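(* Let $M$ be an analytic manifold modelled on an ultrametric Banach space over a complete ultrametric field $\mathbb{K}$. Let $M_0\subseteq M$ be open, $f\colon M_0\to M$ be an analytic mapping, and $p\in M_0$ be a fixed point of $f$. Assume that $T_p(f)$ is an automorphism and that $T_p(M)$ has a centre subspace $T_p(M)_{\mathrm{c}}$ with respect to $T_p(f)$. Then: (a) There exists a centre manifold $N$ around $p$ with respect to $f$. (b) The germ of $N$ at $p$ is uniquely determined (i.e., $N_1\sim_p N_2$ for any two centre manifolds $N_1,N_2$ around $p$ with respect to $f$). (c) For $N$ a centre manifold around $p$ with respect to $f$, each neighbourhood of $p$ in $N$ contains an open neighbourhood $\Omega$ of $p$ in $N$ which is a centre manifold around $p$ with respect to $f$, a submanifold of $M$, stable under $f$ (i.e., $f(\Omega)=\Omega$), and for which $f|_\Omega\colon\Omega\to\Omega$ is a diffeomorphism.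
   Context: A complete ultrametric field is a field $\mathbb{K}$ with an absolute value $|.|$ satisfying $|x+y|\le\max\{|x|,|y|\}$, whose associated metric defines a non-discrete topology and is complete. An ultrametric Banach space over $\mathbb{K}$ is a complete normed $\mathbb{K}$-vector space whose norm satisfies $\|x+y\|\le\max\{\|x\|,\|y\|\}$. $B^E_r(x)=\{y\in E:\|y-x\|<r\}$. Analytic maps: for ultrametric Banach spaces $E,F$, a continuous homogeneous polynomial $p_k\colon E\to F$ of degree $k$ is a map $x\mapsto\beta(x,\ldots,x)$ with $\beta\colon E^k\to F$ continuous $k$-linear (constant for $k=0$), and $\|p_k\|$ is the infimum of $\|\beta\|$ over all such $\beta$. A map $f\colon U\to F$ on an open set $U\subseteq E$ is analytic if for each $x\in U$ there are such $p_k$, $k\in\mathbb{N}_0$, with $\rho:=\sup\{r\ge 0: \|p_k\|r^k\to 0\}>0$, and $r\in(0,\rho]$ with $B^E_r(x)\subseteq U$ and $f(x+y)=\sum_k p_k(y)$ for $y\in B^E_r(0)$. Diffeomorphisms are analytic with analytic inverse. Analytic manifolds modelled on $E$, tangent spaces and tangent maps are defined as usual (Hausdorff space with a maximal atlas of charts onto open subsets of $E$ with analytic transition maps). A subset $N\subseteq M$ is a submanifold if there is a complemented vector subspace $F$ of the modelling space such that each point of $N$ lies in the domain $U$ of a chart $\phi\colon U\to V$ of $M$ with $\phi(N\cap U)=F\cap V$. An analytic manifold $N$ is an immersed submanifold of $M$ if $N\subseteq M$ as a set and the inclusion map $N\to M$ is an immersion (tangent maps injective with complemented image); tangent spaces of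 $N$ are identified with subspaces of those of $M$. Centre subspaces: let $E$ be an ultrametric Banach space and $\alpha\colon E\to E$ an automorphism (continuous linear with continuous linear inverse). An $\alpha$-invariant vector subspace $E_{\mathrm{c}}\subseteq E$ is a centre subspace with respect to $\alpha$ if there exist $\alpha$-invariant vector subspaces $E_{\mathrm{s}},E_{\mathrm{u}}$ with $E=E_{\mathrm{s}}\oplus E_{\mathrm{c}}\oplus E_{\mathrm{u}}$ and an ultrametric norm $\|.\|$ on $E$ defining its topology such that (i) $\|x+y+z\|=\max\{\|x\|,\|y\|,\|z\|\}$ for $x\in E_{\mathrm{s}}$, $y\in E_{\mathrm{c}}$, $z\in E_{\mathrm{u}}$; (ii) $\|\alpha(x)\|=\|x\|$ for all $x\in E_{\mathrm{c}}$; (iii) $\|\alpha_1\|<1$ and $\frac{1}{\|\alpha_3^{-1}\|}>1$ for operator norms with respect to $\|.\|$, where $\alpha_1:=\alpha|_{E_{\mathrm{s}}}$, $\alpha_3:=\alpha|_{E_{\mathrm{u}}}$ (and $\frac10:=\infty$). These subspaces are uniquely determined. Centre manifolds: an immersed submanifold $N\subseteq M_0$ is a centre manifold around $p$ with respect to $f$ if $p\in N$; $T_p(N)=T_p(M)_{\mathrm{c}}$; $f(N)\subseteq N$; and $f|_N\colon N\to N$ is analytic. Germs: for immersed submanifolds $N_1,N_2\subseteq M$ containing $p$, $N_1\sim_p N_2$ means that there is an open neighbourhood $U$ of $p$ in $N_1$ which is also an open neighbourhood of $p$ in $N_2$ and on which $N_1$ and $N_2$ induce the same analytic manifold structure. The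 germ of $N$ at $p$ is its $\sim_p$-equivalence class. *)

(* Defs.v *)
From HB Require Import structures.
From mathcomp Require Import all_boot all_order all_algebra.
From mathcomp Require Import all_classical all_reals all_analysis.
Set Implicit Arguments.
Unset Strict Implicit.
Unset Printing Implicit Defensive.
Import Order.TTheory GRing.Theory Num.Theory.
Import numFieldNormedType.Exports.
Local Open Scope classical_set_scope.
Local Open Scope ring_scope.

Definition norm_complete (R : realType) (V : zmodType) (nu : V -> R) : Prop :=
  forall u : nat -> V,
    (forall e, 0 < e -> exists N, forall m n, (N <= m)%N -> (N <= n)%N ->
       nu (u m - u n) < e) ->
    exists l, forall e, 0 < e -> exists N, forall n, (N <= n)%N ->
       nu (u n - l) < e.

Record ultraField (R : realType) := UltraField {
  uf_field :> fieldType ;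
  absv : uf_field -> R ;
  absv_ge0 : forall x, 0 <= absv x ;
  absv_eq0 : forall x, absv x = 0 <-> x = 0 ;
  absvM : forall x y, absv (x * y) = absv x * absv y ;
  absv_ultra : forall x y, absv (x + y) <= Num.max (absv x) (absv y) ;
  absv_nondiscrete : forall e, 0 < e -> exists2 x, x != 0 & absv x < e ;
  absv_complete : norm_complete absv
}.

Record is_ultranorm (R : realType) (K : ultraField R) (V : lmodType K)
    (nu : V -> R) : Prop := IsUltranorm {
  ultranorm_ge0 : forall x, 0 <= nu x ;
  ultranorm_eq0 : forall x, nu x = 0 <-> x = 0 ;
  ultranormZ : forall (a : K) x, nu (a *: x) = absv a * nu x ;
  ultranorm_ultra : forall x y, nu (x + y) <= Num.max (nu x) (nu y)
}.

(* The carrier is a bare type so that both the module structure ub_class and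
   the metric topology of the norm, declared below, are canonical on it. *)
Record ultraBanach (R : realType) (K : ultraField R) := UltraBanach {
  ub_sort :> Type ;
  ub_class : GRing.Lmodule K ub_sort ;
  unorm : GRing.Lmodule.Pack ub_class -> R ;
  unormP : is_ultranorm unorm ;
  unorm_complete : norm_complete unorm
}.

HB.instance Definition _ (R : realType) (K : ultraField R)
  (E : ultraBanach K) := ub_class E.

Section norm_topology.
Context (R : realType) (K : ultraField R) (E : ultraBanach K).
Let d (x y : E) : R := unorm (x - y).

Let absv1 : absv (1 : K) = 1.
Proof.
have := absvM (1 : K) 1; rewrite mulr1 => h.
have n0 : absv (1 : K) != 0.
  by apply/eqP => /absv_eq0/eqP; rewrite oner_eq0.
by apply: (mulfI n0); rewrite -h mulr1.
Qed.

Lemma unormN (x : E) : unorm (- x) = unorm x.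
Proof.
have e : absv (-1 : K) = 1.
  have h : absv (-1 : K) * absv (-1 : K) = 1 by rewrite -absvM mulrNN mulr1.
  apply/eqP; rewrite -[_ == _](@eqrXn2 _ 2) ?ler01 ?absv_ge0//.
  by rewrite expr1n expr2 h.
by rewrite -scaleN1r (ultranormZ (unormP E)) e mul1r.
Qed.

Let dxx x : d x x = 0.
Proof. by rewrite /d subrr; apply/(ultranorm_eq0 (unormP E)). Qed.

Let d_pos x y : d x y = 0 -> x = y.
Proof. by move=> /(ultranorm_eq0 (unormP E))/eqP; rewrite subr_eq0 => /eqP. Qed.

Let d_sym x y : d x y = d y x.
Proof. by rewrite /d -unormN opprB. Qed.

Let d_triangle y x z : d x z <= d x y + d y z.
Proof.
rewrite /d -(subrKA y); apply: le_trans (ultranorm_ultra (unormP E) _ _) _.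
by rewrite ge_max lerDl lerDr !(ultranorm_ge0 (unormP E)).
Qed.

HB.instance Definition _ :=
  @isMetric.Build R (ub_sort E) d dxx d_pos d_sym d_triangle.
End norm_topology.


Section analytic.
Context (R : realType) (K : ultraField R) (E F : ultraBanach K).

Definition cont_multilinear k (b : ('I_k -> E) -> F) : Prop :=
  (forall v i (a : K) (x y : E),
     b (dfwith v i (a *: x + y)) = a *: b (dfwith v i x) + b (dfwith v i y))
  /\ continuous (b : {ptws 'I_k -> E} -> F).

Definition multilinear_norm k (b : ('I_k -> E) -> F) : R :=
  inf [set C | 0 <= C /\ forall v, unorm (b v) <= C * \prod_i unorm (v i)].

Definition polarizes k (b : ('I_k -> E) -> F) (p : E -> F) : Prop :=
  cont_multilinear b /\ forall x, p x = b (fun=> x).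

Definition cont_hompoly k (p : E -> F) : Prop :=
  exists b : ('I_k -> E) -> F, polarizes b p.

Definition hompoly_norm k (p : E -> F) : R :=
  inf [set multilinear_norm b | b in [set b : ('I_k -> E) -> F | polarizes b p]].

Definition conv_radius (p : nat -> E -> F) : \bar R :=
  ereal_sup [set r%:E | r in
    [set r : R | 0 <= r /\ hompoly_norm k (p k) * r ^+ k @[k --> \oo] --> (0 : R)]].

(* The ball condition forces U to be open. *)
Definition analytic_on (U : set E) (f : E -> F) : Prop :=
  forall x, U x -> exists p : nat -> E -> F,
    [/\ forall k, cont_hompoly k (p k),
        (0 < conv_radius p)%E
      & exists r : \bar R, [/\ (0 < r)%E, (r <= conv_radius p)%E
        & forall y : E, ((unorm y)%:E < r)%E ->
            U (x + y) /\ (\sum_(k < n) p k y) @[n --> \oo] --> f (x + y)]].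

Definition is_differential (f : E -> F) (x : E) (A : {linear E -> F}) : Prop :=
  continuous A /\
  forall e : R, 0 < e ->
    \forall y \near x, unorm (f y - f x - A (y - x)) <= e * unorm (y - x).

(* Unique when it exists, as the field is not discrete; analytic maps are
   differentiable, with differential the linear term of the expansion. *)
Definition differential (f : E -> F) (x : E) : {linear E -> F} :=
  get (is_differential f x).

End analytic.

(* Topological vector spaces are passed as a vector space V with its
   neighbourhood filters nb: mathcomp-analysis only joins topologies and
   modules over ordered scalars, and tangent spaces carry no preferred norm. *)
Section topological_modules.
Context (R : realType) (K : ultraField R) (V : lmodType K).
Implicit Type nb : V -> set_system V.

Definition complemented_for (S : set V) nb : Prop :=
  exists pi : {linear V -> V},
    [/\ forall x, pi @ nb x --> nb (pi x), forall x, pi (pi x) = pi x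
      & range pi = S].

Definition automorphism_for (alpha : {linear V -> V}) nb : Prop :=
  (forall x, alpha @ nb x --> nb (alpha x)) /\
  exists beta : {linear V -> V},
    [/\ forall x, beta @ nb x --> nb (beta x), cancel alpha beta
      & cancel beta alpha].

Definition norm_defines_topology (nu : V -> R) nb : Prop :=
  forall x U, nb x U <-> exists2 r, 0 < r & [set y | nu (y - x) < r] `<=` U.

Definition invariant_subspace (alpha : V -> V) (S : set V) : Prop :=
  GRing.submod_closed (mem S) /\ forall x, S x -> S (alpha x).

Definition direct_sum3 (S1 S2 S3 : set V) : Prop :=
  forall v, exists! t : V * V * V,
    [/\ S1 t.1.1, S2 t.1.2, S3 t.2 & v = t.1.1 + t.1.2 + t.2].

Definition opnorm_on (nu : V -> R) (S : set V) (alpha : V -> V) : \bar R :=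
  ereal_inf [set C%:E | C in
    [set C | 0 <= C /\ forall x, S x -> nu (alpha x) <= C * nu x]].

(* The inverse of \bar R satisfies 0^-1 = +oo.  On an invariant summand of V,
   a bijective alpha restricts to a bijection, so beta is the inverse of
   alpha on Eu. *)
Definition centre_subspace_for (alpha : {linear V -> V}) (Ec : set V) nb
    : Prop :=
  invariant_subspace alpha Ec /\
  exists Es Eu : set V, exists nu : V -> R,
    [/\ invariant_subspace alpha Es, invariant_subspace alpha Eu,
        direct_sum3 Es Ec Eu,
        is_ultranorm nu /\ norm_defines_topology nu nb
      & [/\ forall x y z, Es x -> Ec y -> Eu z ->
              nu (x + y + z) = Num.max (nu x) (Num.max (nu y) (nu z)),
            forall x, Ec x -> nu (alpha x) = nu x,
            (opnorm_on nu Es alpha < 1)%E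
          & exists beta : V -> V, [/\ cancel alpha beta, cancel beta alpha
              & (1 < (opnorm_on nu Eu beta)^-1)%E]]].

End topological_modules.

Notation complemented S := (complemented_for S (fun x => nbhs x)).
Notation automorphism alpha := (automorphism_for alpha (fun x => nbhs x)).
Notation centre_subspace alpha S :=
  (centre_subspace_for alpha S (fun x => nbhs x)).

(* cmap and cinv are total; only their values on the domain cdom and on the
   image cimg matter. *)
Record chart (R : realType) (K : ultraField R) (M : Type) (E : ultraBanach K) :=
  Chart { cdom : set M ; cmap : M -> E ; cinv : E -> M }.

Section charts.
Context (R : realType) (K : ultraField R) (E : ultraBanach K).
Context (M : topologicalType).
Implicit Types c d : chart M E.

Definition cimg c : set E := cmap c @` cdom c.

Definition is_chart c : Prop :=
  [/\ open (cdom c), open (cimg c), {in cdom c, cancel (cmap c) (cinv c)},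
      {in cdom c, continuous (cmap c)} & {in cimg c, continuous (cinv c)}].

Definition analytic_transition c d : Prop :=
  analytic_on (cmap c @` (cdom c `&` cdom d)) (cmap d \o cinv c).

Definition compatible c d : Prop :=
  analytic_transition c d /\ analytic_transition d c.

End charts.

Record manifold (R : realType) (K : ultraField R) (E : ultraBanach K) :=
  Manifold {
    mf_sort :> topologicalType ;
    atlas : set (chart mf_sort E) ;
    mf_hausdorff : hausdorff_space mf_sort ;
    atlas_chart : forall c, atlas c -> is_chart c ;
    atlas_cover : forall x, exists2 c, atlas c & cdom c x ;
    atlas_compatible : forall c d, atlas c -> atlas d -> compatible c d ;
    atlas_maximal : forall c, is_chart c ->
      (forall d, atlas d -> compatible c d) -> atlas c
  }.

Section tangent_space.
Context (R : realType) (K : ultraField R) (E : ultraBanach K) (M : manifold E).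
Variable p : M.

Definition charts_at := {c : chart M E | atlas c /\ cdom c p}.

(* A tangent vector at p is the family of its coordinates in all charts
   around p. *)
Definition is_tangent : set (charts_at -> E) :=
  [set v | forall c d : charts_at,
     v d = differential (cmap (sval d) \o cinv (sval c)) (cmap (sval c) p) (v c)].

Definition tangent_pred : {pred charts_at -> E} := mem is_tangent.

Fact tangent_submod : GRing.submod_closed tangent_pred.
Proof.
split=> [|a u v]; rewrite /tangent_pred !inE /=.
  by move=> c d; rewrite linear0.
by move=> hu hv c d /=; rewrite !fctE linearP -hu -hv.
Qed.

HB.instance Definition _ :=
  GRing.isSubmodClosed.Build K (charts_at -> E) tangent_pred tangent_submod.

Record tangent := Tangent {
  tcoord : charts_at -> E ;
  tcoordP : tcoord \in tangent_pred
}.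

HB.instance Definition _ := [isSub for tcoord].
HB.instance Definition _ := [Choice of tangent by <:].
HB.instance Definition _ := [SubChoice_isSubLmodule of tangent by <:].

(* The coarsest topology making all coordinates v |-> tcoord v c continuous;
   each of them is then a linear homeomorphism onto E. *)
HB.instance Definition _ := Topological.copy tangent
  (initial_topology (tcoord : tangent -> prod_topology (fun=> (E : Type)))).

End tangent_space.


Section maps.
Context (R : realType) (K : ultraField R) (E F : ultraBanach K).
Context (M : manifold E) (N : manifold F).

Definition analytic_map_on (U : set M) (f : M -> N) : Prop :=
  {in U, continuous f} /\
  forall (c : chart M E) (d : chart N F), atlas c -> atlas d ->
    analytic_on (cmap c @` (U `&` cdom c `&` f @^-1` cdom d))
                (cmap d \o f \o cinv c).

Definition is_tangent_map (f : M -> N) (p : M) (q : N)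
    (A : {linear tangent p -> tangent q}) : Prop :=
  forall (v : tangent p) (c : charts_at p) (d : charts_at q),
    tcoord (A v) d =
    differential (cmap (sval d) \o f \o cinv (sval c)) (cmap (sval c) p)
      (tcoord v c).

(* To be used with q = f p only; q is a separate argument so that the tangent
   map at a fixed point p is an endomorphism of tangent p.  It exists by the
   chain rule when f is analytic near p, and is unique. *)
Definition tangent_map (f : M -> N) (p : M) (q : N) :
    {linear tangent p -> tangent q} :=
  get (is_tangent_map f (p := p) (q := q)).

Definition immersion (i : M -> N) : Prop :=
  analytic_map_on setT i /\
  forall x, injective (tangent_map i x (i x)) /\
            complemented (range (tangent_map i x (i x))).

Definition immersed_submanifold (i : M -> N) : Prop :=
  injective i /\ immersion i.

End maps.

Definition diffeomorphism (R : realType) (K : ultraField R)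
    (E F : ultraBanach K) (M : manifold E) (N : manifold F) (f : M -> N) : Prop :=
  analytic_map_on setT f /\
  exists g : N -> M, [/\ cancel f g, cancel g f & analytic_map_on setT g].

Section analytic_restriction.
Context (R : realType) (K : ultraField R) (E F : ultraBanach K).

Lemma nbhs_unormP (x : E) (U : set E) :
  nbhs x U <-> exists2 r : R, 0 < r & [set y | unorm (y - x) < r] `<=` U.
Proof.
have ballE r : ball x r = [set y | unorm (y - x) < r] :> set E.
  rewrite ballEmdist; apply/seteqP; split=> y /=;
    by rewrite /mdist /= -unormN opprB.
split=> [/nbhs_ballP[r r0 h]|[r r0 h]].
  by exists r => //; rewrite -ballE.
by apply/nbhs_ballP; exists r => //; rewrite ballE.
Qed.

Lemma analytic_on_sub (U V : set E) (f g : E -> F) :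
  open V -> V `<=` U -> {in V, f =1 g} -> analytic_on U f -> analytic_on V g.
Proof.
move=> oV VU fg af x Vx; have [p [hp rho0 [r [r0 rrho h]]]] := af x (VU _ Vx).
have /nbhs_unormP[s s0 sV] : nbhs x V by exact: open_nbhs_nbhs.
have Vxy y : unorm y < s -> V (x + y).
  by move=> ys; apply: sV; rewrite /= addrAC subrr add0r.
exists p; split=> //; exists (Order.min r s%:E); split.
- by rewrite lt_min r0 lte_fin.
- by rewrite ge_min rrho.
- move=> y; rewrite lt_min lte_fin => /andP[yr ys].
  by split; [exact: Vxy|rewrite -fg ?inE; [exact: (h y yr).2|exact: Vxy]].
Qed.

End analytic_restriction.

Section chart_restriction.
Context (R : realType) (K : ultraField R) (E : ultraBanach K).

Lemma open_in_preimage (S T : topologicalType) (A : set S) (f : S -> T)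
    (W : set T) :
  open A -> {in A, continuous f} -> open W -> open (A `&` f @^-1` W).
Proof.
move=> oA cf oW; rewrite openE => x [Ax Wfx]; apply: filterI.
  exact: open_nbhs_nbhs.
by apply: (cf x); [rewrite inE|exact: open_nbhs_nbhs].
Qed.

Lemma cinvK (M : topologicalType) (c : chart M E) x :
  is_chart c -> cdom c x -> cinv c (cmap c x) = x.
Proof. by move=> [_ _ h _ _] cx; apply: h; rewrite inE. Qed.

Lemma open_chart_image (M : topologicalType) (c : chart M E) (W : set M) :
  is_chart c -> open W -> open (cmap c @` (cdom c `&` W)).
Proof.
move=> hc oW; have [od oi _ _ ci] := hc.
rewrite (_ : _ @` _ = cimg c `&` cinv c @^-1` W).
  exact: open_in_preimage.
apply/seteqP; split=> [_ [x [cx Wx] <-]|_ [[x cx <-]]] /=.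
  by split; [exists x|rewrite /= (cinvK hc)].
by rewrite (cinvK hc) // => Wx; exists x.
Qed.

(* A chart of M that agrees, on its domain, with a chart in the atlas. *)
Lemma atlas_sub (M : manifold E) (c d : chart M E) :
  atlas d -> open (cdom c) -> cdom c `<=` cdom d ->
  {in cdom c, cmap c =1 cmap d} -> {in cimg c, cinv c =1 cinv d} -> atlas c.
Proof.
move=> ad oc cd emap einv.
have hd := atlas_chart ad; have [od oid _ cmd cid] := hd.
have imgE W : cmap c @` (cdom c `&` W) = cmap d @` (cdom d `&` (cdom c `&` W)).
  apply/seteqP; split=> _ [x [hx hW] <-].
    by exists x; [split=> //; exact: cd|rewrite emap ?inE].
  by have [cx Wx] := hW; exists x => //; rewrite emap ?inE.
have cimgE : cimg c = cmap d @` (cdom d `&` cdom c).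
  by rewrite -[cdom c in RHS]setIT -imgE setIT.
have oic : open (cimg c) by rewrite cimgE; exact: open_chart_image.
have hc : is_chart c.
  split=> //.
  - move=> x; rewrite inE => cx; rewrite einv ?inE; last by exists x.
    by rewrite emap ?inE// (cinvK hd)//; exact: cd.
  - move=> x; rewrite inE => cx W; rewrite emap ?inE// => nW.
    have /cmd - /(_ W nW) h : x \in cdom d by rewrite inE; exact: cd.
    have nc : nbhs x (cdom c) by exact: open_nbhs_nbhs.
    apply: filterS (filterI nc h) => y [cy] /=.
    by rewrite emap ?inE.
  - move=> y; rewrite inE => cy W; rewrite einv ?inE// => nW.
    have /cid - /(_ W nW) h : y \in cimg d.
      by rewrite inE; move: cy; rewrite cimgE => -[x [dx _] <-]; exists x.
    have nc : nbhs y (cimg c) by exact: open_nbhs_nbhs.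
    apply: filterS (filterI nc h) => z [cz] /=.
    by rewrite einv ?inE.
apply: atlas_maximal => // e ae; have he := atlas_chart ae.
have [oe _ _ _ _] := he; have [cde ced] := atlas_compatible ad ae; split.
- apply: analytic_on_sub cde; rewrite ?imgE.
  + by apply: open_chart_image => //; exact: openI.
  + by move=> _ [x [dx [cx ex]] <-]; exists x.
  + move=> y; rewrite inE -imgE => -[x [cx ex] <-] /=.
    by rewrite einv// inE; exists x.
- apply: analytic_on_sub ced.
  + exact: open_chart_image.
  + by move=> _ [x [ex cx] <-]; exists x => //; split=> //; exact: cd.
  + move=> y; rewrite inE => -[x [ex cx] <-] /=.
    by rewrite (cinvK he)// emap ?inE.
Qed.

End chart_restriction.

Section open_submanifold.
Context (R : realType) (K : ultraField R) (E : ultraBanach K).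
Context (N : manifold E) (W : set N).
Hypothesis oW : open W.
Local Notation T := (set_type W).

(* c is the chart d of N, whose domain is contained in W, viewed on W *)
Definition chart_on_sub (c : chart T E) (d : chart N E) : Prop :=
  [/\ set_val @` cdom c = cdom d,
      forall x : T, cdom c x -> cmap c x = cmap d (set_val x)
    & forall y, cimg c y -> set_val (cinv c y) = cinv d y].

Definition sub_atlas : set (chart T E) :=
  [set c | exists2 d, atlas d & chart_on_sub c d].

Let val_inj : injective (set_val : T -> N).
Proof. by move=> x y; rewrite !set_valE => /val_inj. Qed.

Let valW (x : T) : W (set_val x).
Proof. by rewrite set_valE; case: x => x /=; rewrite inE. Qed.

Let cont_val : continuous (set_val : T -> N).
Proof. exact: initial_continuous. Qed.

Let open_val (A : set T) : open A -> open (set_val @` A).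
Proof.
case=> B oB <-; rewrite (_ : _ @` _ = W `&` B); first exact: openI.
apply/seteqP; split=> [_ [x Bx <-]|x [Wx Bx]]; first by split.
by exists (exist _ x (mem_set Wx)) => //=; rewrite set_valE.
Qed.

Let cvg_val (S : topologicalType) (f : S -> T) x :
  {for x, continuous (set_val \o f)} -> {for x, continuous f}.
Proof.
move=> h A [_ [[B oB <-] Bfx BA]].
have nB : nbhs x ((set_val \o f) @^-1` B) by apply: h; exact: open_nbhs_nbhs.
by apply: (filterS _ nB : nbhs x (f @^-1` A)) => y By; exact: BA.
Qed.

Let cimg_sub c d : chart_on_sub c d -> forall V,
  cmap c @` (cdom c `&` set_val @^-1` V) = cmap d @` (cdom d `&` V).
Proof.
move=> [dE mE _] V; apply/seteqP; split=> [_ [x [cx Vx] <-]|_ [x [dx Vx] <-]].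
  by exists (set_val x); [split=> //; rewrite -dE; exists x|rewrite mE].
move: dx Vx; rewrite -dE => -[z cz <-] Vz; exists z; first by split.
by rewrite mE.
Qed.

Let cimgE c d : chart_on_sub c d -> cimg c = cimg d.
Proof. by move=> h; have := cimg_sub h setT; rewrite preimage_setT !setIT. Qed.

Let is_chart_sub c d : is_chart d -> chart_on_sub c d -> is_chart c.
Proof.
move=> hd h; have [od oid kd cd cid] := hd; have [dE mE iE] := h.
have domE : cdom c = set_val @^-1` cdom d.
  apply/seteqP; split=> x; first by rewrite /= -dE => cx; exists x.
  by rewrite /= -dE => -[y cy /val_inj <-].
have oc : open (cdom c).
  by rewrite domE; move/continuousP: cont_val; apply.
split=> //.
- by rewrite (cimgE h).
- move=> x; rewrite inE => cx; apply: val_inj.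
  rewrite iE; last by exists x.
  by rewrite mE// (cinvK hd)// -dE; exists x.
- move=> x; rewrite inE => cx A; rewrite mE// => nA.
  have /cd - /(_ A nA) : set_val x \in cdom d by rewrite inE -dE; exists x.
  move=> /cont_val h'; have nc : nbhs x (cdom c) by exact: open_nbhs_nbhs.
  by apply: filterS (filterI nc h') => y [cy] /=; rewrite mE.
- move=> y; rewrite inE => cy; apply: cvg_val => A /=; rewrite iE// => nA.
  have /cid - /(_ A nA) h' : y \in cimg d by rewrite inE -(cimgE h).
  have nc : nbhs y (cimg c).
    by apply: open_nbhs_nbhs; split=> //; rewrite (cimgE h).
  by apply: filterS (filterI nc h') => z [cz] /=; rewrite iE.
Qed.

Let transition_sub c d c' d' : chart_on_sub c d -> chart_on_sub c' d' ->
  is_chart d -> is_chart d' ->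
  analytic_transition c c' <-> analytic_transition d d'.
Proof.
move=> h h' hd hd'.
have domE : cdom c' = set_val @^-1` cdom d'.
  have [dE _ _] := h'.
  apply/seteqP; split=> x; first by rewrite /= -dE => cx; exists x.
  by rewrite /= -dE => -[y cy /val_inj <-].
have iE : cmap c @` (cdom c `&` cdom c') = cmap d @` (cdom d `&` cdom d').
  by rewrite domE (cimg_sub h).
have [od' _ _ _ _] := hd'.
have oi : open (cmap d @` (cdom d `&` cdom d')) by exact: open_chart_image.
have fE : {in cmap d @` (cdom d `&` cdom d'),
    cmap c' \o cinv c =1 cmap d' \o cinv d}.
  move=> y; rewrite -iE inE => -[x [cx c'x] <-] /=.
  have [_ _ iE1] := h; have [_ mE' _] := h'.
  have hc := is_chart_sub hd h.
  have := iE1 (cmap c x); rewrite (cinvK hc)// => <-; last by exists x.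
  by rewrite mE'.
rewrite /analytic_transition iE.
by split; apply: analytic_on_sub => // y yy; rewrite fE.
Qed.

Let sub_hausdorff : hausdorff_space T.
Proof.
move=> x y h; apply: val_inj; apply: (mf_hausdorff (m := N)) => A B nA nB.
have [z [Az Bz]] := h _ _ (cont_val nA) (cont_val nB).
by exists (set_val z).
Qed.

Let sub_compatible c d : sub_atlas c -> sub_atlas d -> compatible c d.
Proof.
move=> [c' ac hc] [d' ad hd]; have [h1 h2] := atlas_compatible ac ad.
by split; [apply/(transition_sub hc hd)|apply/(transition_sub hd hc)] => //;
  exact: atlas_chart.
Qed.

(* the restriction of a chart of N to W; x0 is a junk value *)
Let restr (x0 : T) (d : chart N E) : chart T E :=
  Chart (set_val @^-1` cdom d) (cmap d \o set_val)
    (fun y => insubd x0 (cinv d y)).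

Let restrN (d : chart N E) : chart N E := Chart (cdom d `&` W) (cmap d) (cinv d).

Let restrN_atlas d : atlas d -> atlas (restrN d).
Proof.
move=> ad; have [od _ _ _ _] := atlas_chart ad.
by apply: (atlas_sub ad) => //=; exact: openI.
Qed.

Let restrP x0 d : atlas d -> chart_on_sub (restr x0 d) (restrN d).
Proof.
move=> ad; split=> //=.
  apply/seteqP; split=> [_ [x dx <-]|x [dx Wx]]; first by split.
  by exists (exist _ x (mem_set Wx)) => //=; rewrite set_valE.
move=> _ [x /= dx <-]; rewrite (cinvK (atlas_chart ad))//.
by rewrite !set_valE insubdK// inE -set_valE.
Qed.

Let sub_cover x : exists2 c, sub_atlas c & cdom c x.
Proof.
have [d ad dx] := atlas_cover (set_val x).
by exists (restr x d) => //; exists (restrN d);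
  [exact: restrN_atlas|exact: restrP].
Qed.

Let sub_maximal c : is_chart c -> (forall d, sub_atlas d -> compatible c d) ->
  sub_atlas c.
Proof.
move=> hc hcomp; have [oc oic kc cc cic] := hc.
pose m (x : N) : E :=
  if pselect (W x) is left Wx then cmap c (exist _ x (mem_set Wx)) else 0.
have mE (x : T) : m (set_val x) = cmap c x.
  rewrite /m; case: pselect => [Wx|]; last by move=> /(_ (valW x)).
  by congr cmap; apply: val_inj; move: (set_val x) Wx => y Wy; rewrite set_valE.
pose d : chart N E := Chart (set_val @` cdom c) m (set_val \o cinv c).
have cd : chart_on_sub c d by split.
have hd : is_chart d.
  split=> /=.
  - exact: open_val.
  - by rewrite -(cimgE cd).
  - by move=> x; rewrite inE => -[z cz <-]; rewrite mE (cinvK hc).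
  - move=> x; rewrite inE => -[z cz <-] A; rewrite mE => nA.
    have /cc - /(_ A nA) : z \in cdom c by rewrite inE.
    rewrite /= nbhsE => -[B [oB Bz] BA].
    rewrite /= nbhsE; exists (set_val @` B).
      by split; [exact: open_val|exists z].
    by move=> _ [y By <-] /=; rewrite mE; exact: BA.
  - move=> y; rewrite -(cimgE cd) => yc; apply: continuous_comp.
      exact: cic.
    exact: cont_val.
exists d => //; apply: atlas_maximal => // e ae.
have [[x0 _]|c0] := pselect (exists x0, cdom c x0).
  have hr := restrP x0 ae; have ar := restrN_atlas ae.
  have hre := atlas_chart ar; have [oe _ _ _ _] := atlas_chart ae.
  have [|h1 h2] := hcomp (restr x0 e); first by exists (restrN e).
  have := (transition_sub cd hr hd hre).1 h1.
  have := (transition_sub hr cd hre hd).1 h2.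
  rewrite /compatible /analytic_transition /=.
  have cW : set_val @` cdom c `<=` W by move=> y [z cz <-]; exact: valW.
  by rewrite -[cdom e `&` W `&` _]setIA (setIidr cW) [cdom e `&` W]setIC setIA
    (setIidl cW).
have d0 x : ~ cdom d x by move=> [z cz zx]; apply: c0; exists z.
by split=> y [x [h1 h2] xy]; exfalso; [exact: (d0 x h1)|exact: (d0 x h2)].
Qed.

Definition open_submanifold : manifold E :=
  Manifold sub_hausdorff
    (fun c hc => let: ex_intro2 _ ad h := hc in is_chart_sub (atlas_chart ad) h)
    sub_cover sub_compatible sub_maximal.

End open_submanifold.

Section centre_manifolds.
Context (R : realType) (K : ultraField R) (E : ultraBanach K) (M : manifold E).

Definition adapted_chart (S : set E) (A : set M) (c : chart M E) : Prop :=
  atlas c /\ cmap c @` (A `&` cdom c) = S `&` cimg c.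

Definition is_submanifold (A : set M) : Prop :=
  exists2 S : set E, complemented S &
    forall x, A x -> exists2 c, adapted_chart S A c & cdom c x.

(* The set range i is a submanifold and the manifold structure of N is the one
   it inherits from M: up to an isomorphism j from F onto the complemented
   subspace S = range j of E, adapted charts of M restrict to charts of N. *)
Definition has_submanifold_structure (F : ultraBanach K) (N : manifold F)
    (i : N -> M) : Prop :=
  exists (j : {linear F -> E}) (k : {linear E -> F}),
    [/\ continuous j, continuous k, cancel j k
      & forall x : N, exists (c : chart M E) (d : chart N F),
          [/\ adapted_chart (range j) (range i) c /\ cdom c (i x),
              atlas d, cdom d = i @^-1` cdom c
            & forall y, cdom d y -> j (cmap d y) = cmap c (i y)]].

(* An immersed submanifold of M is given by its inclusion map i : N -> M. *)
Definition centre_manifold (M0 : set M) (f : M -> M) (p : M)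
    (Tc : set (tangent p)) (F : ultraBanach K) (N : manifold F) (i : N -> M)
    : Prop :=
  [/\ immersed_submanifold i,
      range i `<=` M0,
      exists2 q, i q = p & range (tangent_map i q p) = Tc,
      f @` range i `<=` range i
    & exists2 g : N -> N, analytic_map_on setT g & forall x, i (g x) = f (i x)].

(* Two structures on an open subset U agree when the identity of U is analytic
   in both directions; the modelling spaces may differ by an isomorphism. *)
Definition same_germ (p : M) (F1 F2 : ultraBanach K)
    (N1 : manifold F1) (N2 : manifold F2) (i1 : N1 -> M) (i2 : N2 -> M) : Prop :=
  exists U : set M,
    [/\ U p, U `<=` range i1 /\ U `<=` range i2,
        open (i1 @^-1` U) /\ open (i2 @^-1` U),
        exists2 h : N1 -> N2, analytic_map_on (i1 @^-1` U) h &
          forall x, U (i1 x) -> i2 (h x) = i1 x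
      & exists2 h : N2 -> N1, analytic_map_on (i2 @^-1` U) h &
          forall x, U (i2 x) -> i1 (h x) = i2 x].

End centre_manifolds.

(* Main.v *)
(** In a suitable chart and norm, f = alpha + g with alpha = T_p f and g of order at
    least 2.  The two-sided orbits of f that stay in a small ball around p are the
    fixed points of a map Phi_y which propagates the stable component forwards, the
    unstable one backwards, and the centre one both ways from its value y at time 0.
    Since alpha is isometric on the centre part and the norm is ultrametric, Phi_y
    is a contraction, uniformly in time, even on families of power series in y with
    bounded Gauss norm.  So there is exactly one such orbit X_n(y) for each y, and
    it is analytic in y.  The graph y |-> X_0(y) is a centre manifold, on which f
    acts by the invertible map y |-> k (X_1(y)), k being the centre component.

    Conversely, the dynamics of f on any centre manifold is isometric near p in
    centre coordinates, because an analytic map with isometric derivative is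
    isometric on small balls.  Its two-sided orbits thus stay in the ball and lie
    on the graph, whence the uniqueness of the germ; the parts of the graph over
    small balls are the stable neighbourhoods. *)

Require Import Defs.
From HB Require Import structures.
From mathcomp Require Import all_boot all_order all_algebra.
From mathcomp Require Import all_classical all_reals all_analysis.
From mathcomp Require Import ring.
Set Implicit Arguments.
Unset Strict Implicit.
Unset Printing Implicit Defensive.
Import Order.TTheory GRing.Theory Num.Theory.
Import numFieldNormedType.Exports.
Local Open Scope classical_set_scope.
Local Open Scope ring_scope.

(** * Ultrametric series and power series *)

(** The obstacle is the analyticity of limits: over a general [K], a bound for a map on a ball does
    not control the coefficients of its power series. All estimates are therefore made on
    multilinear coefficients. The condition [asball r C], which bounds the coefficient of degree [k]
    by [C / r ^+ k], is stable under sums, compositions and limits without combinatorial factors,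
    because the norm is ultrametric. A point counts as a constant series, so that the same estimates
    also give the pointwise statements.

    The linear part contracts nothing in the centre direction. Yet the contributions of g
    accumulated over arbitrarily many steps are bounded by the largest of them, which replaces the
    cut-offs and weighted norms of the real theory.

    A centre manifold is only assumed to be immersed and mapped into itself. Backward orbits on it
    come from a local inverse theorem, by which a map with isometric derivative sends small balls
    onto small balls; the continuity of the inverse of the derivative of its centre coordinate comes
    from the open mapping theorem. *)

Lemma half_lt (R : realType) (e : R) : 0 < e -> e / 2 < e.
Proof. by move=> e0; rewrite gtr_pMr // invf_lt1 // ltr1n. Qed.

Definition mklinear (K : nzRingType) (V W : lmodType K) (f : V -> W)
    (H : forall a x y, f (a *: x + y) = a *: f x + f y) : {linear V -> W} :=
  HB.pack f (GRing.isLinear.Build K V W *:%R f H).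

Section ultranorm.
Context (R : realType) (K : ultraField R) (E : ultraBanach K).
Implicit Types (x y z : E) (u v : nat -> E).

Lemma unorm_ge0 x : 0 <= unorm x.
Proof. exact: (ultranorm_ge0 (unormP E)). Qed.

Lemma unorm_eq0 x : unorm x = 0 <-> x = 0.
Proof. exact: (ultranorm_eq0 (unormP E)). Qed.

Lemma unorm0 : unorm (0 : E) = 0.
Proof. exact/unorm_eq0. Qed.

Lemma unormZ (a : K) x : unorm (a *: x) = absv a * unorm x.
Proof. exact: (ultranormZ (unormP E)). Qed.

Lemma unorm_gt0 x : x != 0 -> 0 < unorm x.
Proof.
move=> x0; rewrite lt_neqAle unorm_ge0 andbT eq_sym.
by apply/eqP => /unorm_eq0/eqP; apply/negP.
Qed.

Lemma unormD x y : unorm (x + y) <= Num.max (unorm x) (unorm y).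
Proof. exact: (ultranorm_ultra (unormP E)). Qed.

Lemma unormD_le C x y : unorm x <= C -> unorm y <= C -> unorm (x + y) <= C.
Proof. by move=> hx hy; apply: le_trans (unormD _ _) _; rewrite ge_max hx. Qed.

Lemma unormB_le C x y : unorm x <= C -> unorm y <= C -> unorm (x - y) <= C.
Proof. by move=> hx hy; apply: unormD_le => //; rewrite unormN. Qed.

Lemma unormD_lt C x y : unorm x < C -> unorm y < C -> unorm (x + y) < C.
Proof. by move=> hx hy; apply: le_lt_trans (unormD _ _) _; rewrite gt_max hx. Qed.

Lemma unormB_lt C x y : unorm x < C -> unorm y < C -> unorm (x - y) < C.
Proof. by move=> hx hy; apply: unormD_lt => //; rewrite unormN. Qed.

Lemma unormBC x y : unorm (x - y) = unorm (y - x).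
Proof. by rewrite -unormN opprB. Qed.

Lemma unorm_trans_lt C y x z :
  unorm (x - y) < C -> unorm (y - z) < C -> unorm (x - z) < C.
Proof. by move=> h1 h2; rewrite -(subrKA y); apply: unormD_lt. Qed.

Lemma prod_unorm_ge0 (v : nat -> E) k : 0 <= \prod_(i < k) unorm (v i).
Proof. by apply: prodr_ge0 => i _; exact: unorm_ge0. Qed.

Lemma unorm_sum_le (I : Type) (s : seq I) (P : pred I) (f : I -> E) C :
  0 <= C -> (forall i, P i -> unorm (f i) <= C) ->
  unorm (\sum_(i <- s | P i) f i) <= C.
Proof.
move=> C0 h; elim/big_rec: _ => [|i x Pi hx]; first by rewrite unorm0.
by apply: unormD_le => //; exact: h.
Qed.

Lemma unorm_small x : (forall e, 0 < e -> unorm x < e) -> x = 0.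
Proof.
move=> h; apply/eqP; apply: contraT => /unorm_gt0 /h.
by rewrite ltxx.
Qed.

(** Isosceles principle: otherwise [x = (x + y) - y] would be shorter than itself. *)
Lemma unorm_dominant x y : unorm y < unorm x -> unorm (x + y) = unorm x.
Proof.
move=> yx; apply/eqP; rewrite eq_le; apply/andP; split.
  by apply: unormD_le => //; exact: ltW.
rewrite leNgt; apply/negP => h; have := unormB_lt h yx.
by rewrite addrK ltxx.
Qed.

Definition ucvg u l := forall e, 0 < e -> exists N, forall n, (N <= n)%N ->
  unorm (u n - l) < e.

Lemma ucvg_unique u l l' : ucvg u l -> ucvg u l' -> l = l'.
Proof.
move=> h h'; apply/eqP; rewrite -subr_eq0; apply/eqP/unorm_small => e e0.
have [N hN] := h _ e0; have [N' hN'] := h' _ e0.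
apply: (@unorm_trans_lt _ (u (maxn N N'))).
  by rewrite unormBC; apply: hN; rewrite leq_maxl.
by apply: hN'; rewrite leq_maxr.
Qed.

Lemma ucvgD u v l l' : ucvg u l -> ucvg v l' -> ucvg (fun n => u n + v n) (l + l').
Proof.
move=> h h' e e0; have [N hN] := h _ e0; have [N' hN'] := h' _ e0.
exists (maxn N N') => n; rewrite geq_max => /andP[n1 n2].
by rewrite opprD addrACA; apply: unormD_lt; [exact: hN|exact: hN'].
Qed.

Lemma ucvg_le u l C : ucvg u l -> (forall n, unorm (u n) <= C) -> unorm l <= C.
Proof.
move=> h hu; rewrite leNgt; apply/negP => Cl.
have [|N /(_ N (leqnn _)) hN] := h (unorm l).
  by apply: le_lt_trans Cl; apply: le_trans (hu 0%N); exact: unorm_ge0.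
have := unormB_lt (le_lt_trans (hu N) Cl) hN.
by rewrite opprB addrC subrK ltxx.
Qed.

Lemma ucvg_near u v l : ucvg u l ->
  (forall e, 0 < e -> exists N, forall n, (N <= n)%N -> unorm (v n - u n) < e) ->
  ucvg v l.
Proof.
move=> h h' e e0; have [N hN] := h _ e0; have [N' hN'] := h' _ e0.
exists (maxn N N') => n; rewrite geq_max => /andP[n1 n2].
by apply: unorm_trans_lt (hN' _ n2) (hN _ n1).
Qed.

Lemma eq_ucvg u v l : u =1 v -> ucvg u l -> ucvg v l.
Proof. by move=> uv; have -> : u = v by apply/funext. Qed.

Lemma ucvg_cvg u l : (u @ \oo --> l) <-> ucvg u l.
Proof.
split=> [h e e0|h U /nbhs_unormP[r r0 rU]].
  have /h [N _ hN] : nbhs l [set y | unorm (y - l) < e].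
    by apply/nbhs_unormP; exists e.
  by exists N => n Nn; exact: hN.
have [N hN] := h _ r0; exists N => // n /= Nn; apply: rU; exact: hN.
Qed.

Definition usum u l := ucvg (fun n => \sum_(k < n) u k) l.

Lemma usum_unique u l l' : usum u l -> usum u l' -> l = l'.
Proof. exact: ucvg_unique. Qed.

Lemma usumD u v l l' : usum u l -> usum v l' -> usum (fun n => u n + v n) (l + l').
Proof.
move=> h h'; apply: eq_ucvg (ucvgD h h') => n.
by rewrite big_split.
Qed.

Lemma eq_usum u v l : u =1 v -> usum u l -> usum v l.
Proof. by move=> uv; have -> : u = v by apply/funext. Qed.

Lemma usum_le u l C : 0 <= C -> usum u l -> (forall n, unorm (u n) <= C) ->
  unorm l <= C.
Proof. by move=> C0 h hu; apply: ucvg_le h _ => n; exact: unorm_sum_le. Qed.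

Definition null_seq u := forall e, 0 < e -> exists N, forall n, (N <= n)%N ->
  unorm (u n) < e.

(** No summability is required: a block of consecutive terms is no larger than its largest term. *)
Lemma usum_ex u : null_seq u -> exists l, usum u l.
Proof.
move=> h; apply: (@unorm_complete _ _ E) => e e0.
(* Sums only inherit non-strict bounds from their terms; halving [e] restores the strict one. *)
have [N hN] := h _ (divr_gt0 e0 (@ltr0n R 2)); exists N.
have aux m n : (N <= m)%N -> (m <= n)%N ->
    unorm (\sum_(k < n) u k - \sum_(k < m) u k) < e.
  move=> Nm mn; apply: (@le_lt_trans _ _ (e / 2)); last first.
    exact: half_lt.
  rewrite -!(big_mkord xpredT) (big_cat_nat (leq0n m) mn) /= addrAC subrr add0r.
  rewrite big_nat; apply: unorm_sum_le => [|i /andP[mi _]].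
    by rewrite divr_ge0 // ltW.
  by apply/ltW/hN/(leq_trans Nm).
move=> m n Nm Nn; have [mn|/ltnW nm] := leqP m n; last exact: aux.
by rewrite unormBC; exact: aux.
Qed.

Lemma usum_shift u l m : usum u l ->
  usum (fun k => u (m + k)%N) (l - \sum_(k < m) u k).
Proof.
move=> h e e0; have [N hN] := h _ e0; exists N => n Nn.
have := hN (m + n)%N (leq_trans Nn (leq_addl _ _)).
by rewrite big_split_ord /= opprB addrCA addrA.
Qed.

Lemma usum_finite u m : (forall k, (m <= k)%N -> u k = 0) -> usum u (\sum_(k < m) u k).
Proof.
move=> h e e0; exists m => n mn.
rewrite -!(big_mkord xpredT) (big_cat_nat (leq0n m) mn) /= addrAC subrr add0r.
by rewrite big_nat big1 ?unorm0 // => i /andP[mi _]; exact: h.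
Qed.

Lemma usum1 u (k : nat) : (forall n, n != k -> u n = 0) -> usum u (u k).
Proof.
move=> h; have := @usum_finite u k.+1; rewrite big_ord_recr big1 /= ?add0r => [|i _].
  by apply=> n kn; apply: h; rewrite gtn_eqF.
by apply: h; rewrite ltn_eqF.
Qed.

Lemma usum_delay u l m : usum u l ->
  usum (fun n => if (m <= n)%N then u (n - m)%N else 0) l.
Proof.
move=> h e e0; have [N hN] := h _ e0; exists (m + N)%N => n mNn.
have mn : (m <= n)%N by rewrite (leq_trans _ mNn) // leq_addr.
rewrite -(big_mkord xpredT (fun k => if (m <= k)%N then u (k - m)%N else 0)).
rewrite (big_cat_nat (leq0n m) mn) /= big_nat big1 => [|k /andP[_ km]]; last first.
  by rewrite leqNgt km.
rewrite add0r -{1}[m]add0n big_addn big_mkord.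
rewrite (eq_bigr (fun k : 'I_(n - m) => u k)) => [|k _]; last by rewrite leq_addl addnK.
by apply: hN; rewrite leq_subRL.
Qed.

Section double_series.
Variable a : nat -> nat -> E.
Hypothesis ha : forall e, 0 < e -> exists N, forall i j,
  (N <= i)%N || (N <= j)%N -> unorm (a i j) < e.

(** Outside a large square all terms are small, so both iterated sums are limits of the sums over
    squares. *)
Lemma usum_exchange s S t : (forall i, usum (a i) (s i)) -> usum s S ->
  (forall j, usum (a^~ j) (t j)) -> usum t S.
Proof.
move=> hs hS ht.
have aux (a' : nat -> nat -> E) s' : (forall e, 0 < e -> exists N, forall i j,
    (N <= i)%N || (N <= j)%N -> unorm (a' i j) < e) ->
    (forall i, usum (a' i) (s' i)) -> forall e, 0 < e -> exists N, forall M,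
    (N <= M)%N -> unorm (\sum_(i < M) s' i - \sum_(i < M) \sum_(j < M) a' i j) < e.
  move=> ha' hs' e e0; have e'e := half_lt e0; have e'0 : 0 < e / 2 by rewrite divr_gt0.
set e' := e / 2 in e'e e'0 *; have [N hN] := ha' _ e'0.
  exists N => M NM; apply: le_lt_trans e'e.
  rewrite -sumrB; apply: unorm_sum_le => [|i _]; first exact: ltW.
  apply: (usum_le _ (usum_shift M (hs' i))) => [|j]; first exact: ltW.
  by apply/ltW/hN; rewrite (leq_trans NM (leq_addr _ _)) orbT.
apply: (ucvg_near hS) => e e0.
have [N1 h1] := aux _ _ ha hs _ e0.
have [|N2 h2] := aux (fun j i => a i j) t _ ht _ e0.
  by move=> d /ha[N hN]; exists N => i j; rewrite orbC; exact: hN.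
exists (maxn N1 N2) => M; rewrite geq_max => /andP[/h1 H1 /h2 H2].
rewrite exchange_big /= in H2.
by apply: unorm_trans_lt H2 _; rewrite unormBC.
Qed.

End double_series.

(** Delaying row [i] by [i] places turns the antidiagonals into columns, and the order of summation
    can be exchanged. *)
Lemma usum_antidiagonal (a : nat -> nat -> E) s S :
  (forall e, 0 < e -> exists N, forall i j,
    (N <= i)%N || (N <= j)%N -> unorm (a i j) < e) ->
  (forall i, usum (a i) (s i)) -> usum s S ->
  usum (fun n => \sum_(i < n.+1) a i (n - i)%N) S.
Proof.
move=> ha hs hS; pose b i n := if (i <= n)%N then a i (n - i)%N else 0.
apply: (@usum_exchange b _ s S _ _ hS) => [e e0|i|n].
(* If [i] and [n - i] are both below [N], then neither [i] nor [n] reaches [N + N]. *)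
- have [N hN] := ha _ e0; exists (N + N)%N => i n h; rewrite /b.
  case: ifP => [i_n|_]; last by rewrite unorm0.
  apply: hN; have [//|iN] := leqP N i; rewrite leq_subRL //=.
  case/orP: h => [|/(leq_trans _)]; last by apply; rewrite leq_add2r ltnW.
  by move=> /(leq_trans (leq_addr _ _)); rewrite leqNgt iN.
- exact: usum_delay.
- have := @usum_finite (b^~ n) n.+1.
  rewrite (eq_bigr (fun i : 'I_n.+1 => a i (n - i)%N)) => [|i _].
    by apply=> k nk; rewrite /b leqNgt nk.
  by rewrite /b -ltnS ltn_ord.
Qed.

End ultranorm.

Lemma geometric_small (R : realType) (D t e : R) : 0 <= t -> t < 1 -> 0 < e ->
  exists N, forall n, (N <= n)%N -> D * t ^+ n < e.
Proof.
move=> t0 t1 e0; have /cvgrPdist_lt - /(_ e e0) [N _ hN] : D * t ^+ n @[n --> \oo] --> 0.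
  by apply: cvg_geometric; rewrite ger0_norm.
exists N => n /hN /=; rewrite sub0r normrN; apply: le_lt_trans; exact: ler_norm.
Qed.

(** * Multilinear maps and substitution of series into them *)

Section multilinear.
Context (R : realType) (K : ultraField R).
Implicit Types E F : ultraBanach K.

Definition upd (E : Type) (v : nat -> E) i x := fun n => if n == i then x else v n.

(** Fixing the first argument of a multilinear map means composing it with [scons x]; the inductions
    on the number of arguments rest on this. *)
Definition scons (E : Type) (x : E) (v : nat -> E) n := if n is m.+1 then v m else x.

Lemma upd_scons0 (E : Type) (x y : E) v : upd (scons x v) 0 y = scons y v.
Proof. by apply/funext => -[]. Qed.

Lemma upd_sconsS (E : Type) (x y : E) v i :
  upd (scons x v) i.+1 y = scons x (upd v i y).
Proof. by apply/funext => -[|n]. Qed.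

Lemma scons_eta (E : Type) (v : nat -> E) : scons (v 0) (fun n => v n.+1) = v.
Proof. by apply/funext => -[|n]. Qed.

(* k-linear maps are encoded as functions of sequences that only depend on the
   first k entries. *)
Record mlin E F k (b : (nat -> E) -> F) : Prop := MLin {
  mlin_loc : forall v w, (forall i, (i < k)%N -> v i = w i) -> b v = b w ;
  mlin_lin : forall v i a x y, (i < k)%N ->
    b (upd v i (a *: x + y)) = a *: b (upd v i x) + b (upd v i y)
}.

Definition mbound E F k (b : (nat -> E) -> F) (B : R) :=
  forall v, unorm (b v) <= B * \prod_(i < k) unorm (v i).

Lemma mlin0 E F k : mlin k (fun _ : nat -> E => 0 : F).
Proof. by split=> // v i a x y _; rewrite scaler0 addr0. Qed.

Lemma mlin_scons E F k (b : (nat -> E) -> F) x :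
  mlin k.+1 b -> mlin k (fun w => b (scons x w)).
Proof.
move=> h; split=> [v w vw|v i a y z ik].
  by apply: (mlin_loc h) => -[|i] //=; rewrite ltnS; exact: vw.
by rewrite -!upd_sconsS (mlin_lin h).
Qed.

Lemma mlin_head E F k (b : (nat -> E) -> F) w a x y :
  mlin k.+1 b ->
  b (scons (a *: x + y) w) = a *: b (scons x w) + b (scons y w).
Proof. by move=> h; have := mlin_lin h (scons 0 w) a x y (ltn0Sn _); rewrite !upd_scons0. Qed.

Lemma mbound_scons E F k (b : (nat -> E) -> F) B x :
  mbound k.+1 b B -> mbound k (fun w => b (scons x w)) (B * unorm x).
Proof. by move=> h v; have := h (scons x v); rewrite big_ord_recl /= mulrA. Qed.

Lemma mbound_ge0 E F k (b : (nat -> E) -> F) B B' :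
  B <= B' -> mbound k b B -> mbound k b B'.
Proof.
by move=> BB h v; apply: le_trans (h v) _; rewrite ler_wpM2r ?prod_unorm_ge0.
Qed.

Lemma usum_linear E F (L : {linear E -> F}) l u s : 0 <= l ->
  (forall x, unorm (L x) <= l * unorm x) -> usum u s -> usum (L \o u) (L s).
Proof.
move=> l0 Lb h e e0; have l1 : 0 < l + 1 by rewrite ltr_wpDl.
have [N hN] := h _ (divr_gt0 e0 l1); exists N => n /hN.
rewrite ltr_pdivlMr // => hn.
have -> : \sum_(k < n) (L \o u) k = L (\sum_(k < n) u k) by rewrite linear_sum.
rewrite -linearB; apply: le_lt_trans (Lb _) _; apply: le_lt_trans hn.
by rewrite mulrC ler_wpM2l ?unorm_ge0 // lerDl.
Qed.

Section substitution.
Variables (E F G : ultraBanach K).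
Implicit Types (b : (nat -> F) -> G) (c : nat -> nat -> (nat -> E) -> F).

(* The component of degree n of b (c_0, ..., c_{k-1}), where c_j has the
   components c_{j,i}. *)
Fixpoint msubst k b c n (v : nat -> E) : G :=
  if k is k'.+1 then
    \sum_(i < n.+1) msubst k' (fun w => b (scons (c 0 i v) w))
      (fun j => c j.+1) (n - i)%N (fun l => v (i + l)%N)
  else if n == 0 then b (fun=> 0) else 0.

(** Serves multilinearity when the varied argument enters through [c 0], hence through the form left
    for the other factors. *)
Lemma msubst_comb k a b1 b2 c n v :
  msubst k (fun w => a *: b1 w + b2 w) c n v =
  a *: msubst k b1 c n v + msubst k b2 c n v.
Proof.
elim: k b1 b2 c n v => [|k IH] b1 b2 c n v /=.
  by case: eqP => // _; rewrite scaler0 addr0.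
by rewrite scaler_sumr -big_split /=; apply: eq_bigr => i _; rewrite IH.
Qed.

Lemma mlin_msubst k b c n : mlin k b -> (forall j i, mlin i (c j i)) ->
  mlin n (msubst k b c n).
Proof.
move=> hb hc; elim: k b c n hb hc => [|k IH] b c n hb hc /=.
  by case: eqP => [->|_]; [split|exact: mlin0].
split=> [v w vw|v i a x y i_n].
  apply: eq_bigr => i _.
  have -> : c 0 i v = c 0 i w.
    by apply: (mlin_loc (hc 0 i)) => l li; apply: vw; rewrite (leq_trans li) // -ltnS.
  apply: mlin_loc; first by apply: IH => // ; exact: mlin_scons.
  by move=> l li; apply: vw; rewrite -ltn_subRL.
rewrite scaler_sumr -big_split /=; apply: eq_bigr => l _.
have IH' := fun z => IH (fun w => b (scons z w)) (fun j => c j.+1) (n - l)%N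
  (mlin_scons z hb) (fun j => hc j.+1).
(* The first [l] arguments feed [c 0 l] and the others the remaining factors, so exactly one of the
   two sees argument [i]. *)
have [il|li] := ltnP i l.
  have sh z : (fun m => upd v i z (l + m)%N) = fun m => v (l + m)%N.
    by apply/funext => m; rewrite /upd gtn_eqF // ltn_addr.
  rewrite !sh (mlin_lin (hc 0 l)) // -msubst_comb; congr (msubst k _ _ _ _).
  by apply/funext => w; exact: (mlin_head _ _ _ _ hb).
have sh z : (fun m => upd v i z (l + m)%N) = upd (fun m => v (l + m)%N) (i - l)%N z.
  apply/funext => m; rewrite /upd; congr (if _ then _ else _).
  by rewrite -(eqn_add2l l m) subnKC.
have cz z : c 0 l (upd v i z) = c 0 l v.
  by apply: (mlin_loc (hc 0 l)) => m ml; rewrite /upd ltn_eqF // (leq_trans ml).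
rewrite !sh !cz; apply: (mlin_lin (IH' _)).
by rewrite ltn_sub2rE // -ltnS.
Qed.

Variable r : R.
Hypothesis r0 : 0 < r.

(** Submultiplicativity of the Gauss norm: the powers of [r] for the degrees [i] and [n - i]
    multiply to that for [n], and the sum over [i] costs nothing. *)
Lemma mbound_msubst k b B c D n : mbound k b B -> 0 <= B ->
  (forall j i, mbound i (c j i) (D j / r ^+ i)) -> (forall j, 0 <= D j) ->
  mbound n (msubst k b c n) (B * \prod_(j < k) D j / r ^+ n).
Proof.
move=> hb B0 hc D0; elim: k b B c D n hb B0 hc D0 => [|k IH] b B c D n hb B0 hc D0 v /=.
  rewrite big_ord0 mulr1; case: eqP => [->|_].
    by have := hb (fun=> 0); rewrite !big_ord0 expr0 divr1.
  by rewrite unorm0 !mulr_ge0 ?invr_ge0 ?exprn_ge0 ?(ltW r0) ?prod_unorm_ge0.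
have DD m (d : nat -> R) : (forall j, 0 <= d j) -> 0 <= \prod_(i < m) d i.
  by move=> h; apply: prodr_ge0 => i _; exact: h.
have rn m : 0 <= (r ^+ m)^-1 by rewrite invr_ge0 exprn_ge0 // ltW.
apply: unorm_sum_le => [|i _]; first by rewrite !mulr_ge0 ?(DD k.+1 D) ?prod_unorm_ge0.
have hx := hc 0 i v; set x := c 0 i v in hx *.
have i_n : (i <= n)%N by rewrite -ltnS.
have := IH _ _ (fun j => c j.+1) (fun j => D j.+1) (n - i)%N
  (mbound_scons x hb) (mulr_ge0 B0 (unorm_ge0 x)) (fun j => hc j.+1)
  (fun j => D0 j.+1) (fun l => v (i + l)%N).
move/le_trans; apply; rewrite big_ord_recl /=.
have -> : \prod_(l < n) unorm (v l) = \prod_(l < i) unorm (v l) *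
    \prod_(l < n - i) unorm (v (i + l)%N).
  rewrite -(big_mkord xpredT (fun l => unorm (v l))) (big_cat_nat (leq0n i) i_n) /=.
  rewrite big_mkord; congr (_ * _); rewrite -{1}[nat_of_ord i]add0n big_addn big_mkord.
  by apply: eq_bigr => l _; rewrite addnC.
have -> : (r ^+ n)^-1 = (r ^+ i)^-1 * (r ^+ (n - i))^-1.
  by rewrite -invfM -exprD subnKC.
set P := \prod_(l < i) _ in hx *; set Q := \prod_(l < n - i) _.
set S := \prod_(j < k) _.
have -> : B * (D 0%N * S) * ((r ^+ i)^-1 * (r ^+ (n - i))^-1) * (P * Q) =
  B * (D 0%N / r ^+ i * P) * S / r ^+ (n - i) * Q by ring.
apply: ler_wpM2r; first exact: (prod_unorm_ge0 (fun l => v (i + l)%N)).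
apply: ler_wpM2r => //; apply: ler_wpM2r; first exact: (DD k (fun j => D j.+1)).
exact: ler_wpM2l.
Qed.

(** Cauchy product of the first series with the substitution into the other arguments. Its terms are
    at most [Q * (unorm y / r) ^+ (i + j)], which permits the rearrangement along antidiagonals. *)
Lemma usum_msubst k b B c D y g : mlin k b -> mbound k b B -> 0 <= B ->
  (forall j i, mlin i (c j i)) ->
  (forall j i, mbound i (c j i) (D j / r ^+ i)) -> (forall j, 0 <= D j) ->
  unorm y < r -> (forall j, usum (fun i => c j i (fun=> y)) (g j)) ->
  usum (fun n => msubst k b c n (fun=> y)) (b g).
Proof.
move=> hbl hb B0 hcl hc D0 yr.
elim: k b B c D g hbl hb B0 hcl hc D0 => [|k IH] b B c D g hbl hb B0 hcl hc D0 hg /=.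
  rewrite (@mlin_loc _ _ _ _ hbl g (fun=> 0)) //.
  have := @usum1 _ _ G (fun n => if n == 0%N then b (fun=> 0) else 0) 0%N.
  by apply => n /negbTE /= ->.
pose a i j := msubst k (fun w => b (scons (c 0%N i (fun=> y)) w)) (fun j => c j.+1) j (fun=> y).
have IHa i : usum (a i) (b (scons (c 0%N i (fun=> y)) (fun j => g j.+1))).
  apply: (IH _ (B * unorm (c 0%N i (fun=> y))) _ (fun j => D j.+1)) => //.
  - exact: mlin_scons.
  - exact: mbound_scons.
  - by rewrite mulr_ge0 // unorm_ge0.
apply: (usum_antidiagonal (a := a)) IHa _; last first.
  pose L := mklinear (f := fun x => b (scons x (fun j => g j.+1)))
    (fun s x z => mlin_head _ s x z hbl).
  have Lb x : unorm (L x) <= B * \prod_(i < k) unorm (g i.+1) * unorm x.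
    by apply: le_trans (hb _) _; rewrite big_ord_recl /= mulrCA mulrC.
  rewrite -[X in usum _ (b X)]scons_eta; apply: (usum_linear _ Lb (hg 0%N)).
  by rewrite mulr_ge0 // (prod_unorm_ge0 (fun i => g i.+1)).
have t0 : 0 <= unorm y / r by rewrite divr_ge0 ?unorm_ge0 // ltW.
have t1 : unorm y / r < 1 by rewrite ltr_pdivrMr // mul1r.
have DD m (d : nat -> R) : (forall j, 0 <= d j) -> 0 <= \prod_(i < m) d i.
  by move=> h; apply: prodr_ge0 => i _; exact: h.
pose Q := B * \prod_(j < k.+1) D j.
have Q0 : 0 <= Q by rewrite mulr_ge0 ?(DD k.+1 D) //.
have ha i j : unorm (a i j) <= Q * (unorm y / r) ^+ (i + j).
  apply: le_trans (@mbound_msubst k _ (B * unorm (c 0%N i (fun=> y))) _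
    (fun j => D j.+1) j _ _ _ _ (fun=> y)) _ => //.
  - exact: mbound_scons.
  - by rewrite mulr_ge0 // unorm_ge0.
  rewrite prodr_const card_ord /Q big_ord_recl /= exprD !expr_div_n.
  have := hc 0%N i (fun=> y); rewrite prodr_const card_ord => h.
  set S := \prod_(_ < k) _; set Y := unorm y in h *.
  have -> : B * (D 0%N * S) * (Y ^+ i / r ^+ i * (Y ^+ j / r ^+ j)) =
    B * (D 0%N / r ^+ i * Y ^+ i) * S / r ^+ j * Y ^+ j by ring.
  apply: ler_wpM2r; first by rewrite exprn_ge0 ?unorm_ge0.
  apply: ler_wpM2r; first by rewrite invr_ge0 exprn_ge0 ?(ltW r0).
  apply: ler_wpM2r; first exact: (DD k (fun j => D j.+1)).
  exact: ler_wpM2l.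
move=> e e0; have [N hN] := geometric_small Q t0 t1 e0.
exists N => i j ij; apply: le_lt_trans (ha i j) (hN _ _).
by case/orP: ij => h; rewrite (leq_trans h) // ?leq_addr ?leq_addl.
Qed.

End substitution.
End multilinear.

(** * Power series with bounded Gauss norm *)

Section power_series.
Context (R : realType) (K : ultraField R).
Implicit Types E F : ultraBanach K.

(** The coefficients are multilinear maps rather than homogeneous polynomials, since later arguments
    substitute different series for different arguments and change one argument at a time. *)
Record has_series E F (r C : R) (b : nat -> (nat -> E) -> F)
    (f : E -> F) : Prop := HasSeries {
  series_mlin : forall k, mlin k (b k) ;
  series_bound : forall k, mbound k (b k) (C / r ^+ k) ;
  series_sum : forall y, unorm y < r -> usum (fun k => b k (fun=> y)) (f y)
}.

(* f is given on the open ball of radius r by a power series whose Gauss norm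
   is at most C. *)
Definition asball E F (r C : R) (f : E -> F) :=
  exists b, has_series r C b f.

Section basics.
Variables (E F : ultraBanach K) (r : R).
Hypothesis r0 : 0 < r.
Implicit Types (f g : E -> F) (C : R).

Lemma mbound0_ge0 (b : (nat -> E) -> F) B : mbound 0 b B -> 0 <= B.
Proof. by move/(_ (fun=> 0)); rewrite big_ord0 mulr1; apply: le_trans (unorm_ge0 _). Qed.

Lemma asball_ge0 C f : asball r C f -> 0 <= C.
Proof. by move=> [b hb]; have /mbound0_ge0 := series_bound hb 0; rewrite expr0 divr1. Qed.

Lemma mbound_diag k (b : (nat -> E) -> F) C y : mbound k b (C / r ^+ k) ->
  unorm (b (fun=> y)) <= C * (unorm y / r) ^+ k.
Proof.
move/(_ (fun=> y)); rewrite prodr_const card_ord expr_div_n.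
by rewrite mulrAC -mulrA.
Qed.

Lemma ratio_ge0 (y : E) : 0 <= unorm y / r.
Proof. by rewrite divr_ge0 ?unorm_ge0 // ltW. Qed.

Lemma ratio_lt1 (y : E) : unorm y < r -> unorm y / r < 1.
Proof. by move=> yr; rewrite ltr_pdivrMr // mul1r. Qed.

Lemma asball_bound C f y : asball r C f -> unorm y < r -> unorm (f y) <= C.
Proof.
move=> hf yr; have C0 := asball_ge0 hf; have [b hb] := hf.
apply: (usum_le C0 (series_sum hb yr)) => k.
apply: le_trans (mbound_diag y (series_bound hb k)) _.
apply: ler_piMr => //; apply: exprn_ile1; first exact: ratio_ge0.
by apply/ltW/ratio_lt1.
Qed.

Lemma asball_le C C' f : C <= C' -> asball r C f -> asball r C' f.
Proof.
move=> CC [b hb]; exists b; split; [exact: series_mlin hb| |exact: series_sum hb].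
move=> k; apply: mbound_ge0 (series_bound hb k).
by rewrite ler_wpM2r // invr_ge0 exprn_ge0 // ltW.
Qed.

Lemma asball_sub r' C f : 0 < r' -> r' <= r -> asball r C f -> asball r' C f.
Proof.
move=> r'0 rr hf; have C0 := asball_ge0 hf; have [b hb] := hf.
exists b; split; first exact: series_mlin hb.
  move=> k; apply: mbound_ge0 (series_bound hb k).
  by rewrite ler_wpM2l // lef_pV2 ?posrE ?exprn_gt0 // lerXn2r ?nnegrE // ltW.
by move=> y yr; apply: (series_sum hb); exact: lt_le_trans rr.
Qed.

Lemma eq_asball C f g : (forall y, unorm y < r -> f y = g y) ->
  asball r C f -> asball r C g.
Proof.
move=> fg [b hb]; exists b; split; [exact: series_mlin hb|exact: series_bound hb|].
by move=> y yr; rewrite -fg //; exact: series_sum hb _ yr.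
Qed.

Lemma asball_cst C (x : F) : unorm x <= C -> asball r C (fun _ : E => x).
Proof.
move=> xC; have C0 : 0 <= C by apply: le_trans xC; exact: unorm_ge0.
exists (fun k _ => if k == 0%N then x else 0); split.
- by case=> [|k] /=; [split|exact: mlin0].
- case=> [|k] v /=; first by rewrite big_ord0 expr0 divr1 mulr1.
  by rewrite unorm0 !mulr_ge0 ?invr_ge0 ?exprn_ge0 ?(ltW r0) ?prod_unorm_ge0.
- move=> y _; apply: (@usum1 _ _ F (fun k => if k == 0%N then x else 0) 0%N).
  by move=> n /negbTE ->.
Qed.

Lemma asball_linear (L : {linear E -> F}) l :
  (forall x, unorm (L x) <= l * unorm x) -> 0 <= l -> asball r (l * r) L.
Proof.
move=> Lb l0.
exists (fun k v => if k == 1%N then L (v 0%N) else 0); split.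
- case=> [|[|k]] /=; [exact: mlin0| |exact: mlin0].
  split=> [v w -> //|v [|//] a x y _].
  by rewrite /upd /= linearP.
- move=> k v; case: eqP => [->|_].
    by rewrite big_ord_recl big_ord0 mulr1 expr1 mulfK ?gt_eqF.
  by rewrite unorm0 !mulr_ge0 ?invr_ge0 ?exprn_ge0 ?(ltW r0) ?prod_unorm_ge0.
- move=> y _; apply: (@usum1 _ _ F (fun k => if k == 1%N then L y else 0) 1%N).
  by move=> n /negbTE ->.
Qed.

(** Completeness for the Gauss norm: coefficients are summed degree by degree. The two summations
    commute because the terms are at most [c m * (unorm y / r) ^+ k], small as soon as one index is
    large. *)
Lemma asball_sum (f : nat -> E -> F) c C g : (forall m, asball r (c m) (f m)) ->
  (forall m, c m <= C) ->
  (forall e, 0 < e -> exists N, forall m, (N <= m)%N -> c m < e) ->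
  (forall y, unorm y < r -> usum (fun m => f m y) (g y)) ->
  asball r C g.
Proof.
move=> hf cC c0 hg.
have cge0 m : 0 <= c m := asball_ge0 (hf m).
have C0 : 0 <= C by apply: le_trans (cC 0%N).
have [b hb] : exists b, forall m, has_series r (c m) (b m) (f m).
  by have /choice[b hb] := hf; exists b.
have rk k : 0 <= (r ^+ k)^-1 by rewrite invr_ge0 exprn_ge0 // ltW.
have bb m k v : unorm (b m k v) <= c m / r ^+ k * \prod_(i < k) unorm (v i).
  exact: (series_bound (hb m) k v).
have /choice[b' hb'] : forall kv : nat * (nat -> E), exists l : F,
    usum (fun m => b m kv.1 kv.2) l.
  move=> [k v] /=; apply: usum_ex => e e0.
  set A := (r ^+ k)^-1 * \prod_(i < k) unorm (v i).
  have A0 : 0 <= A by rewrite mulr_ge0 ?prod_unorm_ge0.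
  have A1 : 0 < A + 1 by rewrite ltr_wpDl.
  have [N hN] := c0 _ (divr_gt0 e0 A1).
  exists N => m /hN; rewrite ltr_pdivlMr // => h.
  apply: le_lt_trans (bb m k v) _; rewrite -mulrA -/A; apply: le_lt_trans h.
  by rewrite ler_wpM2l // lerDl.
exists (fun k v => b' (k, v)); split.
- move=> k; split.
    move=> v w vw; apply: usum_unique (hb' (k, v)) _.
    apply: eq_usum (hb' (k, w)) => m /=.
    by rewrite (mlin_loc (series_mlin (hb m) k) vw).
  move=> v i a x y ik; apply: usum_unique (hb' (k, _)) _ => /=.
  have ab (z : F) : unorm (a *: z) <= absv a * unorm z by rewrite unormZ.
  have := usumD (usum_linear (L := *:%R a) (absv_ge0 a) ab (hb' (k, upd v i x)))
    (hb' (k, upd v i y)).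
  apply: eq_usum => m /=.
  by rewrite (mlin_lin (series_mlin (hb m) k)).
- move=> k v; apply: usum_le (hb' (k, v)) _ => [|m] /=.
    by rewrite mulr_ge0 ?prod_unorm_ge0 ?mulr_ge0.
  apply: le_trans (bb m k v) _; apply: ler_wpM2r; first exact: prod_unorm_ge0.
  by apply: ler_wpM2r.
- move=> y yr.
  apply: (@usum_exchange _ _ F (fun m k => b m k (fun=> y)) _ (f^~ y)).
  + have t0 := ratio_ge0 y; have t1 := ratio_lt1 yr.
    move=> e e0; have [N1 h1] := c0 _ e0.
    have [N2 h2] := geometric_small C t0 t1 e0.
    have ha m k := mbound_diag y (series_bound (hb m) k).
    have tk1 k : (unorm y / r) ^+ k <= 1 by apply: exprn_ile1 => //; exact: ltW.
    exists (maxn N1 N2) => m k /orP[]; rewrite geq_max => /andP[n1 n2].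
      apply: le_lt_trans (ha m k) _; apply: le_lt_trans (h1 _ n1).
      exact: ler_piMr.
    apply: le_lt_trans (ha m k) _; apply: le_lt_trans (h2 _ n2).
    by rewrite ler_wpM2r // exprn_ge0.
  + by move=> m; exact: series_sum (hb m) _ yr.
  + exact: hg.
  + by move=> k; exact: (hb' (k, fun=> y)).
Qed.

Lemma asballD C f g : asball r C f -> asball r C g ->
  asball r C (fun y => f y + g y).
Proof.
move=> hf hg; have C0 := asball_ge0 hf.
apply: (@asball_sum (fun m => if m == 0%N then f else if m == 1%N then g else fun=> 0)
  (fun m => if (m <= 1)%N then C else 0)).
- case=> [|[|m]] //=; by apply: asball_cst; rewrite unorm0.
- by move=> m; case: ifP.
- by move=> e e0; exists 2%N => m /(leq_trans _) h; rewrite leqNgt h.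
- move=> y yr.
  have := @usum_finite _ _ F
    (fun m => (if m == 0%N then f else if m == 1%N then g else fun=> 0) y) 2.
  by rewrite !big_ord_recl big_ord0 addr0; apply=> -[|[]].
Qed.

End basics.

Section operations.
Variables (E F G : ultraBanach K) (r : R).
Hypothesis r0 : 0 < r.

Lemma asball_comp_linear (L : {linear F -> G}) l (f : E -> F) C :
  (forall x, unorm (L x) <= l * unorm x) -> 0 <= l ->
  asball r C f -> asball r (l * C) (L \o f).
Proof.
move=> Lb l0 [b hb]; exists (fun k v => L (b k v)); split.
- move=> k; split=> [v w vw|v i a x y ik].
    by rewrite (mlin_loc (series_mlin hb k) vw).
  by rewrite (mlin_lin (series_mlin hb k)) // linearP.
- move=> k v; apply: le_trans (Lb _) _; rewrite -!mulrA ler_wpM2l // mulrA.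
  exact: (series_bound hb).
- by move=> y yr; exact: usum_linear l0 Lb (series_sum hb yr).
Qed.

Lemma asball_msubst k (b : (nat -> F) -> G) B (g : nat -> E -> F) C :
  mlin k b -> mbound k b B -> 0 <= B -> (forall j, asball r (C j) (g j)) ->
  asball r (B * \prod_(j < k) C j) (fun y => b (fun j => g j y)).
Proof.
move=> hbl hb B0 hg.
have C0 j : 0 <= C j := asball_ge0 (hg j).
have /choice[c hc] := hg.
exists (msubst k b c); split.
- by move=> n; apply: mlin_msubst => // j i; exact: series_mlin (hc j) i.
- by move=> n; apply: mbound_msubst => // j i; exact: series_bound (hc j) i.
- move=> y yr; apply: (usum_msubst (r := r) r0 hbl hb B0 _ _ C0 yr) => j.
  + by move=> i; exact: series_mlin (hc j) i.
  + by move=> i; exact: series_bound (hc j) i.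
  + exact: series_sum (hc j) _ yr.
Qed.

Lemma asball_diag k (b : (nat -> F) -> G) B (g : E -> F) C :
  mlin k b -> mbound k b B -> 0 <= B -> asball r C g ->
  asball r (B * C ^+ k) (fun y => b (fun=> g y)).
Proof.
move=> hbl hb B0 hg.
by have := asball_msubst hbl hb B0 (fun=> hg); rewrite prodr_const card_ord.
Qed.

(** The difference telescopes when [f] is replaced by [g] in one argument at a time. Each step has
    one factor [d] and [k] factors [C], and the number of steps does not enter the bound. *)
Lemma asball_diag_sub k (b : (nat -> F) -> G) B (f g : E -> F) C d :
  mlin k.+1 b -> mbound k.+1 b B -> 0 <= B -> asball r C f -> asball r C g ->
  asball r d (fun y => f y - g y) ->
  asball r (B * (C ^+ k * d)) (fun y => b (fun=> f y) - b (fun=> g y)).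
Proof.
move=> hbl hb B0 hf hg hfg.
(* [w j] has [g] in the arguments before [j] and [f] in the others. *)
pose w j y i : F := if (i < j)%N then g y else f y.
have step (j : 'I_k.+1) : asball r (B * (C ^+ k * d))
    (fun y => b (w j y) - b (w j.+1 y)).
  pose h i : E -> F := if i == nat_of_ord j then fun y => f y - g y
    else if (i < j)%N then g else f.
  have hh i : asball r (if i == nat_of_ord j then d else C) (h i).
    by rewrite /h; case: eqP => // _; case: ifP.
  have := asball_msubst hbl hb B0 hh.
  rewrite (bigD1 j) //= eqxx (eq_bigr (fun=> C)); last first.
    by move=> i; rewrite -val_eqE => /negbTE ->.
  rewrite prodr_const [d * _]mulrC.
  have -> : #|(fun i : 'I_k.+1 => i != j)| = k.
    by have := cardC1 j; rewrite card_ord.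
  apply: eq_asball => y _.
  have e1 : w j y = upd (w j y) j (f y).
    by apply/funext => i; rewrite /upd /w; case: eqP => // ->; rewrite ltnn.
  have e2 : w j.+1 y = upd (w j y) j (g y).
    apply/funext => i; rewrite /upd /w ltnS leq_eqVlt.
    by case: eqP => //= ->.
  have e3 : (fun i => h i y) = upd (w j y) j (f y - g y).
    apply/funext => i; rewrite /upd /w /h; case: eqP => // _.
    by case: ifP.
  rewrite e3 [in RHS]e1 e2.
  have := mlin_lin hbl (w j y) (-1) (g y) (f y) (ltn_ord j).
  by rewrite !scaleN1r addrC => ->; rewrite addrC.
have all_ (n : nat) : (n <= k.+1)%N -> asball r (B * (C ^+ k * d))
    (fun y => b (w 0%N y) - b (w n y)).
  elim: n => [_|n IH nk].
    apply: (@eq_asball _ _ _ _ (fun=> 0)) => [y _|]; first by rewrite subrr.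
    apply: asball_cst => //; rewrite unorm0; apply: mulr_ge0 => //.
    by apply: mulr_ge0; [apply: exprn_ge0; exact: asball_ge0 hf|exact: asball_ge0 hfg].
  have := asballD r0 (IH (ltnW nk)) (step (Ordinal nk)).
  by apply: eq_asball => y _ /=; rewrite addrA subrK.
have := all_ k.+1 (leqnn _); apply: eq_asball => y _.
congr (_ - _); apply: (mlin_loc hbl) => i ik; by rewrite /w ?ltn0 ?ik.
Qed.

(** The composed terms have Gauss norms at most [D * (C / s) ^+ m]; the strict inequality [C < s]
    makes them tend to 0. *)
Lemma asball_comp (f : F -> G) (g : E -> F) s D C : 0 < s -> C < s ->
  asball s D f -> asball r C g -> asball r D (f \o g).
Proof.
move=> s0 Cs hf hg; have D0 := asball_ge0 hf; have C0 := asball_ge0 hg.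
have [b hb] := hf.
have t0 : 0 <= C / s by rewrite divr_ge0 // ltW.
have t1 : C / s < 1 by rewrite ltr_pdivrMr // mul1r.
have e m : D / s ^+ m * C ^+ m = D * (C / s) ^+ m.
  by rewrite expr_div_n mulrAC -mulrA.
apply: (asball_sum r0 (f := fun m y => b m (fun=> g y)) (c := fun m => D * (C / s) ^+ m)).
- move=> m; rewrite -e; apply: asball_diag hg.
  + exact: series_mlin hb m.
  + exact: series_bound hb m.
  + by rewrite divr_ge0 // exprn_ge0 // ltW.
- by move=> m; apply: ler_piMr => //; apply: exprn_ile1 => //; exact: ltW.
- by move=> d d0; exact: geometric_small.
- move=> y yr; apply: (series_sum hb); apply: le_lt_trans Cs.
  exact: (asball_bound r0 hg yr).
Qed.

(* The Lipschitz constant D C / s^2 tends to 0 with C: this is the source of all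
   contractions below. *)
Lemma asball_comp_sub (b : nat -> (nat -> F) -> G) (h : F -> G) (f g : E -> F) s D C d :
  C < s -> has_series s D b h -> (forall v, b 0%N v = 0) ->
  (forall v, b 1%N v = 0) -> asball r C f -> asball r C g ->
  asball r d (fun y => f y - g y) ->
  asball r (D / s ^+ 2 * C * d) (fun y => h (f y) - h (g y)).
Proof.
move=> Cs hb b0 b1 hf hg hfg; have C0 := asball_ge0 hf.
have s0 : 0 < s by exact: le_lt_trans Cs.
have D0 : 0 <= D by apply: (@asball_ge0 _ _ s _ h); exists b.
have d0 : 0 <= d := asball_ge0 hfg.
have t0 : 0 <= C / s by rewrite divr_ge0 // ltW.
have t1 : C / s < 1 by rewrite ltr_pdivrMr // mul1r.
have M0 : 0 <= D / s ^+ 2 * C * d by rewrite !mulr_ge0 ?invr_ge0 ?exprn_ge0 // ltW.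
have e m : D / s ^+ m.+2 * (C ^+ m.+1 * d) = D / s ^+ 2 * C * d * (C / s) ^+ m.
  by rewrite expr_div_n -[m.+2]add2n exprD (exprS C) invfM; ring.
(* The terms of degree 0 and 1 vanish, and for the others one factor [C / s ^+ 2] can be split
   off. *)
pose c m := if m is m'.+2 then D / s ^+ 2 * C * d * (C / s) ^+ m' else 0.
apply: (asball_sum r0 (f := fun m y => b m (fun=> f y) - b m (fun=> g y)) (c := c)).
- case=> [|[|m]]; rewrite /c.
  + apply: (@eq_asball _ _ _ _ (fun=> 0)) => [y _|]; first by rewrite !b0 subrr.
    by apply: asball_cst; rewrite ?unorm0.
  + apply: (@eq_asball _ _ _ _ (fun=> 0)) => [y _|]; first by rewrite !b1 subrr.
    by apply: asball_cst; rewrite ?unorm0.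
  + rewrite -e; apply: asball_diag_sub => //.
    * exact: series_mlin hb _.
    * exact: series_bound hb _.
    * by rewrite divr_ge0 // exprn_ge0 // ltW.
- by case=> [|[|m]] //=; apply: ler_piMr => //; apply: exprn_ile1 => //; exact: ltW.
- move=> a a0; have [N hN] := geometric_small (D / s ^+ 2 * C * d) t0 t1 a0.
  by exists N.+2 => -[|[|m]] //= hm; exact: hN.
- move=> y yr.
  have hF := series_sum hb (le_lt_trans (asball_bound r0 hf yr) Cs).
  have hG := series_sum hb (le_lt_trans (asball_bound r0 hg yr) Cs).
  have h2 (x : G) : unorm (- x) <= 1 * unorm x by rewrite unormN mul1r.
  exact: usumD hF (usum_linear (L := -%R) ler01 h2 hG).
Qed.

End operations.

(** The re-expansion is composition with [y |-> x + y], of Gauss norm at most the maximum of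
    [unorm x] and [r']. This is below [r]: in an ultrametric ball every point is a centre. *)
Lemma asball_recenter E F r r' C (f : E -> F) x :
  unorm x < r -> 0 < r' -> r' < r -> asball r C f ->
  asball r' C (fun y => f (x + y)).
Proof.
move=> xr r'0 r'r hf; have r0 : 0 < r by exact: lt_trans r'r.
have h : asball r' (Num.max (unorm x) r') (fun y => x + y).
  apply: asballD => //.
    by apply: asball_cst; rewrite // le_max lexx.
  apply: (@asball_le _ _ _ r'0 (1 * r')) => //; first by rewrite mul1r le_max lexx orbT.
  by apply: (asball_linear _ (L := idfun)) => // y; rewrite mul1r.
by apply: (asball_comp r'0 r0 _ hf h); rewrite gt_max xr.
Qed.

End power_series.

(** * Scaling vectors by a non-discrete absolute value *)

Section absolute_value.
Context (R : realType) (K : ultraField R).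
Implicit Type a : K.

Lemma absv0 : absv (0 : K) = 0.
Proof. exact/absv_eq0. Qed.

Lemma absv_gt0 a : a != 0 -> 0 < absv a.
Proof.
move=> a0; rewrite lt_neqAle absv_ge0 andbT eq_sym.
by apply/eqP => /absv_eq0/eqP; apply/negP.
Qed.

Lemma absv1 : absv (1 : K) = 1.
Proof.
have n0 : absv (1 : K) != 0 by rewrite gt_eqF // absv_gt0 // oner_neq0.
by apply: (mulfI n0); rewrite -absvM !mulr1.
Qed.

Lemma absvX a n : absv (a ^+ n) = absv a ^+ n.
Proof. by elim: n => [|n IH]; rewrite ?absv1 // !exprS absvM IH. Qed.

Lemma absvV a : absv a^-1 = (absv a)^-1.
Proof.
have [->|a0] := eqVneq a 0; first by rewrite invr0 absv0 invr0.
have n0 : absv a != 0 by rewrite gt_eqF // absv_gt0.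
by apply: (mulfI n0); rewrite -absvM !divff // absv1.
Qed.

Lemma absv_small : exists t : K, 0 < absv t /\ absv t < 1.
Proof.
have [t t0 t1] := @absv_nondiscrete _ K 1 ltr01.
by exists t; split => //; exact: absv_gt0.
Qed.

(** Norms of vectors need not be values of [absv], so a vector can only be normalised up to the
    factor [absv t]: a negative power of [t] makes it longer than [d], and the first power of [t]
    that makes it shorter again is taken. *)
Lemma scale_into (E : ultraBanach K) (t : K) (v : E) (d : R) :
  0 < absv t -> absv t < 1 -> 0 < d -> v != 0 ->
  exists2 a, a != 0 & absv t * d <= unorm (a *: v) /\ unorm (a *: v) < d.
Proof.
move=> t0 t1 d0 /unorm_gt0 v0.
have tn0 : t != 0 by apply/eqP => h; move: t0; rewrite h absv0 ltxx.
have [N hN] := geometric_small d (ltW t0) t1 v0.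
pose w := t ^- N *: v.
have tN : 0 < absv t ^+ N by rewrite exprn_gt0.
have wd : d < unorm w.
  rewrite unormZ absvV absvX mulrC ltr_pdivlMr //; exact: hN.
have [M hM] := geometric_small (unorm w) (ltW t0) t1 d0.
have ex : exists n, unorm w * absv t ^+ n < d by exists M; exact: hM.
case: (ex_minnP ex) => -[|n] hn hmin; first by move: hn; rewrite expr0 mulr1 ltNge (ltW wd).
exists (t ^+ n.+1 * t ^- N); first by rewrite mulf_neq0 ?invr_eq0 ?expf_neq0.
rewrite -scalerA -/w unormZ absvX [_ * unorm w]mulrC; split=> //.
rewrite exprS mulrCA ler_pM2l // leNgt; apply/negP => /hmin.
by rewrite ltnn.
Qed.

End absolute_value.

(** * Continuity and boundedness of multilinear maps *)

Section bounded_multilinear.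
Context (R : realType) (K : ultraField R) (E F : ultraBanach K).

Lemma mlin_zero k (b : (nat -> E) -> F) v i : mlin k b -> (i < k)%N -> v i = 0 ->
  b v = 0.
Proof.
move=> hb ik vi; have -> : v = upd v i 0.
  by apply/funext => j; rewrite /upd; case: eqP => // ->.
have := mlin_lin hb v 0 0 0 ik.
by rewrite scaler0 addr0 scale0r add0r => /eqP; rewrite -subr_eq0 => /eqP h;
  have := mlin_lin hb v (-1) 0 0 ik; rewrite scaler0 addr0 scaleN1r addNr.
Qed.

Lemma mlin_scale k (b : (nat -> E) -> F) (a : nat -> K) v m : mlin k b ->
  (m <= k)%N ->
  b (fun i => if (i < m)%N then a i *: v i else v i) = (\prod_(i < m) a i) *: b v.
Proof.
move=> hb; elim: m => [_|m IH mk].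
  by rewrite big_ord0 scale1r; congr b.
rewrite big_ord_recr /= mulrC -scalerA -IH ?(ltnW mk) //.
set w := fun i => if (i < m)%N then _ else _.
have -> : (fun i => if (i < m.+1)%N then a i *: v i else v i) = upd w m (a m *: v m + 0).
  apply/funext => j; rewrite /upd /w ltnS leq_eqVlt.
  by case: eqP => //= ->; rewrite addr0.
rewrite (mlin_lin hb) // [b (upd w m 0)](@mlin_zero k _ _ m) // ?addr0; last first.
  by rewrite /upd eqxx.
congr (_ *: b _); apply/funext => j; rewrite /upd /w; case: eqP => // ->.
by rewrite ltnn.
Qed.

(** Each nonzero argument is scaled into the annulus between [absv t * d] and [d]; undoing the
    scaling costs at most [(absv t * d)^-1 * unorm (v i)] per argument. *)
Lemma mlin_bounded k (b : (nat -> E) -> F) d : mlin k b -> 0 < d ->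
  (forall v, (forall i, (i < k)%N -> unorm (v i) < d) -> unorm (b v) <= 1) ->
  exists2 B, 0 <= B & mbound k b B.
Proof.
move=> hb d0 h; have [t [t0 t1]] := absv_small K.
have td : 0 < (absv t * d)^-1 by rewrite invr_gt0 mulr_gt0.
exists ((absv t * d)^-1 ^+ k); first by rewrite exprn_ge0 // ltW.
move=> v.
have P0 : 0 <= (absv t * d)^-1 ^+ k * \prod_(i < k) unorm (v i).
  by rewrite mulr_ge0 ?exprn_ge0 ?(ltW td) ?prod_unorm_ge0.
have [[i [ik vi]]|vn] := pselect (exists i, (i < k)%N /\ v i = 0).
  by rewrite (mlin_zero hb ik vi) unorm0.
have /choice[a ha] : forall i, exists a : K, (i < k)%N -> a != 0 /\
    (absv t * d <= unorm (a *: v i) /\ unorm (a *: v i) < d).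
  move=> i; have [ik|_] := boolP (i < k)%N; last by exists 0.
  have vi : v i != 0 by apply/eqP => vi; apply: vn; exists i.
  by have [a a0 ha] := scale_into t0 t1 d0 vi; exists a.
have := h (fun i => if (i < k)%N then a i *: v i else v i).
rewrite (mlin_scale a v hb (leqnn k)) unormZ => hav.
have {}hav : absv (\prod_(i < k) a i) * unorm (b v) <= 1.
  by apply: hav => i ik; rewrite ik; have [_ []] := ha i ik.
have A : absv (\prod_(i < k) a i) = \prod_(i < k) absv (a i).
  by rewrite (big_morph _ (@absvM _ K) (absv1 K)).
have A0 : 0 < absv (\prod_(i < k) a i).
  by rewrite A prodr_gt0 // => i _; apply: absv_gt0; have [] := ha i (ltn_ord i).
have : unorm (b v) <= (absv (\prod_(i < k) a i))^-1.
  by rewrite -[X in _ <= X]mul1r ler_pdivlMr // mulrC.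
move/le_trans; apply; rewrite A -prodfV.
have -> : (absv t * d)^-1 ^+ k = \prod_(i < k) (absv t * d)^-1.
  by rewrite prodr_const card_ord.
rewrite -big_split /=; apply: ler_prod => i _.
have [a0 [h1 _]] := ha i (ltn_ord i).
have aa0 := absv_gt0 a0.
rewrite invr_ge0 (ltW aa0) /= -[X in X <= _]mul1r ler_pdivrMr // -mulrA.
by rewrite ler_pdivlMl ?mulr_gt0 // mulr1 [_ * absv (a i)]mulrC -unormZ.
Qed.

Lemma cont_linear_bounded (L : {linear E -> F}) : continuous L ->
  exists2 B, 0 <= B & forall x, unorm (L x) <= B * unorm x.
Proof.
move=> cL.
have /cL/nbhs_unormP[d d0 hd] : nbhs (L 0) [set y | unorm y <= 1].
  apply/nbhs_unormP; exists 1 => // y /=; rewrite linear0 subr0; exact: ltW.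
have [|||B B0 hB] := @mlin_bounded 1 (fun v => L (v 0%N)) d.
- by split=> [v w -> //|v [|//] a x y _]; rewrite /upd /= linearP.
- exact: d0.
- by move=> v /(_ 0%N isT) h; apply: hd; rewrite /= subr0.
by exists B => // x; have := hB (fun=> x); rewrite big_ord_recl big_ord0 mulr1.
Qed.

Lemma bounded_continuous (L : {linear E -> F}) B :
  (forall x, unorm (L x) <= B * unorm x) -> continuous L.
Proof.
move=> hB x U /nbhs_unormP[r r0 rU].
have B1 : 0 < `|B| + 1 by rewrite ltr_wpDl.
apply/nbhs_unormP; exists (r / (`|B| + 1)); first by rewrite divr_gt0.
move=> y; rewrite /= ltr_pdivlMr // => h; apply: rU; rewrite /= -linearB.
apply: le_lt_trans (hB _) _; apply: le_lt_trans h; rewrite mulrC.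
by rewrite ler_wpM2l ?unorm_ge0 // (le_trans (ler_norm _)) // lerDl.
Qed.

(** Passage between maps on ['I_k -> E] and the encoding by sequences; the padding by 0 is harmless,
    as only the first [k] entries count. *)
Definition of_seq k (b : (nat -> E) -> F) (w : 'I_k -> E) : F :=
  b (fun n => if insub n is Some i then w i else 0).

Definition to_seq k (b : ('I_k -> E) -> F) (v : nat -> E) : F :=
  b (fun i => v i).

Lemma cont_multilinear_mlin k (b : ('I_k -> E) -> F) : cont_multilinear b ->
  mlin k (to_seq b).
Proof.
move=> [hb _]; split=> [v w vw|v i a x y ik].
  by congr b; apply/funext => i; exact: vw.
have e z : (fun j : 'I_k => upd v i z j) = dfwith (fun j : 'I_k => v j) (Ordinal ik) z.
  apply/funext => j; rewrite /upd; case: eqP => [ji|ji].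
    by have -> : j = Ordinal ik by [exact: val_inj]; rewrite dfwithin.
  by rewrite dfwithout // eq_sym; apply/eqP => h; apply: ji; rewrite h.
by rewrite /to_seq !e hb.
Qed.

(** With finitely many factors the topology of pointwise convergence is the one of boxes, which
    reduces continuity to norm estimates. *)
Lemma nbhs_box k (v : 'I_k -> E) (A : set {ptws 'I_k -> E}) :
  nbhs (v : {ptws 'I_k -> E}) A <->
  exists2 d, 0 < d & forall w : 'I_k -> E, (forall i, unorm (w i - v i) < d) -> A w.
Proof.
pose G : set_system {ptws 'I_k -> E} := [set A | exists2 d, 0 < d &
  forall w : 'I_k -> E, (forall i, unorm (w i - v i) < d) -> A w].
have FG : Filter G.
  split; first by exists 1.
    move=> P Q [d d0 hd] [e e0 he]; exists (Num.min d e); first by rewrite lt_min d0.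
    move=> w hw; split; [apply: hd|apply: he] => i; apply: lt_le_trans (hw i) _;
      by rewrite ge_min lexx ?orbT.
  by move=> P Q PQ [d d0 hd]; exists d => // w /hd /PQ.
split.
  suff : G --> (v : {ptws 'I_k -> E}) by apply.
  apply/cvg_sup => i B [_ [[C oC <-] Cv CB]].
  have /nbhs_unormP[r r0 rC] : nbhs (v i) C by exact: open_nbhs_nbhs.
  exists r => // w hw; apply: CB; apply: rC; exact: hw.
move=> [d d0 hd].
have : @nbhs {ptws 'I_k -> E} {ptws 'I_k -> E} v
    [set w | forall i : 'I_k, unorm (w i - v i) < d].
  apply: (@filter_forall {ptws 'I_k -> E} _ (fun i => [set w | unorm (w i - v i) < d])
    _ (nbhs_filter (v : {ptws 'I_k -> E}))) => i.
  apply: (@proj_continuous 'I_k (fun=> E : topologicalType) i v [set y | unorm (y - v i) < d]).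
  by apply/nbhs_unormP; exists d.
exact: (@filterS _ _ (nbhs_filter (v : {ptws 'I_k -> E}))) hd.
Qed.

Lemma cont_multilinear_bounded k (b : ('I_k -> E) -> F) : cont_multilinear b ->
  exists2 B, 0 <= B & mbound k (to_seq b) B.
Proof.
move=> hb; have hs := cont_multilinear_mlin hb; have [_ cb] := hb.
have /cb /nbhs_box[d d0 hd] : nbhs (b (fun=> 0)) [set y | unorm (y - b (fun=> 0)) <= 1].
  by apply/nbhs_unormP; exists 1 => // y /= /ltW.
(* For [k = 0] the map is a constant that need not be small; only for positive [k] does it vanish at
   0. *)
case: k b hb hs cb hd => [|k] b hb hs cb hd.
  exists (unorm (b (fun=> 0))); first exact: unorm_ge0.
  move=> v; rewrite big_ord0 mulr1 /to_seq.
  by rewrite (_ : (fun _ => _) = fun=> 0) //; apply/funext => -[].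
have z0 : b (fun=> 0) = 0 by apply: (mlin_zero hs (v := fun=> 0) (ltn0Sn k)).
apply: (mlin_bounded hs d0) => v hv.
have := hd (fun i => v i); rewrite /= z0 subr0; apply => i.
by rewrite subr0; exact: hv.
Qed.

Lemma of_seq_cont_multilinear k (b : (nat -> E) -> F) B : mlin k b ->
  mbound k b B -> 0 <= B -> cont_multilinear (of_seq b : ('I_k -> E) -> F).
Proof.
move=> hb hB B0.
have e (v : 'I_k -> E) i z :
    (fun n => if insub n is Some j then dfwith v i z j else 0) =
    upd (fun n => if insub n is Some j then v j else 0) i z.
  apply/funext => n; rewrite /upd; case: eqP => [->|ni].
    by rewrite valK dfwithin.
  case: insubP => // j _ jn; rewrite dfwithout //.
  by apply/eqP => ij; apply: ni; rewrite -jn ij.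
split; first by move=> v i a x y; rewrite /of_seq !e (mlin_lin hb).
move=> v U /nbhs_unormP[r r0 rU].
apply/nbhs_box.
(* [L] bounds all entries of [v], and those of [w] because [d <= 1]. Being at least 1, it lets the
   product over the other arguments be bounded by [L ^+ k]. *)
pose L := 1 + \sum_i unorm (v i).
have S0 : 0 <= \sum_i unorm (v i) by apply: sumr_ge0 => i _; exact: unorm_ge0.
have L1 : 1 <= L by rewrite lerDl.
have L0 : 0 < L by exact: lt_le_trans L1.
have BL : 0 < B * L ^+ k + 1 by rewrite ltr_wpDl // mulr_ge0 // exprn_ge0 // ltW.
pose d := Num.min 1 (r / (B * L ^+ k + 1)).
have d0 : 0 < d by rewrite lt_min ltr01 divr_gt0.
exists d => // w hw; apply: rU => /=.
have vL i : unorm (v i) <= L.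
  rewrite /L (bigD1 i) //= addrCA lerDl addr_ge0 //.
  by apply: sumr_ge0 => j _; exact: unorm_ge0.
have wL i : unorm (w i) <= L.
  rewrite -(subrK (v i) (w i)); apply: unormD_le => //.
  by apply: le_trans (ltW (hw i)) _; rewrite (le_trans _ L1) // ge_min lexx.
pose ext (u : 'I_k -> E) n : E := if insub n is Some j then u j else 0.
pose m j n : E := if (n < j)%N then ext w n else ext v n.
have step j : (j < k)%N -> unorm (b (m j.+1) - b (m j)) < r.
  move=> jk.
  have := mlin_lin hb (m j) (-1) (ext v j) (ext w j) jk.
  have -> : upd (m j) j (ext v j) = m j.
    by apply/funext => n; rewrite /upd /m; case: eqP => // ->; rewrite ltnn.
  have -> : upd (m j) j (ext w j) = m j.+1.
    by apply/funext => n; rewrite /upd /m ltnS [(n <= j)%N]leq_eqVlt; case: eqP => [->|_].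
  rewrite !scaleN1r [- ext v j + _]addrC [- b _ + _]addrC => <-.
  apply: le_lt_trans (hB _) _.
  have Bd : B * L ^+ k * d < r.
    apply: (@le_lt_trans _ _ (B * L ^+ k * (r / (B * L ^+ k + 1)))).
      rewrite ler_wpM2l ?mulr_ge0 ?exprn_ge0 ?(ltW L0) //.
      by rewrite ge_min lexx orbT.
    by rewrite mulrA ltr_pdivrMr // mulrDr mulr1 mulrC ltrDl.
  apply: le_lt_trans Bd; rewrite -mulrA; apply: ler_wpM2l => //.
  rewrite (bigD1 (Ordinal jk)) //= {1}/upd eqxx mulrC.
  have extL i (ik : (i < k)%N) : ext v i = v (Ordinal ik) /\ ext w i = w (Ordinal ik).
    by rewrite /ext insubT.
  have [e1 e2] := extL j jk.
  rewrite e1 e2.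
  apply: ler_pM => //; try exact: unorm_ge0; last exact: ltW.
    by apply: prodr_ge0 => i _; exact: unorm_ge0.
  apply: (@le_trans _ _ (\prod_(i < k | i != Ordinal jk) L)).
    apply: ler_prod => i ij; rewrite unorm_ge0 /=.
    rewrite /upd; case: eqP => [ij'|_].
      by exfalso; move: ij; rewrite (_ : i = Ordinal jk) ?eqxx //; exact: val_inj.
    have [e3 e4] := extL i (ltn_ord i); rewrite /m e3 e4; case: ifP => _.
      exact: wL.
    exact: vL.
  rewrite prodr_const; apply: ler_weXn2l => //.
  by rewrite (leq_trans (max_card _)) // card_ord.
have all_ j : (j <= k)%N -> unorm (b (m j) - b (m 0%N)) < r.
  elim: j => [_|j IH jk]; first by rewrite subrr unorm0.
  exact: unorm_trans_lt (step j jk) (IH (ltnW jk)).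
have -> : of_seq b w = b (m k).
  by apply: (mlin_loc hb) => i ik; rewrite /m ik.
have -> : of_seq b v = b (m 0%N) by [].
exact: all_.
Qed.

End bounded_multilinear.

(** * Analytic functions and their differentials *)

Section analytic_at.
Context (R : realType) (K : ultraField R).
Implicit Types E F G : ultraBanach K.

Definition an_at E F (f : E -> F) (x : E) :=
  exists r C, 0 < r /\ asball r C (fun y => f (x + y)).

Lemma inf_ge0 (A : set R) : (forall x, A x -> 0 <= x) -> 0 <= inf A.
Proof.
move=> h; have [[x Ax]|A0] := pselect (A !=set0).
  by apply: lb_le_inf; [exists x|].
rewrite (_ : A = set0) ?inf0 //; apply/seteqP; split=> // x Ax.
by case: A0; exists x.
Qed.

Lemma multilinear_norm_ge0 E F k (b : ('I_k -> E) -> F) :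
  0 <= multilinear_norm b.
Proof. by apply: inf_ge0 => x []. Qed.

Lemma hompoly_norm_ge0 E F k (p : E -> F) : 0 <= hompoly_norm k p.
Proof. by apply: inf_ge0 => _ [b _ <-]; exact: multilinear_norm_ge0. Qed.

(** Two nested infima, over the multilinear representatives and over their bounds, are each
    approached up to [e / 2]. *)
Lemma hompoly_norm_lt E F k (p : E -> F) e : 0 < e ->
  cont_hompoly k p -> exists b : (nat -> E) -> F,
  [/\ mlin k b, mbound k b (hompoly_norm k p + e) & forall x, p x = b (fun=> x)].
Proof.
move=> e0 [b0 hb0]; have e2 : 0 < e / 2 by rewrite divr_gt0.
have [|_ [b [hb pb] <-] h1] := inf_adherent e2 (E := [set multilinear_norm b | b in
    [set b : ('I_k -> E) -> F | polarizes b p]]).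
  split; first by exists (multilinear_norm b0), b0.
  by exists 0 => _ [b _ <-]; exact: multilinear_norm_ge0.
have [B B0 hB] := cont_multilinear_bounded hb.
have [|C [C0 hC] h2] := inf_adherent e2 (E := [set C | 0 <= C /\
    forall v, unorm (b v) <= C * \prod_i unorm (v i)]).
  split; last by exists 0 => C [].
  exists B; split=> // v.
  pose w n : E := if insub n is Some i then v i else 0.
  have wv : (fun i : 'I_k => w i) = v by apply/funext => i; rewrite /w valK.
  have := hB w; rewrite /to_seq wv.
  by congr (_ <= _ * _); apply: eq_bigr => i _; rewrite /w valK.
exists (to_seq b); split; [exact: cont_multilinear_mlin| |exact: pb].
have CC : C <= hompoly_norm k p + e.
  apply: ltW; apply: lt_trans h2 _; rewrite -/(multilinear_norm b).
  by rewrite [X in _ < _ + X](splitr e) addrA ltrD2r.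
by apply: (mbound_ge0 CC) => v; exact: hC.
Qed.

(** A positive radius of convergence gives some [s] for which the numbers
    [hompoly_norm k (p k) * s ^+ k] are bounded, that is, a Gauss norm. Conversely a Gauss norm on
    radius [r] gives convergence to 0 at every smaller radius. *)
Lemma analytic_onP E F (U : set E) (f : E -> F) :
  analytic_on U f <-> forall x, U x -> nbhs x U /\ an_at f x.
Proof.
split=> [h x Ux|h x Ux].
  have [p [hp /ereal_sup_gt[_ [s [s0 hs] <-]] s_gt0 [r [r0 _ hr]]]] := h x Ux.
  rewrite lte_fin in s_gt0.
  have [r1 r10 r1r] : exists2 r1 : R, 0 < r1 & (r1%:E <= r)%E.
    by case: r r0 {hr} => [a a0|_|//]; [exists a|exists 1; rewrite ?leey].
  split.
    apply/nbhs_unormP; exists r1 => // y /= yr.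
    have := hr (y - x); rewrite (addrC x) subrK => -[] //.
    by apply: lt_le_trans r1r; rewrite lte_fin.
  have [M [_ hM]] := cvg_seq_bounded (cvgP _ hs).
  have {}hM k : hompoly_norm k (p k) * s ^+ k <= M + 1.
    by apply: le_trans (ler_norm _) _; apply: hM => //; rewrite ltrDl.
  (* A representative within [(s ^+ k)^-1] of the infimum raises the bound from [M + 1] to
     [M + 2]. *)
  have /choice[b hb] : forall k, exists b : (nat -> E) -> F, [/\ mlin k b,
      mbound k b ((M + 2) / s ^+ k) & forall x, p k x = b (fun=> x)].
    move=> k; have sk : 0 < s ^+ k by rewrite exprn_gt0.
    have [|b [h1 h2 h3]] := hompoly_norm_lt _ (hp k) (e := (s ^+ k)^-1).
      by rewrite invr_gt0.
    exists b; split=> //; apply: mbound_ge0 h2.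
    rewrite ler_pdivlMr // mulrDl mulVf ?gt_eqF //.
    have -> : M + 2 = M + 1 + 1 by rewrite -addrA.
    by rewrite lerD2r.
  pose t := Num.min r1 s.
  have t0 : 0 < t by rewrite lt_min r10.
  have M0 : 0 <= M + 2.
    apply: le_trans (_ : 0 <= M + 1) _; last by rewrite lerD2l ler1n.
    by apply: le_trans (hM 0%N); rewrite expr0 mulr1 hompoly_norm_ge0.
  exists t, (M + 2); split=> //; exists b; split.
  - by move=> k; have [] := hb k.
  - move=> k; have [_ h2 _] := hb k; apply: mbound_ge0 h2.
    rewrite ler_wpM2l // lef_pV2 ?posrE ?exprn_gt0 // lerXn2r ?nnegrE //.
    + exact: ltW.
    + by rewrite ge_min lexx orbT.
  - move=> y yt; have yr : ((unorm y)%:E < r)%E.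
      by apply: lt_le_trans r1r; rewrite lte_fin; apply: lt_le_trans yt _; rewrite ge_min lexx.
    have [_ /ucvg_cvg] := hr y yr; apply: eq_ucvg => n.
    by apply: eq_bigr => k _; have [_ _ ->] := hb k.
have [/nbhs_unormP[r0 r00 rU] [r [C [r_gt0 [b hb]]]]] := h x Ux.
have C0 : 0 <= C := asball_ge0 (ex_intro _ b hb).
exists (fun k y => b k (fun=> y)).
have hk k : cont_multilinear (of_seq (b k) : ('I_k -> E) -> F).
  apply: of_seq_cont_multilinear (series_mlin hb k) (series_bound hb k) _.
  by rewrite divr_ge0 // exprn_ge0 // ltW.
have pk k : polarizes (of_seq (b k) : ('I_k -> E) -> F) (fun y => b k (fun=> y)).
  split=> // y; apply: (mlin_loc (series_mlin hb k)) => i ik.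
  by rewrite insubT.
(* Being below [r] makes [C * (s / r) ^+ k] tend to 0; being below [r0] keeps the ball inside
   [U]. *)
pose s := Num.min r r0 / 2.
have m0 : 0 < Num.min r r0 by rewrite lt_min r_gt0.
have s0 : 0 < s by rewrite divr_gt0.
have sm : s < Num.min r r0 by exact: half_lt.
have [sr sr0] : s < r /\ s < r0.
  by split; apply: lt_le_trans sm _; rewrite ge_min lexx ?orbT.
have hn k : hompoly_norm k (fun y => b k (fun=> y)) <= C / r ^+ k.
  apply: (@le_trans _ _ (multilinear_norm (of_seq (b k) : ('I_k -> E) -> F))).
    apply: ge_inf; last by exists (of_seq (b k)); first exact: pk.
    by exists 0 => _ [? _ <-]; exact: multilinear_norm_ge0.
  apply: ge_inf; first by exists 0 => ? [].
  split=> [|v]; first by rewrite divr_ge0 // exprn_ge0 // ltW.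
  apply: le_trans (series_bound hb k _) _.
  rewrite (_ : \prod_(i < k) _ = \prod_i unorm (v i)) //.
  by apply: eq_bigr => i _; rewrite valK.
have sr1 : s / r < 1 by rewrite ltr_pdivrMr // mul1r.
have sr_0 : 0 <= s / r by rewrite divr_ge0 // ltW.
have cs : (s%:E <= conv_radius (fun k y => b k (fun=> y)))%E.
  apply: ereal_sup_ubound; exists s => //; split; first exact: ltW.
  apply: (squeeze_cvgr (f := fun=> 0) (h := geometric C (s / r))).
  - near=> k; rewrite mulr_ge0 ?hompoly_norm_ge0 ?exprn_ge0 ?(ltW s0) //=.
    rewrite (_ : C * (s / r) ^+ k = C / r ^+ k * s ^+ k); last first.
      by rewrite (expr_div_n s r k) [s ^+ k / _]mulrC mulrA.
    apply: ler_wpM2r; last exact: hn.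
    by rewrite exprn_ge0 ?(ltW s0).
  - exact: cvg_cst.
  - by apply: cvg_geometric; rewrite ger0_norm.
split.
- by move=> k; exists (of_seq (b k)); exact: pk.
- by apply: lt_le_trans cs; rewrite lte_fin.
exists s%:E; split=> // y; rewrite lte_fin => ys; split.
  by apply: rU; rewrite /= addrAC subrr add0r; exact: lt_trans sr0.
by apply/ucvg_cvg; exact: series_sum hb _ (lt_trans ys sr).
Unshelve. all: by end_near. Qed.

Lemma asball_an_at E F r C (f : E -> F) x :
  unorm x < r -> asball r C f -> an_at f x.
Proof.
move=> xr hf; have r0 : 0 < r by apply: le_lt_trans xr; exact: unorm_ge0.
exists (r / 2), C; have r2 : 0 < r / 2 by rewrite divr_gt0.
split=> //; apply: asball_recenter xr r2 _ hf.
exact: half_lt.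
Qed.

Lemma eq_an_at E F (f g : E -> F) x :
  (\forall y \near x, f y = g y) -> an_at f x -> an_at g x.
Proof.
move=> /nbhs_unormP[d d0 hd] [r [C [r0 hf]]].
have m0 : 0 < Num.min d r by rewrite lt_min d0.
exists (Num.min d r), C; split=> //.
apply: (@eq_asball _ _ _ _ _ _ (fun y => f (x + y))).
  move=> y yd; apply: hd; rewrite /= addrAC subrr add0r.
  by apply: lt_le_trans yd _; rewrite ge_min lexx.
by apply: (asball_sub r0 m0 _ hf); rewrite ge_min lexx orbT.
Qed.

(** The constant coefficient vanishes, so shrinking the radius from [r] to [s] gains at least the
    factor [s / r] in the Gauss norm. *)
Lemma asball_small E F r C (f : E -> F) e : 0 < r ->
  asball r C f -> f 0 = 0 -> 0 < e ->
  exists2 s, 0 < s & asball s e f.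
Proof.
move=> r0 hf f0 e0; have C0 := asball_ge0 hf; have [b hb] := hf.
have C1 : 0 < C + 1 by rewrite ltr_wpDl.
(* Chosen so that [C * s <= e * r]; here and later, adding 1 keeps a denominator positive. *)
pose s := Num.min r (e * r / (C + 1)).
have s0 : 0 < s by rewrite lt_min r0 divr_gt0 // mulr_gt0.
have sr : s <= r by rewrite ge_min lexx.
have b0 v : b 0%N v = 0.
  have : usum (fun k => b k (fun=> 0)) (f 0).
    by apply: (series_sum hb); rewrite unorm0.
  have h k : k != 0%N -> b k (fun=> 0 : E) = 0.
    by case: k => // k _; apply: (mlin_zero (series_mlin hb k.+1) (ltn0Sn k)).
  have h2 := @usum1 _ _ F (fun k => b k (fun=> 0 : E)) 0%N h.
  rewrite f0 => /(usum_unique h2) <-.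
  exact: (mlin_loc (series_mlin hb 0)).
exists s => //; exists b; split; first exact: series_mlin hb.
  case=> [|k] v.
    by rewrite b0 unorm0 !mulr_ge0 ?invr_ge0 ?exprn_ge0 ?(ltW e0) ?(ltW s0) ?prod_unorm_ge0.
  have rs : C / r ^+ k.+1 <= e / s ^+ k.+1.
    rewrite ler_pdivrMr ?exprn_gt0 // mulrAC ler_pdivlMr ?exprn_gt0 // !exprS.
    have h : C * s <= e * r.
      apply: (@le_trans _ _ ((C + 1) * s)).
        by apply: ler_wpM2r; [exact: ltW|rewrite lerDl].
      by rewrite mulrC -ler_pdivlMr // ge_min lexx orbT.
    rewrite !mulrA; apply: ler_pM => //.
    - by rewrite mulr_ge0 // ltW.
    - by rewrite exprn_ge0 // ltW.
    - by rewrite lerXn2r ?nnegrE // ltW.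
  exact: (mbound_ge0 rs (series_bound hb k.+1)).
move=> y ys; apply: (series_sum hb); exact: lt_le_trans sr.
Qed.

Lemma an_at_small E F (f : E -> F) x e : an_at f x -> 0 < e ->
  exists2 t, 0 < t & asball t e (fun y => f (x + y) - f x).
Proof.
move=> [r [C [r0 hf]]] e0.
have h0 : asball r (Num.max C (unorm (f x))) (fun y => f (x + y) - f x).
  apply: asballD => //.
    by apply: asball_le hf => //; rewrite le_max lexx.
  by apply: asball_cst => //; rewrite unormN le_max lexx orbT.
by apply: asball_small r0 h0 _ e0; rewrite addr0 subrr.
Qed.

Lemma an_at_comp E F G (g : F -> G) (f : E -> F) x :
  an_at f x -> an_at g (f x) -> an_at (g \o f) x.
Proof.
move=> hf [s [D [s0 hg]]].
have [|t t0 ht] := an_at_small hf (e := s / 2); first by rewrite divr_gt0.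
exists t, D; split=> //.
have := asball_comp t0 s0 _ hg ht.
move=> /(_ _)/wrap[]; first exact: half_lt.
by apply: eq_asball => y _ /=; rewrite addrC subrK.
Qed.

Lemma an_at_cst E F (z : F) (x : E) : an_at (fun=> z) x.
Proof. by exists 1, (unorm z); split=> //; exact: asball_cst. Qed.

Lemma an_atD E F (f g : E -> F) x :
  an_at f x -> an_at g x -> an_at (fun y => f y + g y) x.
Proof.
move=> [r [C [r0 hf]]] [s [D [s0 hg]]].
have m0 : 0 < Num.min r s by rewrite lt_min r0.
exists (Num.min r s), (Num.max C D); split=> //; apply: asballD => //.
  apply: (asball_le m0 _ (asball_sub r0 m0 _ hf)); by rewrite ?le_max ?ge_min lexx.
by apply: (asball_le m0 _ (asball_sub s0 m0 _ hg)); rewrite ?le_max ?ge_min lexx orbT.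
Qed.

Lemma an_at_linear E F (L : {linear E -> F}) x :
  continuous L -> an_at L x.
Proof.
move=> /cont_linear_bounded[B B0 hB].
have h1 : asball 1 (B * 1) L by exact: asball_linear.
have := an_atD (an_at_cst (L x) 0) (_ : an_at L 0).
move=> /(_ _)/wrap[].
  by exists 1, (B * 1); split=> //; apply: eq_asball h1 => y _; rewrite add0r.
move=> [r [C [r0 h]]]; exists r, C; split=> //.
by apply: eq_asball h => y _; rewrite add0r linearD.
Qed.

Lemma an_at_id E (x : E) : an_at (fun y => y) x.
Proof.
by apply: (@an_at_linear E E idfun x) => ?.
Qed.

Lemma an_at_cont E F (f : E -> F) x : an_at f x ->
  {for x, continuous f}.
Proof.
move=> hf U /nbhs_unormP[e e0 eU].
have [|t t0 ht] := an_at_small hf (e := e / 2); first by rewrite divr_gt0.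
apply/nbhs_unormP; exists t => // y yt; apply: eU => /=.
have := asball_bound t0 ht yt; rewrite (addrC x) subrK => /le_lt_trans; apply.
exact: half_lt.
Qed.

End analytic_at.

(** * Differentials and the chain rule *)

Section differentials.
Context (R : realType) (K : ultraField R).
Implicit Types E F G : ultraBanach K.

Lemma series_quadratic E F r C b (f : E -> F) y : 0 < r ->
  has_series r C b f -> (forall v, b 0%N v = 0) -> (forall v, b 1%N v = 0) ->
  unorm y < r -> unorm (f y) <= C / r ^+ 2 * unorm y ^+ 2.
Proof.
move=> r0 hb b0 b1 yr; have C0 : 0 <= C := asball_ge0 (ex_intro _ b hb).
have q0 := ratio_ge0 r0 y; have q1 := ratio_lt1 r0 yr.
have -> : C / r ^+ 2 * unorm y ^+ 2 = C * (unorm y / r) ^+ 2.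
  by rewrite expr_div_n mulrAC -mulrA.
have Q0 : 0 <= C * (unorm y / r) ^+ 2 by rewrite mulr_ge0 ?exprn_ge0.
apply: (usum_le Q0 (series_sum hb yr)) => -[|[|k]].
- by rewrite b0 unorm0.
- by rewrite b1 unorm0.
- apply: le_trans (mbound_diag y (series_bound hb k.+2)) _.
  rewrite ler_wpM2l // -[k.+2]add2n exprD ler_piMr ?exprn_ge0 //.
  by apply: exprn_ile1 => //; exact: ltW.
Qed.

Lemma series_remainder E F r C (f : E -> F) : 0 < r ->
  asball r C f -> exists (L : {linear E -> F}) b,
  [/\ continuous L, has_series r C b (fun y => f y - f 0 - L y),
      forall v, b 0%N v = 0 & forall v, b 1%N v = 0].
Proof.
move=> r0 hf; have C0 := asball_ge0 hf; have [b hb] := hf.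
have Llin a x y : b 1%N (fun=> a *: x + y) = a *: b 1%N (fun=> x) + b 1%N (fun=> y).
  have := mlin_lin (series_mlin hb 1) (fun=> 0) a x y (ltn0Sn 0).
  have e z : b 1%N (upd (fun=> 0) 0 z) = b 1%N (fun=> z).
    by apply: (mlin_loc (series_mlin hb 1)) => -[].
  by rewrite !e.
have b0y y v : b 0%N v = b 0%N y by exact: (mlin_loc (series_mlin hb 0)).
have s0 : usum (fun k => b k (fun=> 0)) (f 0).
  by apply: (series_sum hb); rewrite unorm0.
have f0 : f 0 = b 0%N (fun=> 0).
  apply: (usum_unique s0); apply: (@usum1 _ _ F (fun k => b k (fun=> 0)) 0%N).
  by case=> // k _; apply: (mlin_zero (series_mlin hb k.+1) (ltn0Sn k)).
pose b' k : (nat -> E) -> F := if (k < 2)%N then fun=> 0 else b k.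
exists (mklinear Llin), b'; split=> //.
  apply: (@bounded_continuous _ _ _ _ _ (C / r)) => x.
  have := series_bound hb 1 (fun=> x).
  by rewrite big_ord_recl big_ord0 mulr1 expr1.
have Q0 k (v : nat -> E) : 0 <= C / r ^+ k * \prod_(i < k) unorm (v i).
  by rewrite mulr_ge0 ?prod_unorm_ge0 // divr_ge0 // exprn_ge0 // ltW.
split.
- by move=> k; rewrite /b'; case: ifP => _; [exact: mlin0|exact: (series_mlin hb)].
- move=> k v; rewrite /b'; case: ifP => _; last exact: (series_bound hb).
  by rewrite unorm0 Q0.
- move=> y yr.
  pose c k := if k == 0%N then - f 0 else if k == 1%N then - b 1%N (fun=> y) else 0.
  have hc : usum c (- f 0 - b 1%N (fun=> y)).
    have := @usum_finite _ _ F c 2; rewrite !big_ord_recl big_ord0 addr0.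
    by apply=> -[|[]].
  have := usumD (series_sum hb yr) hc; rewrite addrA.
  apply: eq_usum => -[|[|k]] /=; rewrite /b' /c /= ?addr0 ?subrr //.
  by rewrite (b0y (fun=> 0)) f0 subrr.
Qed.

(** Every line contains arbitrarily short nonzero vectors, as [K] is not discrete; dividing the two
    error estimates there by [absv a] separates the linear parts. *)
Lemma differential_unique E F (f : E -> F) x
    (A B : {linear E -> F}) :
  is_differential f x A -> is_differential f x B -> A =1 B.
Proof.
move=> [_ hA] [_ hB] v; apply/eqP; rewrite -subr_eq0; apply/eqP/unorm_small => e e0.
have [->|v0] := eqVneq v 0; first by rewrite (linear0 A) (linear0 B) subrr unorm0.
have v1 := unorm_gt0 v0.
have e1 : 0 < e / 2 / unorm v by rewrite !divr_gt0.
have [d d0 hd] := (nbhs_unormP _ _).1 (filterI (hA _ e1) (hB _ e1)).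
have [t [t0 t1]] := absv_small K.
have [a a0 [_ ad]] := scale_into t0 t1 d0 v0.
have xv : x + a *: v - x = a *: v by rewrite addrAC subrr add0r.
have [|h1 h2] := hd (x + a *: v); first by rewrite /= xv.
rewrite /= xv in h1 h2.
have aa := absv_gt0 a0.
rewrite -(ltr_pM2l aa) -unormZ scalerBr -!linearZ.
have := unormB_le h2 h1; set D := f _ - f _; set P := A _; set Q := B _.
rewrite (_ : D - Q - (D - P) = P - Q); last by rewrite opprB addrC addrA subrK.
rewrite unormZ => /le_lt_trans; apply.
rewrite mulrCA ltr_pM2l // divfK ?gt_eqF //.
exact: half_lt.
Qed.

Lemma differentialE E F (f : E -> F) x (A : {linear E -> F}) :
  is_differential f x A -> differential f x =1 A.
Proof.
move=> hA; apply: (@differential_unique _ _ f x) => //.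
by apply: getPex; exists A.
Qed.

Lemma quadratic_differential E F (f : E -> F) x (L : {linear E -> F})
    r Q : continuous L -> 0 < r ->
  (forall y, unorm y < r -> unorm (f (x + y) - f x - L y) <= Q * unorm y ^+ 2) ->
  is_differential f x L.
Proof.
move=> cL r0 h; split=> // e e0; have Q1 : 0 < `|Q| + 1 by rewrite ltr_wpDl.
apply/nbhs_unormP; exists (Num.min r (e / (`|Q| + 1))).
  by rewrite lt_min r0 divr_gt0.
move=> y; rewrite /= lt_min => /andP[yr ye].
have := h _ yr; rewrite (addrC x) subrK => /le_trans; apply.
rewrite expr2 mulrA ler_wpM2r ?unorm_ge0 //.
move: ye; rewrite ltr_pdivlMr // => /ltW; apply: le_trans; rewrite mulrC.
by rewrite ler_wpM2l ?unorm_ge0 // (le_trans (ler_norm _)) // lerDl.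
Qed.

Lemma an_at_differential E F (f : E -> F) x :
  an_at f x -> is_differential f x (differential f x).
Proof.
move=> [r [C [r0 hf]]]; apply: getPex.
have [L [b [cL hb b0 b1]]] := series_remainder r0 hf; exists L.
apply: (quadratic_differential cL r0 (Q := C / r ^+ 2)) => y yr.
by have := series_quadratic r0 hb b0 b1 yr; rewrite addr0.
Qed.

Lemma differential_cont E F (f : E -> F) x :
  an_at f x -> continuous (differential f x).
Proof. by move=> /an_at_differential[]. Qed.

Lemma differential_comp E F G (g : F -> G) (f : E -> F) x v :
  an_at f x -> an_at g (f x) ->
  differential (g \o f) x v = differential g (f x) (differential f x v).
Proof.
move=> hf hg; have cf := an_at_cont hf.
have [cA hA] := an_at_differential hf; have [cB hB] := an_at_differential hg.
set A := differential f x in cA hA *; set B := differential g (f x) in cB hB *.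
suff : is_differential (g \o f) x (B \o A) by move/differentialE => ->.
have [a a0 ha] := cont_linear_bounded cA.
have [b b0 hb] := cont_linear_bounded cB.
have hBA u : unorm (B (A u)) <= (b * a) * unorm u.
  by apply: le_trans (hb _) _; rewrite -mulrA ler_wpM2l.
split; first exact: (@bounded_continuous _ _ _ _ (B \o A) _ hBA).
move=> e e0.
have a1 : 0 < a + 1 by rewrite ltr_wpDl.
have b1 : 0 < b + 1 by rewrite ltr_wpDl.
(* As [e2 <= 1], [f] is Lipschitz near [x] with constant [a + 1]; moreover [e1 * (a + 1) = e] and
   [(b + 1) * e2 <= e]. *)
pose e1 := e / (a + 1); have e10 : 0 < e1 by rewrite divr_gt0.
pose e2 := Num.min 1 (e / (b + 1)).
have e20 : 0 < e2 by rewrite lt_min ltr01 divr_gt0.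
have n1 : \forall y \near x, unorm (g (f y) - g (f x) - B (f y - f x)) <=
    e1 * unorm (f y - f x) by exact: cf (hB _ e10).
have n2 := hA _ e20.
apply: filterS (filterI n1 n2) => y [/= h1 h2].
set z := unorm (y - x) in h2 *; have z0 : 0 <= z := unorm_ge0 _.
have hfy : unorm (f y - f x) <= (a + 1) * z.
  rewrite -(subrK (A (y - x)) (f y - f x)); apply: unormD_le.
    apply: le_trans h2 _; apply: ler_wpM2r => //.
    by apply: (@le_trans _ _ 1); [rewrite ge_min lexx|rewrite lerDr].
  by apply: le_trans (ha _) _; apply: ler_wpM2r => //; rewrite lerDl.
have -> : g (f y) - g (f x) - B (A (y - x)) =
   (g (f y) - g (f x) - B (f y - f x)) + B (f y - f x - A (y - x)).
  by rewrite [B (_ - A _)]linearB /= addrA subrK.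
apply: unormD_le.
  apply: le_trans h1 _; apply: le_trans (_ : e1 * ((a + 1) * z) <= _).
    by rewrite ler_wpM2l // ltW.
  by rewrite mulrA /e1 divfK ?gt_eqF.
apply: le_trans (hb _) _; apply: (@le_trans _ _ ((b + 1) * (e2 * z))).
  by apply: ler_pM => //; [exact: unorm_ge0|rewrite lerDl].
rewrite mulrA; apply: ler_wpM2r => //.
by rewrite mulrC -ler_pdivlMr // ge_min lexx orbT.
Qed.

Lemma eq_differential E F (f g : E -> F) x v :
  (\forall y \near x, f y = g y) -> an_at f x ->
  differential f x v = differential g x v.
Proof.
move=> fg hf; have [cA hA] := an_at_differential hf.
suff : is_differential g x (differential f x) by move/differentialE => ->.
split=> // e e0; apply: filterS (filterI fg (hA _ e0)) => y [<-].
by rewrite (nbhs_singleton fg).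
Qed.

Lemma differential_linear E F (L : {linear E -> F}) x :
  continuous L -> differential L x =1 L.
Proof.
move=> cL; apply: differentialE; split=> // e e0.
apply: filterE => y; rewrite linearB subrr unorm0 mulr_ge0 ?unorm_ge0 //.
exact: ltW.
Qed.

Lemma differential_translate E F (L : {linear E -> F}) c x :
  continuous L -> differential (fun y => L y + c) x =1 L.
Proof.
move=> cL; apply: differentialE; split=> // e e0; apply: filterE => y.
rewrite opprD addrACA subrr addr0 linearB subrr unorm0 mulr_ge0 ?unorm_ge0 //.
exact: ltW.
Qed.

Lemma differential_id E (f : E -> E) x :
  (\forall y \near x, f y = y) -> differential f x =1 id.
Proof.
move=> h v; rewrite -(eq_differential (f := id)); first last.
- exact: an_at_id.
- by apply: filterS h => y ->.
by apply: (@differential_linear E E idfun x) => ?.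
Qed.

Lemma differential_inverse E F (f : E -> F) (g : F -> E) x :
  an_at f x -> an_at g (f x) -> (\forall y \near x, g (f y) = y) ->
  cancel (differential f x) (differential g (f x)).
Proof.
by move=> hf hg h v; rewrite -differential_comp // differential_id.
Qed.

End differentials.

(** * Contractions on families of power series and the local inverse theorem *)

Section fixpoint.
Context (R : realType) (K : ultraField R).
Implicit Types E F : ultraBanach K.

Lemma asballN E F r C (f : E -> F) : 0 < r -> asball r C f ->
  asball r C (fun y => - f y).
Proof.
move=> r0 hf; rewrite -[C]mul1r.
by apply: (asball_comp_linear (L := -%R)) => // x; rewrite unormN mul1r.
Qed.

Lemma asballB E F r C (f g : E -> F) : 0 < r -> asball r C f ->
  asball r C g -> asball r C (fun y => f y - g y).
Proof. by move=> r0 hf hg; apply: asballD => //; exact: asballN. Qed.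

(** Banach's fixed point theorem for the Gauss norm, uniformly over an index set [I]: later [I] is
    the set of all times of an orbit. The increments of the iterates from 0 are at most
    [C * t ^+ m], so they can be summed as power series. *)
Lemma asball_fixpoint (I : Type) (E F : ultraBanach K) (r C t : R)
    (Phi : (I -> E -> F) -> I -> E -> F) : 0 < r -> 0 <= C -> 0 <= t -> t < 1 ->
  (forall X, (forall i, asball r C (X i)) -> forall i, asball r C (Phi X i)) ->
  (forall X Y d, (forall i, asball r C (X i)) -> (forall i, asball r C (Y i)) ->
    (forall i, asball r d (fun y => X i y - Y i y)) ->
    forall i, asball r (t * d) (fun y => Phi X i y - Phi Y i y)) ->
  exists X, (forall i, asball r C (X i)) /\
    forall i y, unorm y < r -> X i y = Phi X i y.
Proof.
move=> r0 C0 t0 t1 hC ht.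
pose S m := iter m Phi (fun _ _ => 0).
have SC m i : asball r C (S m i).
  elim: m i => [|m IH] i; first by apply: asball_cst; rewrite ?unorm0.
  exact: hC.
have SS m i : asball r (C * t ^+ m) (fun y => S m.+1 i y - S m i y).
  elim: m i => [|m IH] i.
    by rewrite expr0 mulr1; apply: asballB => //; exact: SC.
  by rewrite exprS mulrCA; exact: (ht _ _ _ (SC m.+1) (SC m) IH).
have Ct m : C * t ^+ m <= C by apply: ler_piMr => //; apply: exprn_ile1 => //; exact: ltW.
have small e : 0 < e -> exists N, forall m, (N <= m)%N -> C * t ^+ m < e.
  exact: geometric_small.
have /choice[X hX] : forall iy : I * E, exists l, unorm iy.2 < r ->
    usum (fun m => S m.+1 iy.1 iy.2 - S m iy.1 iy.2) l.
  move=> [i y] /=; have [yr|_] := boolP (unorm y < r); last by exists 0.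
  have [|l hl] := @usum_ex _ _ F (fun m => S m.+1 i y - S m i y); last by exists l.
  move=> e /small[N hN]; exists N => m /hN; apply: le_lt_trans.
  exact: (asball_bound r0 (SS m i) yr).
have tel m i y : \sum_(k < m) (S k.+1 i y - S k i y) = S m i y.
  by rewrite -(big_mkord xpredT (fun k => S k.+1 i y - S k i y)) telescope_sumr // subr0.
have XS i m : asball r (C * t ^+ m) (fun y => X (i, y) - S m i y).
  apply: (asball_sum r0 (f := fun k y => S (m + k).+1 i y - S (m + k) i y)
    (c := fun k => C * t ^+ (m + k))) => //.
  - move=> k; rewrite exprD; apply: ler_wpM2l => //; apply: ler_piMr; first exact: exprn_ge0.
    by apply: exprn_ile1 => //; exact: ltW.
  - move=> e /small[N hN]; exists N => k Nk; apply: hN.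
    exact: leq_trans (leq_addl _ _).
  - by move=> y yr; have := usum_shift m (hX (i, y) yr); rewrite tel.
have XC i : asball r C (fun y => X (i, y)).
  by have := XS i 0%N; rewrite expr0 mulr1; apply: eq_asball => y _; rewrite subr0.
exists (fun i y => X (i, y)); split=> // i y yr.
apply/eqP; rewrite -subr_eq0; apply/eqP/unorm_small => e /small[N hN].
apply: (@le_lt_trans _ _ (C * t ^+ N.+1)); last by apply: hN; exact: leqnSn.
have h1 := asball_bound r0 (XS i N.+1) yr.
have h2 := ht _ _ _ XC (SC N) (XS^~ N) i.
have {}h2 := asball_bound r0 h2 yr.
(* Both differences on the right are at most [C * t ^+ N.+1]: the first is a tail of the series, the
   second the image under [Phi] of such a tail. *)
have -> : X (i, y) - Phi (fun i0 y0 => X (i0, y0)) i y =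
    (X (i, y) - S N.+1 i y) - (Phi (fun i0 y0 => X (i0, y0)) i y - Phi (S N) i y).
  by rewrite opprB addrA subrK.
by apply: unormB_le => //; rewrite exprS mulrCA.
Qed.

(** On Gauss norms at most [r], the last inequality makes the constant of [asball_comp_sub] at most
    one half; [r1] stands for any further constraint on the radius. *)
Lemma contraction_radius (s D r1 : R) : 0 < s -> 0 <= D -> 0 < r1 ->
  exists r, [/\ 0 < r, r < s, r <= r1 & D / s ^+ 2 * r <= 2^-1].
Proof.
move=> s0 D0 r10; have Q0 : 0 <= D / s ^+ 2 by rewrite divr_ge0 // exprn_ge0 // ltW.
have Q1 : 0 < D / s ^+ 2 + 1 by rewrite ltr_wpDl.
exists (Num.min (s / 2) (Num.min r1 (2^-1 / (D / s ^+ 2 + 1)))).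
set m := Num.min r1 _.
have m0 : 0 < m by rewrite lt_min r10 divr_gt0 ?invr_gt0.
have mr : Num.min (s / 2) m <= m by rewrite ge_min lexx orbT.
split.
- by rewrite lt_min divr_gt0.
- by apply: le_lt_trans (half_lt s0); rewrite ge_min lexx.
- by apply: le_trans mr _; rewrite ge_min lexx.
- apply: (@le_trans _ _ ((D / s ^+ 2 + 1) * m)).
    by apply: ler_pM => //; [rewrite le_min divr_ge0 ?(ltW s0) // ltW|rewrite lerDl].
  by rewrite mulrC -ler_pdivlMr // ge_min lexx orbT.
Qed.

Lemma remainder_at0 E F (f : E -> F) : an_at f 0 -> f 0 = 0 ->
  exists s D b, [/\ 0 < s, 0 <= D,
    has_series s D b (fun y => f y - differential f 0 y),
    forall v, b 0%N v = 0 & forall v, b 1%N v = 0].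
Proof.
move=> hf f0; have [s [D [s0 hs]]] := hf.
have {}hs : asball s D f by apply: eq_asball hs => y _; rewrite add0r.
have [L [b [cL hb b0 b1]]] := series_remainder s0 hs.
have hL : is_differential f 0 L.
  apply: (quadratic_differential cL s0 (Q := D / s ^+ 2)) => y yr.
  by have := series_quadratic s0 hb b0 b1 yr; rewrite add0r.
exists s, D, b; split=> //; first exact: asball_ge0 hs.
have -> : (fun y => f y - differential f 0 y) = fun y => f y - f 0 - L y.
  by apply/funext => y; rewrite f0 subr0 (differentialE hL).
exact: hb.
Qed.

(** Write [h = id + g], where [g] has Lipschitz constant one half on the ball. By the isosceles
    principle [h] is an isometry, and its inverse is the fixed point of [X |-> y - g (X y)]. *)
Lemma local_inverse E (h : E -> E) : an_at h 0 -> h 0 = 0 ->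
  differential h 0 =1 id ->
  exists r H, [/\ 0 < r, asball r r h, asball r r H &
    forall x, unorm x < r -> [/\ unorm (h x) = unorm x, unorm (H x) = unorm x,
      h (H x) = x & H (h x) = x]].
Proof.
move=> hh h0 dh; have [s [D [b [s0 D0 hb b0 b1]]]] := remainder_at0 hh h0.
have [g gE] : exists g, forall y, g y = h y - y by exists (fun y => h y - y).
have {}hb : has_series s D b g.
  by rewrite (_ : g = fun y => h y - differential h 0 y) //; apply/funext => y; rewrite gE dh.
have [r [r0 rs _ rD]] := contraction_radius s0 D0 (ltr01 : 0 < (1 : R)).
have t1 : 2^-1 < 1 :> R by rewrite invf_lt1 // ltr1n.
have t0 : 0 <= 2^-1 :> R by rewrite invr_ge0.
have g0 : g 0 = 0 by rewrite gE h0 subrr.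
have gsub (P : ultraBanach K) (f1 f2 : P -> E) d : asball r r f1 -> asball r r f2 ->
    asball r d (fun y => f1 y - f2 y) ->
    asball r (2^-1 * d) (fun y => g (f1 y) - g (f2 y)).
  move=> h1 h2 h12; have d0 := asball_ge0 h12.
  apply: asball_le (asball_comp_sub r0 rs hb b0 b1 h1 h2 h12) => //.
  by apply: ler_wpM2r.
have idb : asball r r (fun y : E => y).
  rewrite -[X in asball _ X]mul1r.
  by apply: (asball_linear r0 (L := idfun)) => // x; rewrite mul1r.
have gb (P : ultraBanach K) (f1 : P -> E) : asball r r f1 -> asball r r (fun y => g (f1 y)).
  move=> h1; have z : asball r r (fun _ : P => 0 : E).
    by apply: asball_cst; rewrite ?unorm0 ?ltW.
  have h10 : asball r r (fun y => f1 y - 0) by apply: eq_asball h1 => y _; rewrite subr0.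
  have tr : 2^-1 * r <= r by rewrite ler_piMl // ltW.
  apply: eq_asball (asball_le r0 tr (gsub _ _ _ _ h1 z h10)) => y _.
  by rewrite g0 subr0.
have [|X Y d hX hY hXY i|X [hX XE]] := @asball_fixpoint unit E E r r 2^-1
  (fun X _ y => y - g (X tt y)) r0 (ltW r0) t0 t1.
- by move=> X hX _; apply: asballB => //; exact: gb.
- have := asballN r0 (gsub _ _ _ _ (hX tt) (hY tt) (hXY tt)).
  by apply: eq_asball => y _ /=; rewrite !opprB [RHS]addrC addrA subrK.
(* The estimate for series is applied to constant ones. *)
have glip x x' : unorm x < r -> unorm x' < r -> unorm (g x - g x') <= 2^-1 * unorm (x - x').
  move=> xr xr'.
  have c (z : E) : unorm z < r -> asball r r (fun _ : E => z).
    by move=> zr; apply: asball_cst => //; exact: ltW.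
  have cd : asball r (unorm (x - x')) (fun _ : E => x - x') by exact: asball_cst.
  have := asball_bound r0 (gsub _ _ _ _ (c _ xr) (c _ xr') cd) (y := 0).
  by apply; rewrite unorm0.
have iso x x' : unorm x < r -> unorm x' < r -> unorm (h x - h x') = unorm (x - x').
  move=> xr xr'; have -> : h x - h x' = (x - x') + (g x - g x').
    by rewrite -[h x](subrK x) -[h x'](subrK x') -!gE opprD addrACA addrC.
  have [->|xx] := eqVneq x x'; first by rewrite !subrr addr0.
  apply: unorm_dominant; apply: le_lt_trans (glip _ _ xr xr') _.
  by rewrite gtr_pMl // unorm_gt0 // subr_eq0.
have norm_h x : unorm x < r -> unorm (h x) = unorm x.
  move=> xr; have z : unorm (0 : E) < r by rewrite unorm0.
  by have := iso x 0 xr z; rewrite h0 !subr0.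
have hh2 : asball r r h.
  by apply: eq_asball (asballD r0 (gb _ _ idb) idb) => y _; rewrite gE subrK.
pose H y := X tt y.
(* The Gauss norm only gives [unorm (H y) <= r]. Then [g (H y)] is at most half of [r], and the
   fixed point equation makes the inequality strict. *)
have Hr y : unorm y < r -> unorm (H y) < r.
  move=> yr; have Hle := asball_bound r0 (hX tt) yr.
  have : unorm (g (H y)) < r.
    have z : asball r r (fun _ : E => 0 : E) by apply: asball_cst; rewrite ?unorm0 ?ltW.
    have h10 : asball r r (fun y => H y - 0) by apply: eq_asball (hX tt) => w _; rewrite subr0.
    have := asball_bound r0 (gsub _ _ _ _ (hX tt) z h10) yr; rewrite g0 subr0.
    by move/le_lt_trans; apply; rewrite gtr_pMl.
  by move=> gr; rewrite /H XE //; exact: unormB_lt.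
have hH y : unorm y < r -> h (H y) = y.
  move=> yr; have e : H y = y - g (H y) := XE tt y yr.
  by rewrite -[h (H y)](subrK (H y)) -gE {2}e addrC subrK.
exists r, H; split=> //; first exact: (hX tt).
move=> x xr; have hx := norm_h _ xr; split=> //.
- by rewrite -[in RHS](hH x xr) norm_h // Hr.
- exact: hH.
- have hxr : unorm (h x) < r by rewrite hx.
  apply/eqP; rewrite -subr_eq0; apply/eqP/unorm_eq0.
  by rewrite -iso // ?Hr // hH // subrr unorm0.
Qed.

End fixpoint.

(** * Bounded orbits near a fixed point *)

(* E splits into the stable image of ps, the centre image of j and the unstable
   image of pu; the norm of E is adapted to this splitting. *)
Record csplit (R : realType) (K : ultraField R) (P E : ultraBanach K)
    (alpha : E -> E) (beta ps pu : {linear E -> E}) (j : {linear P -> E})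
    (k : {linear E -> P}) (a : R) : Prop := CSplit {
  cs_jnorm : forall y, unorm (j y) = unorm y ;
  cs_jk : forall y, k (j y) = y ;
  cs_knorm : forall x, unorm (k x) <= unorm x ;
  cs_psnorm : forall x, unorm (ps x) <= unorm x ;
  cs_punorm : forall x, unorm (pu x) <= unorm x ;
  cs_dec : forall x, ps x + j (k x) + pu x = x ;
  cs_psps : forall x, ps (ps x) = ps x ;
  cs_pupu : forall x, pu (pu x) = pu x ;
  cs_pspu : forall x, ps (pu x) = 0 ;
  cs_pups : forall x, pu (ps x) = 0 ;
  cs_psj : forall y, ps (j y) = 0 ;
  cs_puj : forall y, pu (j y) = 0 ;
  cs_kps : forall x, k (ps x) = 0 ;
  cs_kpu : forall x, k (pu x) = 0 ;
  cs_ab : cancel beta alpha ;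
  cs_ba : cancel alpha beta ;
  cs_aps : forall x, ps (alpha x) = alpha (ps x) ;
  cs_apu : forall x, pu (alpha x) = alpha (pu x) ;
  cs_ac : forall x, j (k (alpha x)) = alpha (j (k x)) ;
  cs_a0 : 0 <= a ;
  cs_a1 : a < 1 ;
  cs_sbound : forall x, unorm (alpha (ps x)) <= a * unorm (ps x) ;
  cs_ubound : forall x, unorm (beta (pu x)) <= a * unorm (pu x) ;
  cs_cnorm : forall y, unorm (alpha (j y)) = unorm y
}.

(** A bound [r] on the whole family improves to the maximum of [w] and [r * t ^+ m] for every [m].
    The index set matters: the estimate at one time uses those at neighbouring times. *)
Lemma contraction_bound (I : Type) (R : realType) (z : I -> R) (t r w : R) :
  0 <= t -> t < 1 -> 0 <= w -> (forall n, z n <= r) ->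
  (forall n d, (forall i, z i <= d) -> z n <= Num.max w (t * d)) ->
  forall n, z n <= w.
Proof.
move=> t0 t1 w0 zr step.
have h m n : z n <= Num.max w (r * t ^+ m).
  elim: m n => [|m IH] n; first by rewrite expr0 mulr1 le_max zr orbT.
  apply: le_trans (step n _ IH) _; rewrite ge_max le_max lexx /=.
  rewrite exprS mulrCA maxr_pMr // ge_max !le_max lexx orbT andbT.
  by rewrite ler_piMl // ltW.
move=> n; rewrite leNgt; apply/negP => wz.
have [N hN] := geometric_small r t0 t1 (le_lt_trans w0 wz).
by have := h N n; rewrite leNgt gt_max wz hN.
Qed.

Section centre_orbits.
Context (R : realType) (K : ultraField R) (P E : ultraBanach K).
Variables (f : E -> E) (beta : {linear E -> E}) (ps pu : {linear E -> E}).
Variables (j : {linear P -> E}) (k : {linear E -> P}) (a : R).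
Local Notation alpha := (differential f 0).
Hypotheses (f0 : f 0 = 0) (cs : csplit alpha beta ps pu j k a).
Let jnorm := cs_jnorm cs.
Let jk := cs_jk cs.
Let knorm := cs_knorm cs.
Let psnorm := cs_psnorm cs.
Let punorm := cs_punorm cs.
Let dec := cs_dec cs.
Let psps := cs_psps cs.
Let pupu := cs_pupu cs.
Let pspu := cs_pspu cs.
Let pups := cs_pups cs.
Let psj := cs_psj cs.
Let puj := cs_puj cs.
Let kps := cs_kps cs.
Let kpu := cs_kpu cs.
Let ab := cs_ab cs.
Let ba := cs_ba cs.
Let aps := cs_aps cs.
Let apu := cs_apu cs.
Let ac := cs_ac cs.
Let a0 := cs_a0 cs.
Let a1 := cs_a1 cs.
Let sbound := cs_sbound cs.
Let ubound := cs_ubound cs.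
Let cnorm := cs_cnorm cs.

Let bpu x : pu (beta x) = beta (pu x).
Proof. by rewrite -[LHS]ba -apu ab. Qed.

Let bps x : ps (beta x) = beta (ps x).
Proof. by rewrite -[LHS]ba -aps ab. Qed.

Let bc x : j (k (beta x)) = beta (j (k x)).
Proof. by rewrite -[LHS]ba -ac ab. Qed.

Let bcnorm y : unorm (beta (j y)) = unorm y.
Proof.
by rewrite -[in LHS](jk y) -bc jnorm -cnorm bc jk ab jnorm.
Qed.

Variable g : E -> E.
Hypothesis gE : forall x, f x = alpha x + g x.

Let opS x := alpha (ps x).
Let opU x := beta (pu x).
Let opC x := alpha (j (k x)).
Let opD x := beta (j (k x)).

Fixpoint cpos (y : P) (x : int -> E) m : E :=
  if m is m'.+1 then opC (cpos y x m') + j (k (g (x (Posz m')))) else j y.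

(** [cneg y x m] belongs to time [-m], whereas [Negz m] is [-(m + 1)], whence the shift in [corbit].
    The recursion solves [x_{n+1} = alpha x_n + g (x_n)] for the centre part of [x_n]. *)
Fixpoint cneg (y : P) (x : int -> E) m : E :=
  if m is m'.+1 then opD (cneg y x m' - g (x (Negz m'))) else j y.

Definition corbit y x n : E :=
  match n with Posz m => cpos y x m | Negz m => cneg y x m.+1 end.

(* The bounded orbits x of f with centre component y at time 0 are the fixed
   points of Phi y: the stable component is propagated forwards, the unstable
   one backwards, and the centre one in both directions, starting from y. *)
Definition Phi y x n : E :=
  opS (x (n - 1)) + ps (g (x (n - 1))) + opU (x (n + 1) - g (x n)) + corbit y x n.

Let lin_sub (Q : ultraBanach K) r d l (X Y : Q -> E) (L : {linear E -> E}) : 0 < r ->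
  (forall x, unorm (L x) <= l * unorm x) -> 0 <= l ->
  asball r d (fun y => X y - Y y) -> asball r (l * d) (fun y => L (X y) - L (Y y)).
Proof.
move=> r0 Lb l0 h.
by apply: eq_asball (asball_comp_linear Lb l0 h) => y _ /=; rewrite linearB.
Qed.

Let bS x : unorm (opS x) <= a * unorm x.
Proof. by apply: le_trans (sbound x) _; apply: ler_wpM2l. Qed.
Let bU x : unorm (opU x) <= a * unorm x.
Proof. by apply: le_trans (ubound x) _; apply: ler_wpM2l. Qed.
Let bC x : unorm (opC x) <= 1 * unorm x.
Proof. by rewrite /opC cnorm mul1r. Qed.
Let bD x : unorm (opD x) <= 1 * unorm x.
Proof. by rewrite /opD bcnorm mul1r. Qed.
Let bjk x : unorm (j (k x)) <= 1 * unorm x.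
Proof. by rewrite jnorm mul1r. Qed.
Let bps1 x : unorm (ps x) <= 1 * unorm x.
Proof. by rewrite mul1r. Qed.

Variables (s D r : R) (b : nat -> (nat -> E) -> E).
Hypotheses (D0 : 0 <= D) (hb : has_series s D b g)
  (b0 : forall v, b 0%N v = 0) (b1 : forall v, b 1%N v = 0).
Hypotheses (r0 : 0 < r) (rs : r < s) (rD : D / s ^+ 2 * r <= 2^-1).
(** The factor [a] comes from the stable and unstable linear parts, one half from [g]. *)
Let t := Num.max a 2^-1.

Let t0 : 0 <= t. Proof. by rewrite le_max a0. Qed.
Let t1 : t < 1. Proof. by rewrite gt_max a1 invf_lt1 // ltr1n. Qed.
Let a_le_t : a <= t. Proof. by rewrite le_max lexx. Qed.
Let ht : 2^-1 <= t. Proof. by rewrite le_max lexx orbT. Qed.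

Let g0 : g 0 = 0. Proof. by have := gE 0; rewrite f0 linear0 add0r => <-. Qed.

Let gsub (Q : ultraBanach K) (X Y : Q -> E) d : asball r r X -> asball r r Y ->
  asball r d (fun y => X y - Y y) ->
  asball r (t * d) (fun y => g (X y) - g (Y y)).
Proof.
move=> hX hY hXY; have d0 := asball_ge0 hXY.
apply: (asball_le r0 _ (asball_comp_sub r0 rs hb b0 b1 hX hY hXY)).
by apply: ler_wpM2r => //; apply: le_trans ht.
Qed.

Section differences.
Variables (Q : ultraBanach K) (eta : Q -> P) (X Y : int -> Q -> E) (d : R).
Hypotheses (hX : forall n, asball r r (X n)) (hY : forall n, asball r r (Y n)).
Hypothesis hXY : forall n, asball r d (fun q => X n q - Y n q).

Let d0 : 0 <= d := asball_ge0 (hXY 0).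
Let td0 : 0 <= t * d := mulr_ge0 t0 d0.

Let weak c f1 : c <= t * d -> asball r c f1 -> asball r (t * d) (f1 : Q -> E).
Proof. by move=> h; apply: (asball_le r0 h). Qed.

Let gXY n : asball r (t * d) (fun q => g (X n q) - g (Y n q)).
Proof. by apply: gsub. Qed.

Let rearr (x1 x2 y1 y2 : E) : x1 + x2 - (y1 + y2) = (x1 - y1) + (x2 - y2).
Proof. by rewrite opprD addrACA. Qed.

(** Both sequences start at the same point, so their difference only collects differences of values
    of [g], transported isometrically. In an ultrametric sum these do not add up: the bound is
    independent of [m], and the centre component is contracted as well. *)
Lemma cpos_sub m : asball r (t * d)
  (fun q => cpos (eta q) (X^~ q) m - cpos (eta q) (Y^~ q) m).
Proof.
elim: m => [|m IH] /=.
  apply: (@eq_asball _ _ _ _ _ _ (fun=> 0)) => [q _|]; first by rewrite subrr.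
  by apply: asball_cst; rewrite ?unorm0.
apply: (@eq_asball _ _ _ _ _ _ (fun q => (opC (cpos (eta q) (X^~ q) m) -
  opC (cpos (eta q) (Y^~ q) m)) + (j (k (g (X m q))) - j (k (g (Y m q)))))) => [q _|].
  by rewrite rearr.
apply: asballD => //; rewrite -[X in asball _ X]mul1r.
  exact: (lin_sub (L := alpha \o (j \o k)) r0 bC ler01 IH).
exact: (lin_sub (L := j \o k) r0 bjk ler01 (gXY m)).
Qed.

Lemma cneg_sub m : asball r (t * d)
  (fun q => cneg (eta q) (X^~ q) m - cneg (eta q) (Y^~ q) m).
Proof.
elim: m => [|m IH] /=.
  apply: (@eq_asball _ _ _ _ _ _ (fun=> 0)) => [q _|]; first by rewrite subrr.
  by apply: asball_cst; rewrite ?unorm0.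
rewrite -[X in asball _ X]mul1r; apply: (lin_sub (L := beta \o (j \o k)) r0 bD ler01).
apply: (@eq_asball _ _ _ _ _ _ (fun q => (cneg (eta q) (X^~ q) m -
  cneg (eta q) (Y^~ q) m) - (g (X (Negz m) q) - g (Y (Negz m) q)))) => [q _|].
  by rewrite opprB rearr opprK [g _ - g _]addrC.
by apply: asballB.
Qed.

(** The parameter space [Q] and the map [eta] make this serve twice: with [eta = id] for series
    depending on the centre component, and with constants for comparing two single sequences. *)
Lemma Phi_sub n : asball r (t * d)
  (fun q => Phi (eta q) (X^~ q) n - Phi (eta q) (Y^~ q) n).
Proof.
apply: (@eq_asball _ _ _ _ _ _ (fun q =>
  (opS (X (n - 1) q) - opS (Y (n - 1) q)) +
  (ps (g (X (n - 1) q)) - ps (g (Y (n - 1) q))) +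
  (opU (X (n + 1) q - g (X n q)) - opU (Y (n + 1) q - g (Y n q))) +
  (corbit (eta q) (X^~ q) n - corbit (eta q) (Y^~ q) n))) => [q _|].
  by rewrite /Phi !rearr.
apply: asballD => //; last first.
  by case: n => m; [exact: cpos_sub|exact: cneg_sub m.+1].
apply: asballD => //; last first.
  apply: (weak (_ : a * d <= _)); first by rewrite ler_wpM2r.
  apply: (lin_sub (L := beta \o pu) r0 bU a0).
  apply: (@eq_asball _ _ _ _ _ _ (fun q => (X (n + 1) q - Y (n + 1) q) -
    (g (X n q) - g (Y n q)))) => [q _|].
    by rewrite opprB rearr opprK [g _ - g _]addrC.
  apply: asballB => //; apply: (asball_le r0 _ (gXY n)).
  by rewrite ler_piMl // ltW.
apply: asballD => //.
  apply: (weak (_ : a * d <= _)); first by rewrite ler_wpM2r.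
  exact: (lin_sub (L := alpha \o ps) r0 bS a0).
rewrite -[X in asball _ X]mul1r.
exact: (lin_sub r0 bps1 ler01 (gXY _)).
Qed.

End differences.
Let opS0 : opS 0 = 0. Proof. by rewrite /opS !linear0. Qed.
Let opU0 : opU 0 = 0. Proof. by rewrite /opU !linear0. Qed.
Let cpos0 y m : unorm (cpos y (fun=> 0) m) <= unorm y.
Proof.
elim: m => [|m IH] /=; first by rewrite jnorm.
rewrite g0 !linear0 addr0; apply: le_trans (bC _) _; by rewrite mul1r.
Qed.

Let cneg0 y m : unorm (cneg y (fun=> 0) m) <= unorm y.
Proof.
elim: m => [|m IH] /=; first by rewrite jnorm.
rewrite g0 subr0; apply: le_trans (bD _) _; by rewrite mul1r.
Qed.

Lemma Phi0 y n : Phi y (fun=> 0) n = corbit y (fun=> 0) n.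
Proof. by rewrite /Phi g0 subrr opS0 opU0 linear0 !add0r. Qed.

Lemma Phi0_norm y n : unorm (Phi y (fun=> 0) n) <= unorm y.
Proof. by rewrite Phi0; case: n => m; [exact: cpos0|exact: cneg0]. Qed.

Lemma Phi0_asball n : asball r r (fun y => Phi y (fun=> 0) n).
Proof.
have hj : asball r r j.
  rewrite -[X in asball _ X]mul1r; by apply: asball_linear => // x; rewrite jnorm mul1r.
have hp m : asball r r (fun y => cpos y (fun=> 0) m).
  elim: m => [//|m IH] /=.
  have := asball_comp_linear (L := alpha \o (j \o k)) bC ler01 IH; rewrite mul1r.
  by apply: eq_asball => y _ /=; rewrite g0 !linear0 addr0.
have hn m : asball r r (fun y => cneg y (fun=> 0) m).
  elim: m => [//|m IH] /=.
  have := asball_comp_linear (L := beta \o (j \o k)) bD ler01 IH; rewrite mul1r.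
  by apply: eq_asball => y _ /=; rewrite g0 subr0.
apply: (@eq_asball _ _ _ _ _ _ (fun y => corbit y (fun=> 0) n)) => [y _|].
  by rewrite Phi0.
by case: n => m; [exact: hp|exact: hn m.+1].
Qed.

Let jkC z : j (k (opC z)) = opC z.
Proof. by rewrite /opC ac jk. Qed.
Let jkD z : j (k (opD z)) = opD z.
Proof. by rewrite /opD bc jk. Qed.
Let opCD z : opC (opD z) = j (k z).
Proof. by rewrite /opC /opD bc jk ab. Qed.

Let jk_cpos y x m : j (k (cpos y x m)) = cpos y x m.
Proof. by case: m => [|m] /=; [rewrite jk|rewrite !linearD /= jkC jk]. Qed.

Let jk_cneg y x m : j (k (cneg y x m)) = cneg y x m.
Proof. by case: m => [|m] /=; rewrite ?jk ?jkD. Qed.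

Let jk_corbit y x n : j (k (corbit y x n)) = corbit y x n.
Proof. by case: n => m; [exact: jk_cpos|exact: jk_cneg]. Qed.

Let psS z : ps (opS z) = opS z. Proof. by rewrite /opS aps psps. Qed.
Let psU z : ps (opU z) = 0. Proof. by rewrite /opU bps pspu linear0. Qed.
Let puS z : pu (opS z) = 0. Proof. by rewrite /opS apu pups linear0. Qed.
Let puU z : pu (opU z) = opU z. Proof. by rewrite /opU bpu pupu. Qed.
Let kS z : k (opS z) = 0.
Proof. by rewrite -[LHS]jk /opS ac kps !linear0. Qed.
Let kU z : k (opU z) = 0.
Proof. by rewrite -[LHS]jk /opU bc kpu !linear0. Qed.

Let negz_succ m : Negz m.+1 + 1 = Negz m.
Proof. by rewrite !NegzE -[m.+2]addn1 PoszD opprD subrK. Qed.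

Let negz0_succ : Negz 0 + 1 = 0.
Proof. by rewrite NegzE addNr. Qed.

Let posz_succ m : Posz m + 1 = Posz m.+1.
Proof. by rewrite -PoszD addn1. Qed.

Let corbit_step y x n :
  corbit y x (n + 1) = opC (corbit y x n) + j (k (g (x n))).
Proof.
case: n => [m|[|m]]; first by rewrite posz_succ.
  by rewrite negz0_succ /= opCD !linearB /= jk subrK.
rewrite negz_succ [in RHS]/= opCD [in RHS]linearB [in RHS]linearB /=.
by rewrite -/(cneg y x m.+1) (jk_cneg y x m.+1) subrK.
Qed.

Lemma orbit_Phi x : (forall n, f (x n) = x (n + 1)) ->
  forall n, x n = Phi (k (x 0)) x n.
Proof.
move=> hx; have hc : forall n, corbit (k (x 0)) x n = j (k (x n)).
  have hp m : cpos (k (x 0)) x m = j (k (x (Posz m))).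
    elim: m => [//|m IH] /=; rewrite IH -posz_succ -hx gE !linearD /= ac.
    by rewrite /opC jk.
  have hn m : cneg (k (x 0)) x m.+1 = j (k (x (Negz m))).
    elim: m => [|m IH].
      rewrite /= -[in k (x 0)]negz0_succ -hx gE /opD !linearB !linearD /=.
      by rewrite !jk addrK ac ba.
    rewrite [LHS]/= -/(cneg (k (x 0)) x m.+1) IH -negz_succ -hx gE /opD.
    by rewrite !linearB !linearD /= !jk addrK ac ba.
  by case=> m; [exact: hp|exact: hn].
move=> n; rewrite /Phi hc -[LHS]dec -addrA [j _ + _]addrC addrA; congr (_ + _ + _).
  rewrite -{1}[n](subrK 1) -hx gE linearD /= aps; congr (_ + _).
by rewrite -hx gE addrK /opU apu ba.
Qed.

(** [ps], [pu] and [k] each isolate one summand of [Phi]; the three resulting recursions are the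
    components of the orbit equation. *)
Lemma Phi_orbit y x : (forall n, x n = Phi y x n) ->
  k (x 0) = y /\ forall n, f (x n) = x (n + 1).
Proof.
move=> hx.
have psC n : ps (corbit y x n) = 0 by rewrite -jk_corbit psj.
have puC n : pu (corbit y x n) = 0 by rewrite -jk_corbit puj.
have hps n : ps (x n) = opS (x (n - 1)) + ps (g (x (n - 1))).
  by rewrite {1}hx /Phi [LHS]linearD [ps (_ + opU _)]linearD [ps (opS _ + _)]linearD /=
    psU psS psps psC !addr0.
have hpu n : pu (x n) = opU (x (n + 1) - g (x n)).
  by rewrite {1}hx /Phi [LHS]linearD [pu (_ + opU _)]linearD [pu (opS _ + _)]linearD /=
    puS pups puU puC addr0 !add0r.
have hc n : j (k (x n)) = corbit y x n.
  rewrite {1}hx /Phi [k _]linearD [k (_ + opU _)]linearD [k (opS _ + _)]linearD /=.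
  by rewrite kS kps kU !add0r jk_corbit.
split; first by have := congr1 k (hc 0); rewrite /= !jk.
move=> n; rewrite -[LHS]dec -[RHS]dec; congr (_ + _ + _).
- by rewrite hps addrK gE linearD /= aps.
- by rewrite hc corbit_step -hc gE !linearD /= ac /opC jk.
- by rewrite gE linearD /= apu hpu /opU ab linearB /= subrK.
Qed.

Lemma Phi_contract y x x' d n : (forall n, unorm (x n) <= r) ->
  (forall n, unorm (x' n) <= r) -> (forall n, unorm (x n - x' n) <= d) ->
  unorm (Phi y x n - Phi y x' n) <= t * d.
Proof.
move=> hx hx' hd.
have c (z : E) e : unorm z <= e -> asball r e (fun _ : P => z).
  exact: asball_cst.
have := @Phi_sub P (fun=> y) (fun n _ => x n) (fun n _ => x' n) d _ _ _ n.
move=> /(_ (fun n => c _ _ (hx n)) (fun n => c _ _ (hx' n)) (fun n => c _ _ (hd n))).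
by move=> h; apply: (asball_bound r0 h (y := 0)); rewrite unorm0.
Qed.

Lemma bounded_orbit_unique (x x' : int -> E) : (forall n, unorm (x n) <= r) ->
  (forall n, unorm (x' n) <= r) -> (forall n, f (x n) = x (n + 1)) ->
  (forall n, f (x' n) = x' (n + 1)) -> k (x 0) = k (x' 0) -> x =1 x'.
Proof.
move=> hx hx' ox ox' e n; apply/eqP; rewrite -subr_eq0; apply/eqP/unorm_eq0/eqP.
rewrite eq_le unorm_ge0 andbT; move: n.
apply: (contraction_bound t0 t1 (lexx 0) (r := r)) => [n|n d hd].
  exact: unormB_le.
rewrite le_max; apply/orP; right; rewrite (orbit_Phi ox) (orbit_Phi ox') e.
exact: Phi_contract.
Qed.

Lemma centre_orbits_exist : exists X : int -> P -> E,
  [/\ forall n, asball r r (X n),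
      forall n y, unorm y < r -> f (X n y) = X (n + 1) y,
      forall n y, unorm y < r -> unorm (X n y) <= unorm y,
      forall y, unorm y < r -> k (X 0 y) = y /\
        unorm (X 0 y - j y) <= D / s ^+ 2 * unorm y ^+ 2
    & forall x : int -> E, (forall n, unorm (x n) <= r) ->
        (forall n, f (x n) = x (n + 1)) -> unorm (k (x 0)) < r ->
        forall n, x n = X n (k (x 0))].
Proof.
have [||X [hX XE]] := @asball_fixpoint R K int P E r r t
  (fun X n y => Phi y (X^~ y) n) r0 (ltW r0) t0 t1.
- move=> X hX n.
  have z (m : int) : asball r r (fun _ : P => 0 : E).
    by apply: asball_cst; rewrite ?unorm0 ?ltW.
  have hX0 m : asball r r (fun q => X m q - 0).
    by apply: eq_asball (hX m) => q _; rewrite subr0.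
  have h := @Phi_sub P id X (fun _ _ => 0) r hX z hX0 n.
  have tr : t * r <= r by rewrite ler_piMl // ltW.
  apply: eq_asball (asballD r0 (asball_le r0 tr h) (Phi0_asball n)) => q _.
  by rewrite subrK.
- by move=> X Y d hX hY hXY n; exact: (@Phi_sub P id).
have Xr n y : unorm y < r -> unorm (X n y) <= r.
  by move=> yr; exact: (asball_bound r0 (hX n) yr).
have orb y : unorm y < r -> k (X 0 y) = y /\ forall n, f (X n y) = X (n + 1) y.
  by move=> yr; apply: (@Phi_orbit y (X^~ y)) => n; exact: XE.
have Xy n y : unorm y < r -> unorm (X n y) <= unorm y.
  (* Compare with [Phi y] at the zero sequence, which is the linear orbit of [j y] and has norm at
     most [unorm y] at all times. *)
  move=> yr; move: n.
  apply: (contraction_bound t0 t1 (unorm_ge0 y) (r := r)) => [n|n d hd]; first exact: Xr.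
  rewrite XE // -(subrK (Phi y (fun=> 0) n) (Phi y (X^~ y) n)).
  apply: unormD_le; last by rewrite le_max Phi0_norm.
  rewrite le_max; apply/orP; right.
  apply: Phi_contract => [i|i|i]; [exact: Xr|by rewrite unorm0 ltW|by rewrite subr0].
exists X; split=> //; first by move=> n y yr; have [_] := orb y yr; apply.
all: cycle 1.
  move=> x hx ox xr; have [k0 oX] := orb _ xr.
  by apply: (@bounded_orbit_unique x (X^~ (k (x 0)))) => // i; exact: Xr.
move=> y yr; have [k0 oX] := orb _ yr; split=> //.
have Q0 : 0 <= D / s ^+ 2 * unorm y ^+ 2.
  by rewrite mulr_ge0 ?exprn_ge0 ?unorm_ge0 // divr_ge0 // exprn_ge0 // ltW // (lt_trans r0).
have gX n : unorm (g (X n y)) <= D / s ^+ 2 * unorm y ^+ 2.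
  have s0 : 0 < s := lt_trans r0 rs.
  apply: le_trans (series_quadratic s0 hb b0 b1 _) _.
    by apply: le_lt_trans (Xy n y yr) _; exact: lt_trans rs.
  apply: ler_wpM2l; first by rewrite divr_ge0 // exprn_ge0 // ltW.
  by rewrite lerXn2r ?nnegrE ?unorm_ge0 // Xy.
(* The stable component comes from the previous one, contracted by [a], and from [g]. Going back
   indefinitely leaves only the quadratic contributions of [g]; this makes the graph tangent to the
   centre space. *)
have hs n : unorm (ps (X n y)) <= D / s ^+ 2 * unorm y ^+ 2.
  move: n; apply: (contraction_bound t0 t1 Q0 (r := r)) => [n|n d hd].
    exact: le_trans (psnorm _) (Xr _ _ yr).
  rewrite -[n](subrK 1) -oX gE linearD /= aps; apply: unormD_le.
    rewrite le_max; apply/orP; right; apply: le_trans (sbound _) _.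
    by apply: ler_pM => //; exact: unorm_ge0.
  by rewrite le_max (le_trans (psnorm _)).
have hu n : unorm (pu (X n y)) <= D / s ^+ 2 * unorm y ^+ 2.
  move: n; apply: (contraction_bound t0 t1 Q0 (r := r)) => [n|n d hd].
    exact: le_trans (punorm _) (Xr _ _ yr).
  have -> : pu (X n y) = beta (pu (X (n + 1) y)) - beta (pu (g (X n y))).
    by rewrite -oX gE !linearD /= apu ba addrK.
  apply: unormB_le.
    rewrite le_max; apply/orP; right; apply: le_trans (ubound _) _.
    by apply: ler_pM => //; exact: unorm_ge0.
  rewrite le_max; apply/orP; left; apply: le_trans (ubound _) _.
  apply: le_trans (ler_piMl (unorm_ge0 _) (ltW a1)) _.
  by rewrite (le_trans (punorm _)).
rewrite -[X in unorm (X - _)]dec k0 addrAC addrK.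
exact: unormD_le.
Qed.

End centre_orbits.

(** * Open mapping theorem *)

Section open_mapping.
Context (R : realType) (K : ultraField R) (F G : ultraBanach K).
Variable B : {linear F -> G}.
Hypotheses (cB : continuous B) (surjB : forall y, exists x, B x = y).

(* Baire: otherwise there are nested balls of G whose common point avoids the image
   of every ball of F. *)
Let somewhere_dense : exists (n : nat) y0 d, 0 < d /\ forall y, unorm (y - y0) < d ->
  forall e, 0 < e -> exists2 x, unorm x <= n%:R & unorm (B x - y) < e.
Proof.
apply: contrapT => hn.
have avoid (n : nat) y0 d : 0 < d -> exists p : G * R,
    [/\ unorm (p.1 - y0) < d, 0 < p.2, p.2 <= d, p.2 <= n.+1%:R^-1 &
      forall x, unorm x <= n%:R -> p.2 <= unorm (B x - p.1)].
  move=> d0; apply: contrapT => h; apply: hn; exists n, y0, d; split=> // y yd e e0.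
  apply: contrapT => h'; apply: h.
  exists (y, Num.min e (Num.min d n.+1%:R^-1)) => /=; split=> //.
  - by rewrite !lt_min e0 d0 invr_gt0 ltr0n.
  - by rewrite !ge_min lexx orbT.
  - by rewrite !ge_min lexx !orbT.
  - move=> x xn; rewrite leNgt; apply/negP => hx; apply: h'; exists x => //.
    by apply: lt_le_trans hx _; rewrite ge_min lexx.
have /choice[nxt hnxt] : forall q : nat * (G * R), exists p : G * R, 0 < q.2.2 ->
    [/\ unorm (p.1 - q.2.1) < q.2.2, 0 < p.2, p.2 <= q.2.2, p.2 <= q.1.+1%:R^-1 &
      forall x, unorm x <= q.1%:R -> p.2 <= unorm (B x - p.1)].
  move=> [n [y0 d]] /=; have [d0|_] := ltrP 0 d; last by exists (0, 0).
  by have [p hp] := avoid n y0 d d0; exists p.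
pose s := fix s n : G * R := if n is m.+1 then nxt (m, s m) else (0, 1).
have s0 n : 0 < (s n).2.
  elim: n => [|n IH] /=; first exact: ltr01.
  by have [] := hnxt (n, s n) IH.
have sS n := hnxt (n, s n) (s0 n).
have nested n m : unorm ((s (n + m)%N).1 - (s n).1) < (s n).2 /\ (s (n + m)%N).2 <= (s n).2.
  elim: m => [|m [IH1 IH2]]; first by rewrite addn0 subrr unorm0.
  rewrite addnS; have [h1 _ h2 _ _] := sS (n + m)%N; split; last exact: le_trans h2 IH2.
  by apply: (unorm_trans_lt _ IH1); exact: lt_le_trans h1 IH2.
have small e : 0 < e -> exists n, (s n).2 < e.
  move=> e0; have [n hn'] := ltr_add_invr (e0 : 0 < e).
  rewrite add0r in hn'; exists n.+1.
  by have [_ _ _ h _] := sS n; exact: le_lt_trans h hn'.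
have [l hl] : exists l, ucvg (fun n => (s n).1) l.
  apply: (@unorm_complete _ _ G) => e /small[N hN]; exists N => m n /subnKC <- /subnKC <-.
  have [h1 _] := nested N (m - N)%N; have [h2 _] := nested N (n - N)%N.
  apply: lt_trans hN; apply: unorm_trans_lt h1 _; by rewrite unormBC.
have ls n : unorm (l - (s n).1) < (s n).2.
  have [N hN] := hl _ (s0 n); have := hN (n + N)%N (leq_addl _ _).
  rewrite unormBC => h; apply: unorm_trans_lt h _; by have [] := nested n N.
have [x Bx] := surjB l.
have [n xn] : exists n : nat, unorm x <= n%:R.
  exists (Num.trunc (unorm x)).+1; apply/ltW; exact: truncnS_gt.
have [_ _ _ _ h] := sS n.
by have := h x xn; rewrite Bx leNgt (ls n.+1).
Qed.

(** Exact preimages are sums of approximate ones: each residual is multiplied by [t^-1] to return to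
    the ball of radius [d], so that the corrections decay like [absv t ^+ m] and their sum stays in
    the ball of radius [n]. *)
Lemma bounded_inverse : injective B ->
  exists2 B' : {linear G -> F}, continuous B' & cancel B B' /\ cancel B' B.
Proof.
move=> injB; have [n [y0 [d [d0 hd]]]] := somewhere_dense.
have [t [t0 t1]] := absv_small K.
have tn0 : t != 0 by apply/eqP => h; move: t0; rewrite h absv0 ltxx.
(* Subtracting approximations of [y0 + y] and [y0] moves the centre to 0, while the ultrametric
   inequality keeps the same [n]. *)
have dense0 y : unorm y < d -> forall e, 0 < e ->
    exists2 x, unorm x <= n%:R & unorm (y - B x) < e.
  move=> yd e e0.
  have [|x1 x1n h1] := hd (y0 + y) _ e e0; first by rewrite addrAC subrr add0r.
  have [|x2 x2n h2] := hd y0 _ e e0; first by rewrite subrr unorm0.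
  exists (x1 - x2); first exact: unormB_le.
  have -> : y - B (x1 - x2) = (B x2 - y0) - (B x1 - (y0 + y)).
    by rewrite linearB !opprB !addrA subrK [y + _]addrC.
  exact: unormB_lt.
have td : 0 < absv t * d by rewrite mulr_gt0.
have /choice[c hc] : forall y, exists x, unorm y < d ->
    unorm x <= n%:R /\ unorm (y - B x) < absv t * d.
  move=> y; have [yd|_] := boolP (unorm y < d); last by exists 0.
  by have [x h1 h2] := dense0 y yd _ td; exists x.
have [b b0 hb] := cont_linear_bounded cB.
have small_sol y : unorm y < d -> exists2 x, B x = y & unorm x <= n%:R.
  move=> yd.
  pose s := fix s m : G := if m is m'.+1 then t^-1 *: (s m' - B (c (s m'))) else y.
  have sd m : unorm (s m) < d.
    elim: m => [//|m IH] /=; have [_ h] := hc _ IH.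
    by rewrite unormZ absvV mulrC ltr_pdivrMr // mulrC.
  have cn m : unorm (c (s m)) <= n%:R by have [] := hc _ (sd m).
  have [|x hx] := @usum_ex _ _ F (fun m => t ^+ m *: c (s m)).
    move=> e e0; have [N hN] := geometric_small n%:R (ltW t0) t1 e0.
    exists N => m /hN; apply: le_lt_trans; rewrite unormZ absvX mulrC.
    by rewrite ler_wpM2r // exprn_ge0 // ltW.
  have tm m : absv t ^+ m <= 1 by apply: exprn_ile1; exact: ltW.
  exists x; last first.
    apply: usum_le (ler0n _ _) hx _ => m; rewrite unormZ absvX.
    apply: le_trans (cn m); apply: ler_piMl => //; exact: unorm_ge0.
  have h1 : usum (B \o (fun m => t ^+ m *: c (s m))) (B x).
    exact: usum_linear b0 _ hx.
  apply: (usum_unique h1) => e e0.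
  have [N hN] := geometric_small d (ltW t0) t1 e0; exists N => m Nm.
  have -> : \sum_(i < m) (B \o (fun m => t ^+ m *: c (s m))) i = y - t ^+ m *: s m.
    elim: m {Nm} => [|m IH]; first by rewrite big_ord0 expr0 scale1r subrr.
    rewrite big_ord_recr /= IH scalerA exprSr mulfK // scalerBr [B (_ *: _)]linearZ /=.
    by rewrite opprB addrA [LHS]addrAC.
  rewrite addrAC subrr add0r unormN unormZ absvX.
  apply: le_lt_trans (hN m Nm); rewrite mulrC ler_wpM2r ?exprn_ge0 ?(ltW t0) //.
  exact: ltW.
have /choice[B' hB'] := surjB.
have B'lin a x y : B' (a *: x + y) = a *: B' x + B' y.
  by apply: injB; rewrite linearP !hB'.
have KB : cancel B B' by move=> x; apply: injB; rewrite hB'.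
exists (mklinear B'lin); last by split.
(* A vector is first scaled into the annulus between [absv t * d] and [d], which explains the
   constant. *)
apply: (@bounded_continuous _ _ _ _ _ (n%:R / (absv t * d))) => y.
have [->|yn0] := eqVneq y 0; first by rewrite [mklinear _ _]linear0 !unorm0 mulr0.
have [a an0 [h1 h2]] := scale_into t0 t1 d0 yn0.
have [x Bx xn] := small_sol _ h2.
have -> : mklinear B'lin y = a^-1 *: x.
  by apply: injB; rewrite hB' linearZ /= Bx scalerA mulVf // scale1r.
rewrite unormZ absvV mulrC ler_pdivrMr ?absv_gt0 //.
apply: le_trans xn _; rewrite -mulrA [unorm y * _]mulrC -unormZ -mulrA.
by rewrite ler_peMr // ler_pdivlMl // mulr1.
Qed.

End open_mapping.

(** * Adapted norms *)

Section renorming.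
Context (R : realType) (K : ultraField R) (E : ultraBanach K).

(** [J] and [J'] are the identity between two copies of the vector space. Completeness carries over
    because small vectors are the same for both norms. *)
Lemma renorm (nu : E -> R) : is_ultranorm nu ->
  norm_defines_topology nu (fun x : E => nbhs x) ->
  exists (E' : ultraBanach K) (J : {linear E -> E'}) (J' : {linear E' -> E}),
    [/\ continuous J, continuous J', cancel J J', cancel J' J
      & forall x, unorm (J x) = nu x].
Proof.
move=> hnu top.
have nu_small e : 0 < e -> exists2 d, 0 < d & forall x, nu x < d -> unorm x < e.
  move=> e0; have [|d d0 hd] := (top 0 [set x | unorm x < e]).1.
    by apply/nbhs_unormP; exists e => // x /=; rewrite subr0.
  by exists d => // x xd; apply: hd; rewrite /= subr0.
have small_nu e : 0 < e -> exists2 d, 0 < d & forall x, unorm x < d -> nu x < e.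
  move=> e0; have /nbhs_unormP[d d0 hd] : nbhs (0 : E) [set x | nu x < e].
    by apply/top; exists e => // x /=; rewrite subr0.
  by exists d => // x xd; apply: hd; rewrite /= subr0.
have complete : norm_complete nu.
  move=> u hu; have [|l hl] := @unorm_complete _ _ E u.
    move=> e /nu_small[d d0 hd]; have [N hN] := hu d d0.
    by exists N => m n Nm Nn; apply: hd; exact: hN.
  exists l => e /small_nu[d d0 hd]; have [N hN] := hl d d0.
  by exists N => n Nn; apply: hd; exact: hN.
pose E' := @UltraBanach R K E (ub_class E) nu hnu complete.
have H1 (a : K) (x y : E) : (a *: x + y : E') = a *: (x : E') + (y : E') by [].
have H2 (a : K) (x y : E') : (a *: x + y : E) = a *: (x : E) + (y : E) by [].
exists E', (@mklinear K E E' (fun x => x) H1), (@mklinear K E' E (fun x => x) H2).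
split=> //.
- move=> x U /nbhs_unormP[e e0 he]; have [d d0 hd] := small_nu e e0.
  apply/nbhs_unormP; exists d => // y yd; apply: he; exact: hd.
- move=> x U /nbhs_unormP[e e0 he]; have [d d0 hd] := nu_small e e0.
  apply/nbhs_unormP; exists d => // y yd; apply: he; exact: hd.
Qed.

End renorming.

Section retract.
Context (R : realType) (K : ultraField R) (E : ultraBanach K).
Variable pi : {linear E -> E}.

Definition fixed_pred : {pred E} := [pred x | pi x == x].

Fact fixed_submod : GRing.submod_closed fixed_pred.
Proof.
split=> [|a u v]; rewrite !inE ?linear0 // => /eqP hu /eqP hv.
by rewrite linearP hu hv.
Qed.

HB.instance Definition _ :=
  GRing.isSubmodClosed.Build K E fixed_pred fixed_submod.

Record fixed_space := FixedSpace { fval : E ; fvalP : fval \in fixed_pred }.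

HB.instance Definition _ := [isSub for fval].
HB.instance Definition _ := [Choice of fixed_space by <:].
HB.instance Definition _ := [SubChoice_isSubLmodule of fixed_space by <:].

Hypotheses (pipi : forall x, pi (pi x) = pi x)
  (pinorm : forall x, unorm (pi x) <= unorm x).

Let fnorm (x : fixed_space) := unorm (fval x).

Let fnormP : is_ultranorm fnorm.
Proof.
split=> [x|x|a x|x y]; rewrite /fnorm.
- exact: unorm_ge0.
- split=> [/unorm_eq0 h|->]; last exact: unorm0.
  exact: (val_inj (h : val x = val (0 : fixed_space))).
- exact: unormZ.
- exact: unormD.
Qed.

Let fnorm_complete : norm_complete fnorm.
Proof.
move=> u hu; have [l hl] := @unorm_complete _ _ E (fval \o u) hu.
have lfix : l \in fixed_pred.
  rewrite inE; apply/eqP; apply: (@ucvg_unique _ _ _ (fval \o u)); last exact: hl.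
  move=> e e0; have [N hN] := hl e e0; exists N => n Nn.
  have := fvalP (u n); rewrite inE => /eqP h.
  rewrite /= -h -linearB; apply: le_lt_trans (pinorm _) _; exact: hN.
by exists (FixedSpace lfix).
Qed.

(** The fixed vectors of a projection of norm at most 1 form a closed subspace, hence a Banach space
    of their own; charts of a centre manifold need such a modelling space. *)
Lemma retract_space : exists (P : ultraBanach K) (j : {linear P -> E})
    (k : {linear E -> P}), [/\ forall y, unorm (j y) = unorm y,
      forall y, k (j y) = y & forall x, j (k x) = pi x].
Proof.
pose P := @UltraBanach R K fixed_space (GRing.Lmodule.class fixed_space)
  fnorm fnormP fnorm_complete.
have piP x : pi x \in fixed_pred by rewrite inE pipi.
have H1 (a : K) (x y : P) : fval (a *: x + y) = a *: fval x + fval y by [].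
have H2 (a : K) (x y : E) : FixedSpace (piP (a *: x + y)) =
    a *: (FixedSpace (piP x) : P) + (FixedSpace (piP y) : P).
  by apply: val_inj; rewrite /= linearP.
exists P, (@mklinear K P E fval H1), (@mklinear K E P (fun x => FixedSpace (piP x)) H2).
split=> //.
move=> y; apply: val_inj; have := fvalP y; rewrite inE => /eqP h; exact: h.
Qed.

End retract.

(** * The splitting along a centre subspace *)

Section splitting.
Context (R : realType) (K : ultraField R).

Lemma direct_sum_projections (V : lmodType K) (S1 S2 S3 : set V) :
  GRing.submod_closed (mem S1) -> GRing.submod_closed (mem S2) ->
  GRing.submod_closed (mem S3) -> direct_sum3 S1 S2 S3 ->
  exists p1 p2 p3 : {linear V -> V},
    [/\ forall v, S1 (p1 v), forall v, S2 (p2 v), forall v, S3 (p3 v)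
      & (forall v, p1 v + p2 v + p3 v = v) /\
      forall x y z, S1 x -> S2 y -> S3 z ->
        [/\ p1 (x + y + z) = x, p2 (x + y + z) = y & p3 (x + y + z) = z]].
Proof.
move=> h1 h2 h3 ds.
have cl (S : set V) (h : GRing.submod_closed (mem S)) a x y : S x -> S y -> S (a *: x + y).
  by move=> Sx Sy; have [_ h'] := h; have := h' a x y (mem_set Sx) (mem_set Sy); rewrite inE.
have /choice[q hq] := ds.
pose p1 v := (q v).1.1; pose p2 v := (q v).1.2; pose p3 v := (q v).2.
have qS v : [/\ S1 (p1 v), S2 (p2 v), S3 (p3 v) & v = p1 v + p2 v + p3 v].
  by have [] := hq v.
have qU x y z : S1 x -> S2 y -> S3 z ->
    [/\ p1 (x + y + z) = x, p2 (x + y + z) = y & p3 (x + y + z) = z].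
  move=> hx hy hz; have [_ /(_ (x, y, z))] := hq (x + y + z).
  by rewrite /p1 /p2 /p3 => ->.
have lin a u v : [/\ p1 (a *: u + v) = a *: p1 u + p1 v,
    p2 (a *: u + v) = a *: p2 u + p2 v & p3 (a *: u + v) = a *: p3 u + p3 v].
  have [u1 u2 u3 ue] := qS u; have [v1 v2 v3 ve] := qS v.
  have <- : (a *: p1 u + p1 v) + (a *: p2 u + p2 v) + (a *: p3 u + p3 v) = a *: u + v.
    by rewrite [in RHS]ue [in RHS]ve !scalerDr [RHS]addrACA; congr (_ + _); exact: addrACA.
  exact: qU (cl _ h1 a _ _ u1 v1) (cl _ h2 a _ _ u2 v2) (cl _ h3 a _ _ u3 v3).
have l1 a u v : p1 (a *: u + v) = a *: p1 u + p1 v by have [] := lin a u v.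
have l2 a u v : p2 (a *: u + v) = a *: p2 u + p2 v by have [] := lin a u v.
have l3 a u v : p3 (a *: u + v) = a *: p3 u + p3 v by have [] := lin a u v.
exists (mklinear l1), (mklinear l2), (mklinear l3); split.
- by move=> v; have [] := qS v.
- by move=> v; have [] := qS v.
- by move=> v; have [] := qS v.
by split=> // v; have [_ _ _] := qS v.
Qed.

Lemma centre_splitting (E : ultraBanach K) (alpha : {linear E -> E}) (Ec : set E) :
  centre_subspace alpha Ec ->
  exists (E' P : ultraBanach K) (J : {linear E -> E'}) (J' : {linear E' -> E})
    (beta ps pu : {linear E' -> E'}) (j : {linear P -> E'}) (k : {linear E' -> P})
    (a : R), [/\ continuous J, continuous J', cancel J J', cancel J' J
    & csplit (fun x => J (alpha (J' x))) beta ps pu j k a /\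
      forall x, Ec x <-> exists y, J x = j y].
Proof.
move=> [[cEc ic] [Es [Eu [nu [[cEs is_] [cEu iu] ds [hnu top] [hmax hiso hs]]]]]].
move=> [beta [ba ab hu]].
have [E' [J [J' [cJ cJ' JK J'K Jnu]]]] := renorm hnu top.
have [p1 [p2 [p3 [S1 S2 S3 [dec uniq]]]]] := direct_sum_projections cEs cEc cEu ds.
have [C1 [C10 C11 hC1]] : exists C, [/\ 0 <= C, C < 1 & forall x, Es x -> nu (alpha x) <= C * nu x].
  have /ereal_inf_lt[_ [C [C0 hC] <-]] := hs; rewrite lte_fin => C1.
  by exists C.
have [C2 [C20 C21 hC2]] : exists C, [/\ 0 <= C, C < 1 & forall x, Eu x -> nu (beta x) <= C * nu x].
  move: hu; rewrite inve_gt1; last first.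
    by apply: le_ereal_inf_tmp => _ [C [C0 _] <-]; rewrite lee_fin.
  by move=> /ereal_inf_lt[_ [C [C0 hC] <-]]; rewrite lte_fin => C_lt1; exists C.
have blin a x y : beta (a *: x + y) = a *: beta x + beta y.
  by rewrite -[RHS]ba linearP !ab.
have z1 : Es 0 by have [] := cEs; rewrite inE.
have z2 : Ec 0 by have [] := cEc; rewrite inE.
have z3 : Eu 0 by have [] := cEu; rewrite inE.
have e1 x : Es x -> [/\ p1 x = x, p2 x = 0 & p3 x = 0].
  by move=> hx; have := uniq x 0 0 hx z2 z3; rewrite !addr0.
have e2 x : Ec x -> [/\ p1 x = 0, p2 x = x & p3 x = 0].
  by move=> hx; have := uniq 0 x 0 z1 hx z3; rewrite addr0 add0r.
have e3 x : Eu x -> [/\ p1 x = 0, p2 x = 0 & p3 x = x].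
  by move=> hx; have := uniq 0 0 x z1 z2 hx; rewrite !add0r.
have comm x : [/\ p1 (alpha x) = alpha (p1 x), p2 (alpha x) = alpha (p2 x)
    & p3 (alpha x) = alpha (p3 x)].
  have ax : alpha x = alpha (p1 x) + alpha (p2 x) + alpha (p3 x).
    by rewrite -{1}(dec x) !linearD.
  rewrite ax.
  exact: uniq (is_ _ (S1 x)) (ic _ (S2 x)) (iu _ (S3 x)).
have nuE x : nu x = Num.max (nu (p1 x)) (Num.max (nu (p2 x)) (nu (p3 x))).
  by rewrite -{1}(dec x) hmax.
have n1 x : nu (p1 x) <= nu x by rewrite [leRHS]nuE le_max lexx.
have n2 x : nu (p2 x) <= nu x by rewrite [leRHS]nuE !le_max lexx orbT.
have n3 x : nu (p3 x) <= nu x by rewrite [leRHS]nuE !le_max lexx !orbT.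
pose cl (L : {linear E -> E}) : {linear E' -> E'} := J \o (L \o J').
(* [P] is the centre subspace with the adapted norm. The projection onto it has norm at most 1,
   since that norm is a maximum over the summands. *)
have [||P [j [k [jn kj jkE]]]] := @retract_space _ _ E' (cl p2).
- by move=> x /=; rewrite JK; have [_ ->] := e2 _ (S2 (J' x)).
- by move=> x /=; rewrite -{2}(J'K x) !Jnu.
have jkE' x : j (k x) = J (p2 (J' x)) := jkE x.
have jJ y : J (p2 (J' (j y))) = j y by rewrite -jkE' kj.
have Ecj y : Ec (J' (j y)) by rewrite -jJ JK.
have jinj : injective j by apply: can_inj kj.
have jpu x y : j x = j y -> x = y by exact: jinj.
exists E', P, J, J', (cl (mklinear blin)), (cl p1), (cl p3), j, k, (Num.max C1 C2).
split=> //; split; last first.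
  move=> x; split=> [hx|[y hy]].
    by exists (k (J x)); rewrite jkE' JK; have [_ ->] := e2 _ hx.
  by rewrite -(JK x) hy.
have knorm x : unorm (k x) <= unorm x.
  by rewrite -jn jkE' -{2}(J'K x) !Jnu.
split=> //=.
- by move=> x; rewrite -{2}(J'K x) !Jnu.
- by move=> x; rewrite -{2}(J'K x) !Jnu.
- by move=> x; rewrite jkE' -!linearD dec J'K.
- by move=> x; rewrite JK; have [->] := e1 _ (S1 (J' x)).
- by move=> x; rewrite JK; have [_ _ ->] := e3 _ (S3 (J' x)).
- by move=> x; rewrite JK; have [->] := e3 _ (S3 (J' x)); rewrite linear0.
- by move=> x; rewrite JK; have [_ _ ->] := e1 _ (S1 (J' x)); rewrite linear0.
- by move=> y; have [->] := e2 _ (Ecj y); rewrite linear0.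
- by move=> y; have [_ _ ->] := e2 _ (Ecj y); rewrite linear0.
- move=> x; apply: jinj; rewrite jkE' JK linear0.
  by have [_ ->] := e1 _ (S1 (J' x)); rewrite linear0.
- move=> x; apply: jinj; rewrite jkE' JK linear0.
  by have [_ ->] := e3 _ (S3 (J' x)); rewrite linear0.
- by move=> x; rewrite /= JK ab J'K.
- by move=> x; rewrite /= JK ba J'K.
- by move=> x; rewrite !JK; have [->] := comm (J' x).
- by move=> x; rewrite !JK; have [_ _ ->] := comm (J' x).
- by move=> x; rewrite !jkE' !JK; have [_ ->] := comm (J' x).
- by rewrite le_max C10.
- by rewrite gt_max C11.
- move=> x; rewrite !Jnu !JK; apply: le_trans (hC1 _ (S1 _)) _.
  by rewrite ler_wpM2r ?(ultranorm_ge0 hnu) // le_max lexx.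
- move=> x; rewrite !Jnu !JK; apply: le_trans (hC2 _ (S3 _)) _.
  by rewrite ler_wpM2r ?(ultranorm_ge0 hnu) // le_max lexx orbT.
- by move=> y; rewrite Jnu hiso // -Jnu J'K jn.
Qed.

End splitting.

(** * Analytic manifolds and tangent maps *)

Section chart_facts.
Context (R : realType) (K : ultraField R) (E : ultraBanach K).

Lemma chart_nbhs (M : topologicalType) (c : chart M E) x :
  is_chart c -> cdom c x -> nbhs x (cdom c).
Proof. by move=> [oc _ _ _ _] cx; exact: open_nbhs_nbhs. Qed.

Lemma cmap_cont (M : topologicalType) (c : chart M E) x :
  is_chart c -> cdom c x -> {for x, continuous (cmap c)}.
Proof. by move=> [_ _ _ h _] cx; apply: h; rewrite inE. Qed.

Lemma cinv_cont (M : topologicalType) (c : chart M E) x :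
  is_chart c -> cdom c x -> forall U, nbhs x U ->
  \forall y \near cmap c x, U (cinv c y).
Proof.
move=> hc cx U nU; have [_ _ _ _ h] := hc.
by apply: h; [rewrite inE; exists x|rewrite (cinvK hc)].
Qed.

Lemma chart_img_near (M : topologicalType) (c : chart M E) x :
  is_chart c -> cdom c x ->
  \forall y \near cmap c x, cdom c (cinv c y) /\ cmap c (cinv c y) = y.
Proof.
move=> hc cx; have [_ oi _ _ _] := hc.
have : nbhs (cmap c x) (cimg c) by apply: open_nbhs_nbhs; split=> //; exists x.
apply: filterS => _ [z cz <-].
by rewrite (cinvK hc).
Qed.

Lemma chart_near (M : topologicalType) (c : chart M E) x (U : set M) :
  is_chart c -> cdom c x -> nbhs x U ->
  \forall y \near cmap c x, [/\ U (cinv c y), cdom c (cinv c y) & cmap c (cinv c y) = y].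
Proof.
move=> hc cx nU.
by apply: filterS (filterI (cinv_cont hc cx nU) (chart_img_near hc cx)) => y [? []].
Qed.

Lemma transition_an_at (M : manifold E) (c d : chart M E) x :
  atlas c -> atlas d -> cdom c x -> cdom d x ->
  an_at (cmap d \o cinv c) (cmap c x).
Proof.
move=> ac ad cx dx; have [/analytic_onP h _] := atlas_compatible ac ad.
by have [|_] := h (cmap c x); first by exists x.
Qed.

End chart_facts.

Section analytic_maps.
Context (R : realType) (K : ultraField R).
Implicit Types E F G : ultraBanach K.

(** One pair of charts is enough, as [man_an_at] passes to all others. Continuity is part of the
    definition because it keeps nearby images inside the chart at [f x]. *)
Definition man_an E F (M : manifold E) (N : manifold F)
    (f : M -> N) (x : M) := {for x, continuous f} /\
  exists c d, [/\ atlas c, cdom c x, atlas d, cdom d (f x)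
    & an_at (cmap d \o f \o cinv c) (cmap c x)].

Lemma man_an_at E F (M : manifold E) (N : manifold F)
    (f : M -> N) x c d : man_an f x -> atlas c -> cdom c x -> atlas d ->
  cdom d (f x) -> an_at (cmap d \o f \o cinv c) (cmap c x).
Proof.
move=> [cf [c0 [d0 [ac0 c0x ad0 d0f h]]]] ac cx ad df.
have hc := atlas_chart ac; have hd := atlas_chart ad.
have hc0 := atlas_chart ac0; have hd0 := atlas_chart ad0.
have t1 := transition_an_at ac ac0 cx c0x.
have t2 := transition_an_at ad0 ad d0f df.
have h' : an_at (cmap d0 \o f \o cinv c0) ((cmap c0 \o cinv c) (cmap c x)).
  by rewrite /= (cinvK hc).
have h1 := an_at_comp t1 h'.
have t2' : an_at (cmap d \o cinv d0) ((cmap d0 \o f \o cinv c0 \o (cmap c0 \o cinv c)) (cmap c x)).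
  by rewrite /= (cinvK hc) // (cinvK hc0).
apply: eq_an_at (an_at_comp h1 t2').
have n1 := chart_nbhs hc0 c0x; have n2 : nbhs x (f @^-1` cdom d0) by apply: cf; exact: chart_nbhs.
apply: filterS (chart_near hc cx (filterI n1 n2)) => y [[/= y1 y2] _ _].
by rewrite /= (cinvK hc0) // (cinvK hd0).
Qed.

Lemma analytic_map_on_at E F (M : manifold E) (N : manifold F)
    (U : set M) (f : M -> N) x : analytic_map_on U f -> U x -> man_an f x.
Proof.
move=> [cf h] Ux; split; first by apply: cf; rewrite inE.
have [c ac cx] := atlas_cover x; have [d ad df] := atlas_cover (f x).
exists c, d; split=> //; have /analytic_onP h' := h c d ac ad.
by have [|_] := h' (cmap c x); first by exists x.
Qed.

Lemma analytic_map_onI E F (M : manifold E) (N : manifold F)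
    (U : set M) (f : M -> N) : open U -> (forall x, U x -> man_an f x) ->
  analytic_map_on U f.
Proof.
move=> oU h; split; first by move=> x; rewrite inE => /h[].
move=> c d ac ad; apply/analytic_onP => _ [x [[Ux cx] dfx] <-].
have hf := h x Ux; split; last exact: man_an_at.
have hc := atlas_chart ac; have [cf _] := hf.
have n1 : nbhs x U by exact: open_nbhs_nbhs.
have n2 : nbhs x (f @^-1` cdom d) by apply: cf; exact: chart_nbhs (atlas_chart ad) dfx.
apply: filterS (chart_near hc cx (filterI n1 n2)) => y [[y1 y2] y3 y4].
by exists (cinv c y).
Qed.

Lemma man_an_comp E F G (M : manifold E) (N : manifold F)
    (Q : manifold G) (f : M -> N) (g : N -> Q) x :
  man_an f x -> man_an g (f x) -> man_an (g \o f) x.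
Proof.
move=> hf hg; have [cf _] := hf; have [cg _] := hg; split.
  exact: continuous_comp.
have [c ac cx] := atlas_cover x; have [d ad df] := atlas_cover (f x).
have [e ae ef] := atlas_cover (g (f x)).
have hc := atlas_chart ac; have hd := atlas_chart ad.
exists c, e; split=> //.
have h1 := man_an_at hf ac cx ad df.
have h2 : an_at (cmap e \o g \o cinv d) ((cmap d \o f \o cinv c) (cmap c x)).
  by rewrite /= (cinvK hc) //; exact: man_an_at.
apply: eq_an_at (an_at_comp h1 h2).
have n2 : nbhs x (f @^-1` cdom d) by apply: cf; exact: chart_nbhs.
by apply: filterS (chart_near hc cx n2) => y [/= y2 _ _]; rewrite (cinvK hd).
Qed.

Lemma man_an_id E (M : manifold E) (x : M) : man_an id x.
Proof.
split; first by move=> ?.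
have [c ac cx] := atlas_cover x; exists c, c; split=> //.
exact: transition_an_at.
Qed.

Lemma chart_differential_comp E F G (M : manifold E) (N : manifold F)
    (Q : manifold G) (f : M -> N) (g : N -> Q) x c d e v :
  man_an f x -> man_an g (f x) -> atlas c -> cdom c x -> atlas d -> cdom d (f x) ->
  atlas e -> cdom e (g (f x)) ->
  differential (cmap e \o (g \o f) \o cinv c) (cmap c x) v =
  differential (cmap e \o g \o cinv d) (cmap d (f x))
    (differential (cmap d \o f \o cinv c) (cmap c x) v).
Proof.
move=> hf hg ac cx ad df ae ef.
have hc := atlas_chart ac; have hd := atlas_chart ad.
have h1 := man_an_at hf ac cx ad df.
have h2 := man_an_at hg ad df ae ef.
have e1 : cmap d (f x) = (cmap d \o f \o cinv c) (cmap c x) by rewrite /= (cinvK hc).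
rewrite e1 in h2 *; rewrite -differential_comp //.
apply: eq_differential; last exact: man_an_at (man_an_comp hf hg) ac cx ae ef.
have [cf _] := hf.
have n2 : nbhs x (f @^-1` cdom d) by apply: cf; exact: chart_nbhs.
by apply: filterS (chart_near hc cx n2) => y [/= y2 _ _]; rewrite (cinvK hd).
Qed.

End analytic_maps.

(** * Banach spaces as manifolds *)

Section vector_manifold.
Context (R : realType) (K : ultraField R) (E : ultraBanach K).

Definition id_chart : chart E E := Chart setT id id.

Lemma id_chartP : is_chart id_chart.
Proof.
split => //=; first exact: openT.
- rewrite (_ : cimg _ = setT); first exact: openT.
  by apply/seteqP; split=> // x _; exists x.
- by move=> x _ U.
- by move=> x _ U.
Qed.

(** The maximal atlas generated by the identity. With it, charts and parametrizations are maps of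
    manifolds and compose by [man_an_comp]. *)
Definition vatlas : set (chart E E) := [set c | is_chart c /\ compatible c id_chart].

Let vhausdorff : hausdorff_space E.
Proof.
move=> x y h; apply/eqP; rewrite -subr_eq0; apply/eqP/unorm_small => e e0.
have nb (z : E) : nbhs z [set w | unorm (w - z) < e] by apply/nbhs_unormP; exists e.
have [w [/= wx wy]] := h _ _ (nb x) (nb y).
by apply: (unorm_trans_lt _ wy); rewrite unormBC.
Qed.

Let chart_of_vatlas c : vatlas c -> is_chart c. Proof. by case. Qed.

Let vid : vatlas id_chart.
Proof.
split; first exact: id_chartP.
suff h : analytic_transition id_chart id_chart by split.
apply/analytic_onP => x _; split; last exact: an_at_id.
by apply: filterS filterT => y _; exists y.
Qed.

Let vcover x : exists2 c, vatlas c & cdom c x.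
Proof. by exists id_chart. Qed.

Let vcompatible c d : vatlas c -> vatlas d -> compatible c d.
Proof.
have aux c' d' : vatlas c' -> vatlas d' -> analytic_transition c' d'.
  move=> [hc [/analytic_onP h1 _]] [hd [_ /analytic_onP h2]].
  apply/analytic_onP => _ [x [cx dx] <-]; split.
    have [od _ _ _ _] := hd.
    have o := open_chart_image hc od; apply: open_nbhs_nbhs; split=> //.
    by exists x.
  have [|_ a1] := h1 (cmap c' x); first by exists x.
  have [|_ a2] := h2 x; first by exists x.
  have e : cinv c' (cmap c' x) = x by exact: cinvK.
  have := an_at_comp a1 (g := cmap d').
  by rewrite /= e; apply.
by move=> hc hd; split; exact: aux.
Qed.

Let vmaximal c : is_chart c -> (forall d, vatlas d -> compatible c d) -> vatlas c.
Proof. by move=> hc h; split=> //; exact: h. Qed.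

Definition vman : manifold E :=
  Manifold vhausdorff chart_of_vatlas vcover vcompatible vmaximal.

Lemma vman_atlas : @atlas _ _ _ vman id_chart.
Proof. exact: vid. Qed.

End vector_manifold.

Section chart_maps.
Context (R : realType) (K : ultraField R).
Implicit Types E F : ultraBanach K.

Lemma vman_an E F (f : E -> F) x :
  an_at f x -> man_an (f : vman E -> vman F) x.
Proof.
move=> hf; split; first exact: an_at_cont.
by exists (id_chart E), (id_chart F); split=> //; exact: vman_atlas.
Qed.

Lemma vman_an_inv E F (f : E -> F) x :
  man_an (f : vman E -> vman F) x -> an_at f x.
Proof.
move=> hf.
have h := man_an_at hf (vman_atlas E) I (vman_atlas F) I.
by apply: eq_an_at h; apply: filterE.
Qed.

Lemma cmap_man_an E (M : manifold E) (c : chart M E) x :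
  atlas c -> cdom c x -> man_an (cmap c : M -> vman E) x.
Proof.
move=> ac cx; have hc := atlas_chart ac; split; first exact: cmap_cont.
exists c, (id_chart E); split=> //; first exact: vman_atlas.
apply: eq_an_at (an_at_id _).
by apply: filterS (chart_img_near hc cx) => y [_ /= ->].
Qed.

Lemma cinv_man_an E (M : manifold E) (c : chart M E) x :
  atlas c -> cdom c x -> man_an (cinv c : vman E -> M) (cmap c x).
Proof.
move=> ac cx; have hc := atlas_chart ac; split.
  by move=> U; rewrite (cinvK hc) // => /(cinv_cont hc cx).
exists (id_chart E), c; split=> //; rewrite ?(cinvK hc) //; first exact: vman_atlas.
apply: eq_an_at (an_at_id _).
by apply: filterS (chart_img_near hc cx) => y [_ /= ->].
Qed.

(** Transitions between the new chart and an old one are composites of analytic maps of manifolds,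
    so the maximal atlas contains the new chart. *)
Lemma atlas_man_an E (M : manifold E) (U : set M)
    (g : M -> E) (h : E -> M) : open U -> open (g @` U) ->
  (forall x, U x -> [/\ h (g x) = x, man_an (g : M -> vman E) x
    & man_an (h : vman E -> M) (g x)]) ->
  atlas (Chart U g h).
Proof.
move=> oU oi gh; set e := Chart _ _ _.
have hg x : U x -> h (g x) = x by move=> /gh[].
have man_g x : U x -> man_an (g : M -> vman E) x by move=> /gh[].
have man_h x : U x -> man_an (h : vman E -> M) (g x) by move=> /gh[].
have he : is_chart e.
  split=> //=.
  - by move=> x; rewrite inE => /hg.
  - by move=> x; rewrite inE => /man_g[].
  - by move=> y; rewrite inE => -[x Ux <-]; have [] := man_h x Ux.
apply: atlas_maximal => // d ad; have hd := atlas_chart ad; have [od _ _ _ _] := hd.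
split; apply/analytic_onP.
- move=> _ [x [Ux dx] <-]; split.
    apply: open_nbhs_nbhs; split; first exact: open_chart_image.
    by exists x.
  apply: vman_an_inv; apply: (@man_an_comp _ _ _ _ _ (vman E) M (vman E)).
    exact: man_h.
  by apply: cmap_man_an; rewrite //= hg.
- move=> _ [x [dx Ux] <-]; split.
    apply: open_nbhs_nbhs; split; first exact: open_chart_image.
    by exists x.
  apply: vman_an_inv; apply: (@man_an_comp _ _ _ _ _ (vman E) M (vman E)).
    exact: cinv_man_an.
  by rewrite (cinvK hd) //; exact: man_g.
Qed.

End chart_maps.

(** * Tangent spaces in a chart *)

Section tangent_coordinates.
Context (R : realType) (K : ultraField R) (E : ultraBanach K) (M : manifold E).
Variable p : M.
Implicit Types c d e : charts_at p.

(** Chain rule for the composite of two identity maps, read in three charts. *)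
Lemma transition_cocycle c d e v :
  differential (cmap (sval e) \o cinv (sval c)) (cmap (sval c) p) v =
  differential (cmap (sval e) \o cinv (sval d)) (cmap (sval d) p)
    (differential (cmap (sval d) \o cinv (sval c)) (cmap (sval c) p) v).
Proof.
case: c d e => [c [ac cp]] [d [ad dp]] [e [ae ep]] /=.
exact: (chart_differential_comp v (man_an_id p) (man_an_id (p : M)) ac cp ad dp ae ep).
Qed.

Lemma transition_id c v :
  differential (cmap (sval c) \o cinv (sval c)) (cmap (sval c) p) v = v.
Proof.
case: c => [c [ac cp]] /=; apply: differential_id.
by apply: filterS (chart_img_near (atlas_chart ac) cp) => y [_ /=].
Qed.

Lemma tcoordE (v : tangent p) c d : tcoord v d =
  differential (cmap (sval d) \o cinv (sval c)) (cmap (sval c) p) (tcoord v c).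
Proof. by have := tcoordP v; rewrite inE => h; exact: h. Qed.

Lemma tcoord_inj c (v w : tangent p) : tcoord v c = tcoord w c -> v = w.
Proof.
move=> vw; apply: val_inj; apply/funext => d.
by rewrite /= (tcoordE v c) (tcoordE w c) vw.
Qed.

Let coord_tangent c (x : E) : (fun d => differential
  (cmap (sval d) \o cinv (sval c)) (cmap (sval c) p) x) \in @tangent_pred _ _ _ _ p.
Proof. by rewrite inE => d d'; exact: transition_cocycle. Qed.

Definition of_coord c (x : E) : tangent p := Tangent (coord_tangent c x).

Lemma of_coordK c x : tcoord (of_coord c x) c = x.
Proof. exact: transition_id. Qed.

Lemma tcoordK c v : of_coord c (tcoord v c) = v.
Proof. by apply: (@tcoord_inj c); rewrite of_coordK. Qed.

Fact tcoord_linear c (a : K) (v w : tangent p) :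
  tcoord (a *: v + w) c = a *: tcoord v c + tcoord w c.
Proof. by []. Qed.

Definition tcoordl c : {linear tangent p -> E} :=
  mklinear (f := fun v => tcoord v c) (tcoord_linear c).

Fact of_coord_linear c (a : K) (v w : E) :
  of_coord c (a *: v + w) = a *: of_coord c v + of_coord c w.
Proof. by apply: (@tcoord_inj c); rewrite tcoord_linear !of_coordK. Qed.

Definition of_coordl c : {linear E -> tangent p} := mklinear (of_coord_linear c).

Lemma of_coordlK c x : tcoord (of_coordl c x) c = x.
Proof. exact: of_coordK. Qed.

Lemma tcoordlK c v : of_coordl c (tcoord v c) = v.
Proof. exact: tcoordK. Qed.

Let tc : tangent p -> {ptws charts_at p -> E} := @tcoord _ _ _ M p.

Lemma tcoord_cont c : continuous (tcoordl c : tangent p -> E).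
Proof.
move=> v U nU.
have h : continuous tc by exact: initial_continuous.
apply: (h v [set f | U (f c)]).
exact: (@proj_continuous {classic charts_at p} (fun=> E : topologicalType) c (tc v) U nU).
Qed.

Lemma of_coord_cont c : continuous (of_coordl c : E -> tangent p).
Proof.
apply: (@continuous_comp_initial _ _ _ tc) => x.
have FF : Filter (nbhs ((tc \o of_coordl c) y @[y --> x])).
  exact: (@fmap_filter _ _ (tc \o of_coordl c) _ (nbhs_filter x)).
apply/cvg_sup => {FF} d U [_ [[C oC <-] Cx CU]].
case: c d Cx CU => [c [ac cp]] [d [ad dp]] Cx CU.
have h := differential_cont (transition_an_at ac ad cp dp).
have nC : nbhs x (differential (cmap d \o cinv c) (cmap c p) @^-1` C).
  by apply: h; exact: open_nbhs_nbhs.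
by apply: (@filterS _ _ (nbhs_filter x) _ _ _ nC) => y Cy; exact: CU.
Qed.

End tangent_coordinates.

Section tangent_maps.
Context (R : realType) (K : ultraField R).
Implicit Types E F : ultraBanach K.

Lemma is_tangent_map_ex E F (M : manifold E) (N : manifold F)
    (f : M -> N) p q : man_an f p -> f p = q ->
  exists A, is_tangent_map f (p := p) (q := q) A.
Proof.
move=> hf <-{q}.
have [c0' ac0 c0p] := atlas_cover p; have [d0' ad0 d0q] := atlas_cover (f p).
pose c0 : charts_at p := exist _ c0' (conj ac0 c0p).
pose d0 : charts_at (f p) := exist _ d0' (conj ad0 d0q).
pose D : {linear E -> F} := differential (cmap d0' \o f \o cinv c0') (cmap c0' p).
exists (of_coordl d0 \o (D \o tcoordl c0)) => v c d.
rewrite [LHS](tcoordE _ d0) [tcoord _ d0]of_coordK /= (tcoordE v c c0) /D => {D}.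
case: c d => [c [ac cp]] [d [ad dq]] /=.
have e1 := chart_differential_comp (tcoord v (exist _ c (conj ac cp)))
  (man_an_id p) hf ac cp ac0 c0p ad0 d0q.
rewrite -e1.
by have <- := chart_differential_comp (tcoord v (exist _ c (conj ac cp)))
  hf (man_an_id (f p)) ac cp ad0 d0q ad dq.
Qed.

Lemma tangent_mapE E F (M : manifold E) (N : manifold F)
    (f : M -> N) p q : man_an f p -> f p = q ->
  is_tangent_map f (tangent_map f p q).
Proof. by move=> hf fp; apply: getPex; exact: is_tangent_map_ex. Qed.

(** Phrased with neighbourhood filters so that it covers both the modelling space and the tangent
    space, which has no norm. *)
Lemma complemented_image (V W : lmodType K) (nbV : V -> set_system V)
    (nbW : W -> set_system W) (s : {linear V -> W}) (t : {linear W -> V}) (S : set V) :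
  cancel s t -> cancel t s -> (forall x, s @ nbV x --> nbW (s x)) ->
  (forall x, t @ nbW x --> nbV (t x)) ->
  complemented_for S nbV -> complemented_for (s @` S) nbW.
Proof.
move=> st ts cs ct [pi [cpi pipi piS]].
exists (s \o (pi \o t)); split=> /=.
- move=> x U /= h; have := cs (pi (t x)) U h => h1.
  have := cpi (t x) _ h1 => h2; exact: (ct x _ h2).
- by move=> x; rewrite st pipi.
- rewrite -piS; apply/seteqP; split.
    by move=> _ [x _ <-] /=; exists (pi (t x)) => //; exists (t x).
  by move=> _ [_ [y _ <-] <-]; exists (s y) => //=; rewrite st.
Qed.

Section immersions.
Variables (E F : ultraBanach K) (M : manifold E) (N : manifold F) (i : N -> M).
Variables (x : N) (c : charts_at x) (d : charts_at (i x)).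
Hypothesis hi : man_an i x.
Let L := differential (cmap (sval d) \o i \o cinv (sval c)) (cmap (sval c) x).

Lemma tangent_map_coord v : tcoord (tangent_map i x (i x) v) d = L (tcoord v c).
Proof. exact: (tangent_mapE hi erefl). Qed.

Lemma tangent_map_range : range (tangent_map i x (i x)) = of_coordl d @` range L.
Proof.
apply/seteqP; split.
  move=> _ [v _ <-]; exists (L (tcoord v c)); first by exists (tcoord v c).
  by rewrite -tangent_map_coord tcoordlK.
move=> _ [_ [y _ <-] <-]; exists (of_coordl c y) => //.
by apply: (@tcoord_inj _ _ _ _ _ d); rewrite tangent_map_coord !of_coordlK.
Qed.

Lemma tangent_map_injective : injective (tangent_map i x (i x)) <-> injective L.
Proof.
split=> h u v uv.
  rewrite -(of_coordlK c u) -(of_coordlK c v); congr tcoord; apply: h.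
  by apply: (@tcoord_inj _ _ _ _ _ d); rewrite !tangent_map_coord !of_coordlK.
apply: (@tcoord_inj _ _ _ _ _ c); apply: h.
by rewrite -!tangent_map_coord uv.
Qed.

Lemma tangent_map_complemented :
  complemented (range (tangent_map i x (i x))) <-> complemented (range L).
Proof.
have ct (y : E) : of_coordl d @ nbhs y --> nbhs (of_coordl d y).
  exact: of_coord_cont.
have cc (y : tangent (i x)) : tcoordl d @ nbhs y --> nbhs (tcoordl d y).
  exact: tcoord_cont.
have cK : cancel (tcoordl d) (of_coordl d) := @tcoordlK _ _ _ _ _ d.
have Kc : cancel (of_coordl d) (tcoordl d) := @of_coordlK _ _ _ _ _ d.
rewrite tangent_map_range; split=> h.
  have := complemented_image cK Kc cc ct h.
  suff -> : [set tcoordl d x0 | x0 in of_coordl d @` range L] = range L by [].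
  apply/seteqP; split=> [_ [_ [y Ly <-] <-]|y Ly].
    by rewrite Kc.
  by exists (of_coordl d y); [exists y|exact: of_coordlK].
exact: complemented_image Kc cK ct cc h.
Qed.

End immersions.
End tangent_maps.

(** * Restriction to open submanifolds *)

Section open_submanifolds.
Context (R : realType) (K : ultraField R) (F : ultraBanach K) (N : manifold F).
Variables (W : set N) (oW : open W).
Local Notation T := (open_submanifold oW).
Local Notation val_ := (set_val : T -> N).

Lemma sub_val_inj : injective val_.
Proof. by move=> x y; rewrite !set_valE => /val_inj. Qed.

Lemma sub_valP (x : T) : W (val_ x).
Proof. by rewrite set_valE; case: x => x /=; rewrite inE. Qed.

Lemma sub_val_ex x : W x -> exists y : T, val_ y = x.
Proof. by move=> Wx; exists (exist _ x (mem_set Wx)); rewrite set_valE. Qed.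

Lemma sub_val_cont : continuous val_.
Proof. exact: initial_continuous. Qed.

(* y0 is a junk value, taken outside W *)
Lemma sub_retract (y0 : T) : exists s : N -> T, forall x, W x -> val_ (s x) = x.
Proof.
exists (fun x => insubd y0 x) => x Wx.
by rewrite set_valE insubdK // inE.
Qed.

Lemma sub_atlasE (c : chart T F) (d : chart N F) : atlas d -> cdom d `<=` W ->
  cdom c = val_ @^-1` cdom d -> (forall x, cdom c x -> cmap c x = cmap d (val_ x)) ->
  (forall y, cimg d y -> val_ (cinv c y) = cinv d y) -> atlas c.
Proof.
move=> ad dW domE mE iE; exists d => //; split=> //.
  rewrite domE; apply/seteqP; split=> [_ [x dx <-] //|x dx].
  by have [y yx] := sub_val_ex (dW x dx); exists y; rewrite //= yx.
move=> y [x cx <-]; apply: iE; exists (val_ x); last by rewrite mE.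
by move: cx; rewrite domE.
Qed.

Lemma sub_chart_ex (x : T) (d : chart N F) : atlas d -> cdom d (val_ x) ->
  exists c : chart T F, [/\ atlas c, cdom c = val_ @^-1` cdom d,
    cmap c = cmap d \o val_
    & forall y, W (cinv d y) -> val_ (cinv c y) = cinv d y].
Proof.
move=> ad dx; have [s sK] := sub_retract x; have hd := atlas_chart ad.
have [od _ _ _ _] := hd.
exists (Chart (val_ @^-1` cdom d) (cmap d \o val_) (s \o cinv d)); split=> //; last first.
  by move=> y Wy; exact: sK.
pose dW : chart N F := Chart (cdom d `&` W) (cmap d) (cinv d).
have adW : atlas dW by apply: (atlas_sub ad) => //=; exact: openI.
apply: (sub_atlasE (d := dW)) => //=.
- by apply/seteqP; split=> z /=; [split=> //; exact: sub_valP|case].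
- by move=> _ [z [dz Wz] <-] /=; apply: sK; rewrite (cinvK hd).
Qed.

Lemma sub_man_an (E : ultraBanach K) (M : manifold E) (f : N -> M) (x : T) :
  man_an f (val_ x) -> man_an (f \o val_ : T -> M) x.
Proof.
move=> [cf [d [e [ad dx ae ef h]]]]; split.
  by apply: continuous_comp => //; exact: sub_val_cont.
have [c [ac domE mE iE]] := sub_chart_ex ad dx.
exists c, e; split=> //; first by rewrite domE.
rewrite mE; apply: eq_an_at h.
have nW : nbhs (val_ x) W by apply: open_nbhs_nbhs; split=> //; exact: sub_valP.
by apply: filterS (cinv_cont (atlas_chart ad) dx nW) => y Wy /=; rewrite iE.
Qed.

Lemma sub_lift_man_an (E : ultraBanach K) (M : manifold E) (f : M -> N) (h : M -> T) x :
  (\forall y \near x, val_ (h y) = f y) -> man_an f x -> man_an h x.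
Proof.
move=> hf [cf [c [d [ac cx ad df ha]]]]; have hfx := nbhs_singleton hf.
split.
  move=> A [_ [[B oB <-] Bfx BA]].
  have nB : nbhs x (f @^-1` B).
    by apply: cf; apply: open_nbhs_nbhs; split=> //; rewrite -hfx.
  apply: filterS (filterI nB hf) => y [/= By e]; apply: BA.
  by rewrite /= /preimage /= e.
have dhx : cdom d (val_ (h x)) by rewrite hfx.
have [e [ae domE mE iE]] := sub_chart_ex ad dhx.
exists c, e; split=> //; first by rewrite domE.
apply: eq_an_at ha.
by apply: filterS (chart_near (atlas_chart ac) cx hf) => y [/= e1 _ _]; rewrite mE /= e1.
Qed.

Section immersion.
Variables (E : ultraBanach K) (M : manifold E) (f : N -> M) (x : T).
Hypothesis hf : man_an f (val_ x).

(** In restricted charts a map and its restriction have the same local expression near the point,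
    hence the same differential. *)
Lemma sub_tangent_ex : exists (c : charts_at (val_ x)) (c' : charts_at x)
    (d : charts_at (f (val_ x))),
  (differential (cmap (sval d) \o (f \o val_) \o cinv (sval c')) (cmap (sval c') x) : F -> E) =
  differential (cmap (sval d) \o f \o cinv (sval c)) (cmap (sval c) (val_ x)).
Proof.
have [c ac cx] := atlas_cover (val_ x); have [d ad dx] := atlas_cover (f (val_ x)).
have [c' [ac' domE mE iE]] := sub_chart_ex ac cx.
have c'x : cdom c' x by rewrite domE.
exists (exist _ c (conj ac cx)), (exist _ c' (conj ac' c'x)), (exist _ d (conj ad dx)) => /=.
apply/funext => v; rewrite mE /=; apply/esym/eq_differential; last exact: man_an_at.
have nW : nbhs (val_ x) W by apply: open_nbhs_nbhs; split=> //; exact: sub_valP.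
by apply: filterS (cinv_cont (atlas_chart ac) cx nW) => y Wy /=; rewrite iE.
Qed.

Lemma sub_tangent_range :
  range (tangent_map (f \o val_ : T -> M) x (f (val_ x))) =
  range (tangent_map f (val_ x) (f (val_ x))).
Proof.
have [c [c' [d e]]] := sub_tangent_ex.
by rewrite (tangent_map_range c d hf) (tangent_map_range c' d (sub_man_an hf)) e.
Qed.

Lemma sub_tangent_injective :
  injective (tangent_map (f \o val_ : T -> M) x (f (val_ x))) <->
  injective (tangent_map f (val_ x) (f (val_ x))).
Proof.
have [c [c' [d e]]] := sub_tangent_ex.
have h1 := tangent_map_injective c d hf.
have h2 := tangent_map_injective c' d (sub_man_an hf).
by rewrite e in h2; split=> h; [apply/h1/h2|apply/h2/h1].
Qed.

End immersion.

(** Used for the graph, with [N] the whole space [P] and [W] a ball outside which [i] and [g] mean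
    nothing, and for neighbourhoods inside a given centre manifold. Hence all hypotheses are
    restricted to [W]. *)
Lemma centre_manifold_open (E : ultraBanach K) (M : manifold E) (M0 : set M)
    (f : M -> M) (q : N) (i : N -> M) (g : N -> N) (p : M) (Tc : set (tangent p)) :
  i q = p -> W q -> {in W &, injective i} ->
  (forall x, W x -> [/\ man_an i x, injective (tangent_map i x (i x)) &
    complemented (range (tangent_map i x (i x)))]) ->
  (forall x, W x -> M0 (i x)) -> range (tangent_map i q p) = Tc ->
  (forall x, W x -> [/\ man_an g x, W (g x) & i (g x) = f (i x)]) ->
  centre_manifold M0 f Tc (i \o val_ : T -> M).
Proof.
(* The type of [Tc] depends on [p], so [p] is replaced by [i q] first. *)
move=> iq; case: p / iq Tc => Tc Wq inji imm iM0 rTc hg.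
have [q' q'q] := sub_val_ex Wq.
have [s sK] := sub_retract q'.
split.
- split.
    move=> x y /= /inji xy; apply: sub_val_inj; apply: xy; rewrite inE; exact: sub_valP.
  split.
    apply: analytic_map_onI; first exact: openT.
    by move=> x _; apply: sub_man_an; have [] := imm _ (sub_valP x).
  move=> x; have [h1 h2 h3] := imm _ (sub_valP x).
  split; first exact/(sub_tangent_injective h1).
  have := sub_tangent_range h1; rewrite /= => ->; exact: h3.
- by move=> _ [x _ <-]; apply: iM0; exact: sub_valP.
- have [h1 _ _] := imm _ Wq.
  rewrite -q'q in h1 Tc rTc *; exists q' => //.
  by rewrite (sub_tangent_range h1).
- move=> _ [_ [x _ <-] <-]; have [_ gW e] := hg _ (sub_valP x).
  by exists (s (g (val_ x))) => //=; rewrite sK // e.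
- exists (s \o g \o val_) => [|x /=]; last first.
    by have [_ gW e] := hg _ (sub_valP x); rewrite sK.
  apply: analytic_map_onI; first exact: openT.
  move=> x _; have [h1 _ _] := hg _ (sub_valP x).
  apply: sub_lift_man_an (sub_man_an h1).
  by apply: filterE => y /=; rewrite sK //; have [] := hg _ (sub_valP y).
Qed.

End open_submanifolds.

(** * Centre manifolds *)

Section centred_charts.
Context (R : realType) (K : ultraField R) (E E' : ultraBanach K) (M : manifold E).
Variables (p : M) (c : charts_at p) (J : {linear E -> E'}) (J' : {linear E' -> E}).

Definition coord_at (x : M) : E' := J (cmap (sval c) x) - J (cmap (sval c) p).

Definition point_at (y : E') : M := cinv (sval c) (J' y + cmap (sval c) p).

Hypotheses (cJ : continuous J) (cJ' : continuous J') (JK : cancel J J')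
  (J'K : cancel J' J).

Lemma coord_at_p : coord_at p = 0. Proof. by rewrite /coord_at subrr. Qed.

Lemma point_at0 : point_at 0 = p.
Proof.
by rewrite /point_at linear0 add0r; case: c => d [ad dp] /=; rewrite (cinvK (atlas_chart ad)).
Qed.

Lemma coord_atK x : cdom (sval c) x -> point_at (coord_at x) = x.
Proof.
rewrite /point_at /coord_at => cx; rewrite -linearB /= JK subrK.
by move: cx; case: c => d [ad _] /=; exact: cinvK (atlas_chart ad).
Qed.

Lemma cmap_point_at y : coord_at (point_at y) = y ->
  cmap (sval c) (point_at y) = J' y + cmap (sval c) p.
Proof. by rewrite /coord_at => e; rewrite -{2}e -linearB /= JK subrK. Qed.

Lemma an_at_affine (F G : ultraBanach K) (L : {linear F -> G}) b x :
  continuous L -> an_at (fun y => L y + b) x.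
Proof. by move=> cL; apply: an_atD; [exact: an_at_linear|exact: an_at_cst]. Qed.

Lemma coord_at_man_an x : cdom (sval c) x -> man_an (coord_at : M -> vman E') x.
Proof.
move=> cx; apply: (@man_an_comp _ _ _ _ _ M (vman E) (vman E') (cmap (sval c))
  (fun y => J y - J (cmap (sval c) p))).
  by move: cx; case: c => d [ad _] /=; exact: cmap_man_an.
by apply: vman_an; exact: an_at_affine.
Qed.

Lemma point_at_man_an y : cdom (sval c) (point_at y) -> coord_at (point_at y) = y ->
  man_an (point_at : vman E' -> M) y.
Proof.
move=> cx e; apply: (@man_an_comp _ _ _ _ _ (vman E') (vman E) M
  (fun y => J' y + cmap (sval c) p) (cinv (sval c))).
  by apply: vman_an; exact: an_at_affine.
rewrite -(cmap_point_at e); move: (point_at y) cx => x.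
by case: c => d [ad _] /=; exact: cinv_man_an.
Qed.

Lemma point_at_near (U : set M) : nbhs p U -> exists2 r, 0 < r & forall y, unorm y < r ->
  [/\ U (point_at y), cdom (sval c) (point_at y) & coord_at (point_at y) = y].
Proof.
move=> nU; have h : \forall z \near cmap (sval c) p, [/\ U (cinv (sval c) z),
    cdom (sval c) (cinv (sval c) z) & cmap (sval c) (cinv (sval c) z) = z].
  by case: c => d [ad dp] /=; exact: chart_near (atlas_chart ad) dp nU.
have ca := an_at_cont (@an_at_affine _ _ J' (cmap (sval c) p) 0 cJ').
have e0 : cmap (sval c) p = J' 0 + cmap (sval c) p by rewrite linear0 add0r.
have [r r0 hr] := (nbhs_unormP _ _).1 (ca _ (eq_ind _ (fun z => nbhs z _) h _ e0)).
exists r => // y yr; have [|h1 h2 h3] := hr y; first by rewrite /= subr0.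
by split=> //; rewrite /coord_at /point_at h3 linearD /= J'K addrK.
Qed.

End centred_charts.

(* Data of f near its fixed point p: J maps the coordinates in the chart c to a
   renormed space E, with 0 corresponding to p, and cm_f is f in the resulting
   coordinates; j and k are the inclusion of and the projection to the centre space
   P, S is the inverse of the derivative of f on P, and X n y is the state at time n
   of the bounded orbit with centre component y at time 0. *)
Record centre_model (R : realType) (K : ultraField R) (E : ultraBanach K)
    (M : manifold E) (M0 : set M) (f : M -> M) (p : M) (Tc : set (tangent p)) :=
  CentreModel {
  cm_E : ultraBanach K ;
  cm_P : ultraBanach K ;
  cm_c : charts_at p ;
  cm_J : {linear E -> cm_E} ;
  cm_J' : {linear cm_E -> E} ;
  cm_j : {linear cm_P -> cm_E} ;
  cm_k : {linear cm_E -> cm_P} ;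
  cm_S : {linear cm_P -> cm_P} ;
  cm_X : int -> cm_P -> cm_E ;
  cm_r : R ;
  cm_Q : R ;
  cm_JP : [/\ continuous cm_J, continuous cm_J', cancel cm_J cm_J' & cancel cm_J' cm_J] ;
  cm_jnorm : forall y, unorm (cm_j y) = unorm y ;
  cm_jk : forall y, cm_k (cm_j y) = y ;
  cm_knorm : forall x, unorm (cm_k x) <= unorm x ;
  cm_alpha := fun y => cm_J (differential (cmap (sval cm_c) \o f \o cinv (sval cm_c))
    (cmap (sval cm_c) p) (cm_J' (cm_j y))) ;
  cm_SK : forall y, cm_S (cm_k (cm_alpha y)) = y ;
  cm_Snorm : forall y, unorm (cm_S y) = unorm y ;
  cm_r0 : 0 < cm_r ;
  cm_dom : forall x, unorm x < cm_r ->
    [/\ cdom (sval cm_c) (point_at cm_c cm_J' x),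
        coord_at cm_c cm_J (point_at cm_c cm_J' x) = x,
        M0 (point_at cm_c cm_J' x)
      & cdom (sval cm_c) (f (point_at cm_c cm_J' x))] ;
  cm_f := fun x => coord_at cm_c cm_J (f (point_at cm_c cm_J' x)) ;
  cm_Xball : forall n, asball cm_r cm_r (cm_X n) ;
  cm_Xf : forall n y, unorm y < cm_r -> cm_f (cm_X n y) = cm_X (n + 1) y ;
  cm_Xnorm : forall n y, unorm y < cm_r -> unorm (cm_X n y) <= unorm y ;
  cm_Xk : forall y, unorm y < cm_r -> cm_k (cm_X 0 y) = y ;
  cm_Xj : forall y, unorm y < cm_r -> unorm (cm_X 0 y - cm_j y) <= cm_Q * unorm y ^+ 2 ;
  cm_uniq : forall x : int -> cm_E, (forall n, unorm (x n) <= cm_r) ->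
    (forall n, cm_f (x n) = x (n + 1)) -> unorm (cm_k (x 0)) < cm_r ->
    forall n, x n = cm_X n (cm_k (x 0)) ;
  cm_Tc : forall v, Tc v <-> exists y, cm_J (tcoord v cm_c) = cm_j y
}.

(** * The map in coordinates adapted to the centre splitting *)

Section model_existence.
Context (R : realType) (K : ultraField R) (E : ultraBanach K) (M : manifold E).

(** The splitting, the norm and the inverse are transported along the coordinate isomorphism, since
    [centre_splitting] works in a Banach space. *)
Lemma centre_subspace_coord (p : M) (A : {linear tangent p -> tangent p})
    (c : charts_at p) (D : {linear E -> E}) (Tc : set (tangent p)) :
  (forall v, tcoord (A v) c = D (tcoord v c)) ->
  centre_subspace A Tc -> centre_subspace D [set e | Tc (of_coordl c e)].
Proof.
move=> AD [[cTc iTc] [Es [Eu [nu [[cEs is_] [cEu iu] ds [hnu top] [hmax hiso hs hu]]]]]].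
have Ks := @of_coordlK _ _ _ _ _ c; have sK := @tcoordlK _ _ _ _ _ c.
have cs := @of_coord_cont _ _ _ _ _ c.
move: (of_coordl c) Ks sK cs => s Ks sK cs.
have sD e : s (D e) = A (s e).
  by apply: (@tcoord_inj _ _ _ _ _ c); rewrite AD !Ks.
have cl (S : set (tangent p)) : GRing.submod_closed (mem S) ->
    GRing.submod_closed (mem [set e | S (s e)]).
  move=> [h0 h1]; split; first by rewrite inE /= linear0; move: h0; rewrite inE.
  move=> a u v; rewrite !inE /= => hu' hv; rewrite linearP.
  by have := h1 a (s u) (s v); rewrite !inE; apply.
split; first by split; [exact: cl|move=> x /=; rewrite sD; exact: iTc].
exists [set e | Es (s e)], [set e | Eu (s e)], (fun e => nu (s e)); split.
- by split; [exact: cl|move=> x /=; rewrite sD; exact: is_].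
- by split; [exact: cl|move=> x /=; rewrite sD; exact: iu].
- move=> e; have [[[x y] z] [/= [hx hy hz hv] uniq]] := ds (s e).
  exists (tcoord x c, tcoord y c, tcoord z c); split=> /=.
    split; rewrite ?sK //; rewrite -[LHS]Ks hv.
    by rewrite -[LHS]/(tcoordl c _) !linearD.
  move=> [[x' y'] z'] /= [hx' hy' hz' hv'].
  have := uniq (s x', s y', s z'); rewrite /= => u.
  have [] : (x, y, z) = (s x', s y', s z') by apply: u; split=> //; rewrite hv' !linearD.
  by move=> -> -> ->; rewrite !Ks.
- split.
    split=> [x|x|a x|x y].
    + exact: (ultranorm_ge0 hnu).
    + split=> [/(ultranorm_eq0 hnu) h|->]; last by rewrite linear0; apply/(ultranorm_eq0 hnu).
      by rewrite -(Ks x) h -[LHS]/(tcoordl c 0) linear0.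
    + by rewrite linearZ; exact: (ultranormZ hnu).
    + by rewrite linearD; exact: (ultranorm_ultra hnu).
  move=> x U; split.
    move=> nU; have [r r0 hr] := (top (s x) [set v | U (tcoord v c)]).1
      (@tcoord_cont _ _ _ _ _ c (s x) U (eq_ind_r (fun z => nbhs z U) nU (Ks x))).
    exists r => // y yr; have := hr (s y); rewrite /= Ks; apply.
    by rewrite -linearB.
  move=> [r r0 hr].
  have n1 : nbhs (s x) [set v | nu (v - s x) < r] by apply/top; exists r.
  apply: (@filterS _ _ (nbhs_filter x) _ _ _ (cs x _ n1)) => y /= h.
  by apply: hr; rewrite /= linearB.
- split=> //=.
  + by move=> x y z hx hy hz; rewrite !linearD; exact: hmax.
  + by move=> x hx; rewrite sD; exact: hiso.
  + rewrite (_ : opnorm_on _ _ _ = opnorm_on nu Es A) //.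
    congr ereal_inf; apply/seteqP; split=> _ [C [C0 hC] <-]; exists C => //; split=> //.
      by move=> v hv; have := hC (tcoord v c); rewrite /= sD sK; apply.
    by move=> e he; rewrite sD; exact: hC.
  + have [beta [ab ba hb]] := hu; exists (fun e => tcoord (beta (s e)) c); split.
    * by move=> e; rewrite sD ab Ks.
    * by move=> e; rewrite -AD ba Ks.
    * rewrite (_ : opnorm_on _ _ _ = opnorm_on nu Eu beta) //.
      congr ereal_inf; apply/seteqP; split=> _ [C [C0 hC] <-]; exists C => //; split=> //.
        by move=> v hv; have := hC (tcoord v c); rewrite /= !sK; apply.
      by move=> e he; rewrite sK; exact: hC.
Qed.

(** Allows different manifolds at source and target, as it is applied to [f] at its fixed point and
    to the inclusion of a centre manifold. *)
Lemma coord_rep (F E1 F1 : ultraBanach K) (N : manifold F) (i : N -> M) x p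
    (d : charts_at x) (c : charts_at p) (J : {linear E -> E1}) (J' : {linear F1 -> F}) :
  continuous J -> continuous J' -> man_an i x -> i x = p ->
  an_at (fun y => coord_at c J (i (point_at d J' y))) 0 /\
  forall v, differential (fun y => coord_at c J (i (point_at d J' y))) 0 v =
    J (differential (cmap (sval c) \o i \o cinv (sval d)) (cmap (sval d) x) (J' v)).
Proof.
move=> cJ cJ' hi ix; have [ac cp] := svalP c; have [ad dx] := svalP d.
set i1 := cmap (sval c) \o i \o cinv (sval d).
have a1 := @an_at_affine _ _ _ _ J' (cmap (sval d) x) 0 cJ'.
have e1 : J' 0 + cmap (sval d) x = cmap (sval d) x by rewrite linear0 add0r.
have a2 : an_at i1 ((fun y => J' y + cmap (sval d) x) 0).
  by rewrite e1; apply: man_an_at; rewrite ?ix.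
have a3 y := @an_at_affine _ _ _ _ J (- J (cmap (sval c) p)) y cJ.
have a12 := an_at_comp a1 a2.
split; first exact: (an_at_comp a12 (a3 _)).
move=> v; have -> : (fun y => coord_at c J (i (point_at d J' y))) =
  (fun y => J y - J (cmap (sval c) p)) \o (i1 \o (fun y => J' y + cmap (sval d) x)) by [].
rewrite differential_comp // differential_translate // differential_comp //.
by rewrite differential_translate // e1.
Qed.

Lemma centre_model_ex (M0 : set M) (f : M -> M) (p : M) (Tc : set (tangent p)) :
  open M0 -> analytic_map_on M0 f -> M0 p -> f p = p ->
  centre_subspace (tangent_map f p p) Tc ->
  exists m : centre_model M0 f Tc, True.
Proof.
move=> oM0 haf M0p fp hTc.
have hf := analytic_map_on_at haf M0p.
have [c0 ac0 c0p] := atlas_cover p.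
pose c : charts_at p := exist _ c0 (conj ac0 c0p).
pose D := differential (cmap (sval c) \o f \o cinv (sval c)) (cmap (sval c) p).
have AD v : tcoord (tangent_map f p p v) c = D (tcoord v c).
  exact: (tangent_mapE hf fp).
have [E' [P [J [J' [beta [ps [pu [j [k [a [cJ cJ' JK J'K [cs HEc]]]]]]]]]]]] :=
  centre_splitting (centre_subspace_coord AD hTc).
pose f0 x := coord_at c J (f (point_at c J' x)).
have [f0an f0D] := coord_rep c c cJ cJ' hf fp.
rewrite -/f0 in f0an f0D.
have f00 : f0 0 = 0 by rewrite /f0 point_at0 fp coord_at_p.
have alphaE : (differential f0 0 : E' -> E') = fun x => J (D (J' x)).
  by apply/funext => x; exact: f0D.
have [s [D0 [b [s0 D00 hb b0 b1]]]] := remainder_at0 f0an f00.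
have [cf _] := hf.
have nU : nbhs p (M0 `&` (f @^-1` cdom c0)).
  apply: filterI; first exact: open_nbhs_nbhs.
  by apply: cf; rewrite fp; exact: chart_nbhs (atlas_chart ac0) c0p.
(* On the ball of radius [rm] the coordinates describe points of [M0] whose images stay in the
   chart; [r] is then taken at most [rm]. *)
have [rm rm0 hrm] := point_at_near c cJ' J'K nU.
have [r [r0 rs rrm rD]] := contraction_radius s0 D00 rm0.
have gE x : f0 x = differential f0 0 x + (f0 x - differential f0 0 x).
  by rewrite addrC subrK.
have cs' : csplit (differential f0 0) beta ps pu j k a by rewrite alphaE.
have [X [Xb Xf Xn Xk Xu]] :=
  centre_orbits_exist f00 cs' gE D00 hb b0 b1 r0 rs rD.
have aj y : j (k (J (D (J' (j y))))) = J (D (J' (j y))).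
  by rewrite (cs_ac cs) (cs_jk cs).
have SK y : k (beta (j (k (J (D (J' (j y))))))) = y.
  by rewrite aj (cs_ba cs) (cs_jk cs).
have Snorm y : unorm (k (beta (j y))) = unorm y.
  by rewrite -(cs_cnorm cs) -(cs_ac cs) (cs_ab cs) (cs_jk cs) (cs_jnorm cs).
have dom x : unorm x < r -> [/\ cdom (sval c) (point_at c J' x),
    coord_at c J (point_at c J' x) = x, M0 (point_at c J' x)
    & cdom (sval c) (f (point_at c J' x))].
  by move=> xr; have [[h1 h2] h3 h4] := hrm x (lt_le_trans xr rrm).
exists (@CentreModel _ _ _ _ _ _ _ Tc E' P c J J' j k (k \o (beta \o j)) X r (D0 / s ^+ 2)
  (And4 cJ cJ' JK J'K) (cs_jnorm cs) (cs_jk cs) (cs_knorm cs) SK Snorm r0 dom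
  Xb Xf Xn (fun y yr => (Xk y yr).1) (fun y yr => (Xk y yr).2) Xu
  (fun v => eq_ind _ (fun w => Tc w <-> _) (HEc (tcoord v c)) _ (tcoordlK c v))).
exact: I.
Qed.

End model_existence.

Lemma an_atB (R : realType) (K : ultraField R) (E F : ultraBanach K) (f g : E -> F) x :
  an_at f x -> an_at g x -> an_at (fun y => f y - g y) x.
Proof.
move=> hf hg; apply: an_atD => //.
apply: (an_at_comp hg); apply: (an_at_linear (L := -%R)).
by apply: (bounded_continuous (B := 1)) => u; rewrite mul1r unormN.
Qed.

(** * The graph of the bounded orbits as a centre manifold *)

Section model.
Context (R : realType) (K : ultraField R) (E : ultraBanach K) (M : manifold E).
Variables (M0 : set M) (f : M -> M) (p : M) (Tc : set (tangent p)).
Variable m : centre_model M0 f Tc.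
Local Notation P := (cm_P m).
Local Notation c := (cm_c m).
Local Notation J := (cm_J m).
Local Notation J' := (cm_J' m).
Local Notation j := (cm_j m).
Local Notation k := (cm_k m).
Local Notation X := (@cm_X _ _ _ _ _ _ _ _ m).
Local Notation r := (cm_r m).
Local Notation chi := (coord_at c J).
Local Notation pt := (point_at c J').

Definition graph_map (y : P) : M := pt (X 0 y).
Definition graph_coord (x : M) : P := k (chi x).
Definition graph_dyn n (y : P) : P := k (X n y).

Let r0 : 0 < r := cm_r0 m.
Let cJ : continuous J. Proof. by have [] := cm_JP m. Qed.
Let cJ' : continuous J'. Proof. by have [] := cm_JP m. Qed.
Let JK : cancel J J'. Proof. by have [] := cm_JP m. Qed.
Let J'K : cancel J' J. Proof. by have [] := cm_JP m. Qed.

Lemma cmk_cont : continuous k.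
Proof. by apply: (bounded_continuous (B := 1)) => x; rewrite mul1r cm_knorm. Qed.

Lemma cmj_cont : continuous j.
Proof. by apply: (bounded_continuous (B := 1)) => x; rewrite mul1r cm_jnorm. Qed.

Let Xr n y : unorm y < r -> unorm (X n y) < r.
Proof. by move=> yr; apply: (le_lt_trans (cm_Xnorm n yr)). Qed.

Lemma graph_dom y : unorm y < r ->
  [/\ cdom (sval c) (graph_map y), chi (graph_map y) = X 0 y & M0 (graph_map y)].
Proof. by move=> /(Xr 0)/cm_dom[]. Qed.

Lemma graph_mapK y : unorm y < r -> graph_coord (graph_map y) = y.
Proof. by move=> yr; rewrite /graph_coord; have [_ -> _] := graph_dom yr; exact: cm_Xk. Qed.

Lemma graph_dyn_norm n y : unorm y < r -> unorm (graph_dyn n y) <= unorm y.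
Proof. by move=> yr; apply: (le_trans (cm_knorm (X n y))); exact: cm_Xnorm. Qed.

Lemma graph_dyn_lt n y t : t <= r -> unorm y < t -> unorm (graph_dyn n y) < t.
Proof.
by move=> tr yt; apply: (le_lt_trans _ yt); apply/graph_dyn_norm/(lt_le_trans yt).
Qed.

(** A bounded orbit shifted in time is a bounded orbit, so by uniqueness it is the one of its new
    centre component. Hence all its points lie on the graph, which makes the graph invariant. *)
Lemma orbit_on_graph n y : unorm y < r -> X n y = X 0 (graph_dyn n y).
Proof.
move=> yr; rewrite -{1}[n]addr0.
have := @cm_uniq _ _ _ _ _ _ _ _ m (fun i => X (n + i) y).
rewrite [in k _]addr0; apply.
- by move=> i; apply/ltW/Xr.
- by move=> i; rewrite cm_Xf // addrA.
- exact: graph_dyn_lt.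
Qed.

Lemma map_graph y : unorm y < r -> f (graph_map y) = graph_map (graph_dyn 1 y).
Proof.
move=> yr; have [h1 h2 h3 h4] := cm_dom (Xr 0 yr).
rewrite /graph_map -orbit_on_graph // -(coord_atK JK h4); congr pt.
by have := cm_Xf 0 yr; rewrite add0r.
Qed.

Lemma map_coord_graph y : unorm y < r -> @cm_f _ _ _ _ _ _ _ _ m (X 0 y) = X 0 (graph_dyn 1 y).
Proof. by move=> yr; rewrite cm_Xf // add0r orbit_on_graph. Qed.

Lemma graph_dynK y : unorm y < r -> graph_dyn 1 (graph_dyn (-1) y) = y.
Proof.
move=> yr; have yr' := graph_dyn_lt (-1) (lexx r) yr.
rewrite -[RHS](cm_Xk yr) -[LHS](cm_Xk (graph_dyn_lt 1 (lexx r) yr')).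
congr (k _); rewrite -map_coord_graph // -orbit_on_graph // cm_Xf //.
Qed.

(** The orbit of [y] shifted by one step is that of [graph_dyn 1 y]; at time -1 it is back at the
    point over [y]. *)
Lemma graph_dynVK y : unorm y < r -> graph_dyn (-1) (graph_dyn 1 y) = y.
Proof.
move=> yr; have yr' := graph_dyn_lt 1 (lexx r) yr.
have := @cm_uniq _ _ _ _ _ _ _ _ m (fun i => X (i + 1) y).
rewrite add0r => h; rewrite {1}/graph_dyn -[graph_dyn 1 y]/(k (X 1 y)) -h ?addNr ?cm_Xk //.
- by move=> i; apply/ltW/Xr.
- by move=> i; rewrite cm_Xf.
Qed.

Lemma X_an_at n y : unorm y < r -> an_at (X n) y.
Proof. by move=> yr; apply: asball_an_at yr _; exact: cm_Xball. Qed.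

Lemma graph_dyn_man_an n y : unorm y < r ->
  man_an (graph_dyn n : vman P -> vman P) y.
Proof.
move=> yr; apply: vman_an; apply: (an_at_comp (X_an_at n yr)).
exact: an_at_linear cmk_cont.
Qed.

Lemma graph_map_man_an y : unorm y < r -> man_an (graph_map : vman P -> M) y.
Proof.
move=> yr; have [h1 h2 _] := graph_dom yr.
apply: (@man_an_comp _ _ _ _ _ (vman P) (vman (cm_E m)) M (X 0) pt).
  exact/vman_an/X_an_at.
exact: point_at_man_an.
Qed.

Lemma graph_coord_man_an x : cdom (sval c) x -> man_an (graph_coord : M -> vman P) x.
Proof.
move=> cx; apply: (@man_an_comp _ _ _ _ _ M (vman (cm_E m)) (vman P) chi k).
  exact: coord_at_man_an.
by apply: vman_an; exact: an_at_linear cmk_cont.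
Qed.

Lemma graph_map0 : graph_map 0 = p.
Proof.
have z : unorm (0 : P) < r by rewrite unorm0.
rewrite /graph_map (_ : X 0 0 = 0) ?point_at0 //.
by apply/unorm_eq0/eqP; rewrite eq_le unorm_ge0 andbT -(unorm0 P) cm_Xnorm.
Qed.

Lemma ball_near (F : ultraBanach K) (y : F) t : unorm y < t -> \forall z \near y, unorm z < t.
Proof.
move=> yt; have t0 : 0 < t by apply: le_lt_trans yt; exact: unorm_ge0.
apply/nbhs_unormP; exists t => // z /= zt.
by rewrite -(subrK y z); exact: unormD_lt.
Qed.

Lemma ball_open (F : ultraBanach K) (t : R) : open [set y : F | unorm y < t].
Proof. by rewrite openE => y /= /ball_near. Qed.

Let kJ : {linear E -> P} := k \o J.

Let kJcont : continuous kJ.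
Proof. by move=> x; apply: (@continuous_comp _ _ _ J k); [exact: cJ|exact: cmk_cont]. Qed.

Lemma graph_rep y : unorm y < r ->
  \forall z \near y, cmap (sval c) (graph_map z) = J' (X 0 z) + cmap (sval c) p.
Proof.
move=> /ball_near; apply: filterS => z zr.
by apply: cmap_point_at => //; have [_ -> _] := graph_dom zr.
Qed.

Lemma graph_rep_an_at y : unorm y < r -> an_at (cmap (sval c) \o graph_map) y.
Proof.
move=> yr; have := an_at_comp (X_an_at 0 yr) (an_at_affine (cmap (sval c) p) (X 0 y) cJ').
by apply: eq_an_at; apply: filterS (graph_rep yr) => z /= ->.
Qed.

Lemma graph_rep_retract y v : unorm y < r ->
  kJ (differential (cmap (sval c) \o graph_map) y v) = v.
Proof.
move=> yr; have h1 := graph_rep_an_at yr.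
rewrite -(differential_translate (- k (J (cmap (sval c) p))) (cmap (sval c) (graph_map y)) kJcont).
rewrite -[X in differential _ X]/((cmap (sval c) \o graph_map) y).
rewrite -differential_comp //; last exact: an_at_affine.
apply: differential_id; apply: filterS (ball_near yr) => z zr /=.
have := graph_mapK zr; rewrite /graph_coord /coord_at linearB /=; exact.
Qed.

Let vc (y : P) : @charts_at _ _ _ (vman P) y := exist _ (id_chart P) (conj (vman_atlas P) I).

(** The centre coordinate inverts the parametrization, so [kJ] is a continuous left inverse of the
    derivative [L]. This gives injectivity, and [L \o kJ] projects onto the range of [L]. *)
Lemma graph_immersion y : unorm y < r ->
  injective (tangent_map (graph_map : vman P -> M) y (graph_map y)) /\
  complemented (range (tangent_map (graph_map : vman P -> M) y (graph_map y))).
Proof.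
move=> yr; have [h1 _ _] := graph_dom yr; have [ac _] := svalP c.
pose d : charts_at (graph_map y) := exist _ (sval c) (conj ac h1).
have ha := graph_map_man_an yr.
set L := differential (cmap (sval c) \o graph_map) y.
have KL v : kJ (L v) = v := graph_rep_retract v yr.
split.
  apply/(tangent_map_injective (vc y) d ha) => u v uv.
  by rewrite -(KL u) -(KL v); congr (kJ _); exact: uv.
apply/(tangent_map_complemented (vc y) d ha).
exists (L \o kJ); split.
- have cL : continuous L by apply: differential_cont; exact: graph_rep_an_at.
  by move=> x; apply: (@continuous_comp _ _ _ kJ L); [exact: kJcont|exact: cL].
- by move=> x; rewrite -[LHS]/(L (kJ (L (kJ x)))) KL.
- apply/seteqP; split=> [_ [x _ <-]|_ [x _ <-]]; first by exists (kJ x).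
  by exists (L x) => //; rewrite -[LHS]/(L (kJ (L x))) KL.
Qed.

(** The graph deviates from the centre space only to second order, by [cm_Xj]. *)
Lemma graph_differential0 v : differential (cmap (sval c) \o graph_map) 0 v = J' (j v).
Proof.
have z : unorm (0 : P) < r by rewrite unorm0.
have X00 : X 0 0 = 0.
  by apply/unorm_eq0/eqP; rewrite eq_le unorm_ge0 andbT -(unorm0 P) cm_Xnorm.
have h1 := an_at_comp (X_an_at 0 z) (an_at_affine (cmap (sval c) p) (X 0 0) cJ').
rewrite -(@eq_differential _ _ _ _ _ _ _ _ (_ : \forall z \near 0, _ = _) h1); last first.
  by apply: filterS (graph_rep z) => w /= ->.
rewrite differential_comp ?differential_translate //; first last.
- exact: an_at_affine.
- exact: X_an_at.
congr (J' _); apply: differentialE.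
apply: (quadratic_differential cmj_cont r0 (Q := cm_Q m)) => y yr.
by rewrite add0r X00 subr0; exact: cm_Xj.
Qed.

Lemma graph_tangent : range (tangent_map (graph_map : vman P -> M) 0 p) = Tc.
Proof.
have z : unorm (0 : P) < r by rewrite unorm0.
have hT v : tcoord (tangent_map (graph_map : vman P -> M) 0 p v) c = J' (j (tcoord v (vc 0))).
  rewrite -graph_differential0.
  exact: (tangent_mapE (graph_map_man_an z) graph_map0).
apply/seteqP; split=> [_ [v _ <-]|v /(cm_Tc m)[y hy]].
  by apply/(cm_Tc m); exists (tcoord v (vc 0)); rewrite hT J'K.
exists (of_coordl (vc 0) y) => //; apply: (@tcoord_inj _ _ _ _ _ c).
by rewrite /= hT of_coordlK -hy JK.
Qed.

Lemma graph_centre_manifold :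
  centre_manifold M0 f Tc (graph_map \o set_val :
    open_submanifold (N := vman P) (@ball_open P r) -> M).
Proof.
apply: (@centre_manifold_open _ _ _ (vman P) _ _ _ _ _ _ 0 graph_map (graph_dyn 1)).
- exact: graph_map0.
- by rewrite /= unorm0.
- by move=> x y; rewrite !inE /= => xr yr xy; rewrite -(graph_mapK xr) xy graph_mapK.
- by move=> x xr; have [] := graph_immersion xr; split=> //; exact: graph_map_man_an.
- by move=> x /graph_dom[].
- exact: graph_tangent.
- move=> x xr; split; [exact: graph_dyn_man_an|exact: graph_dyn_lt|].
  by rewrite map_graph.
Qed.

Hypotheses (hf : man_an f p) (fp : f p = p).

Local Notation S := (@cm_S _ _ _ _ _ _ _ _ m).
Local Notation fc := (@cm_f _ _ _ _ _ _ _ _ m).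

(* On a submanifold tangent to the centre space, f is a local isometry up to the
   isometric linear part S^-1. *)
Lemma centre_dynamics_isometry (e : P -> cm_E m) : an_at e 0 -> e 0 = 0 ->
  (forall v, differential e 0 v = j v) ->
  exists t (H : P -> P), 0 < t /\ forall y, unorm y < t ->
    [/\ unorm (k (fc (e y))) = unorm y, unorm (H y) = unorm y & k (fc (e (H y))) = y].
Proof.
move=> e_an e0 eD; have [f_an fD] := coord_rep c c cJ cJ' hf fp.
have fc_an : an_at fc (e 0) by rewrite e0.
have fe_an := an_at_comp e_an fc_an.
have kfe_an : an_at (k \o (fc \o e)) 0.
  by apply: (an_at_comp fe_an); apply: an_at_linear; exact: cmk_cont.
have cS : continuous S.
  by apply: (bounded_continuous (B := 1)) => x; rewrite mul1r cm_Snorm.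
(* [S] turns the derivative into the identity, as [local_inverse] requires; being an injective
   isometry, it can be removed afterwards. *)
have SG_an : an_at (S \o (k \o (fc \o e))) 0 by apply: an_at_comp; last exact: an_at_linear.
have SG0 : (S \o (k \o (fc \o e))) 0 = 0.
  by rewrite /= e0 /cm_f point_at0 fp coord_at_p !linear0.
have SGD : differential (S \o (k \o (fc \o e))) 0 =1 id.
  move=> v; rewrite differential_comp //; last exact: an_at_linear.
  rewrite differential_linear // differential_comp //; last first.
    by apply: an_at_linear; exact: cmk_cont.
  rewrite differential_linear; last exact: cmk_cont.
  rewrite differential_comp // e0 eD; have := fD (j v); rewrite -/(fc) => ->.
  exact: cm_SK.
have [t [H [t0 _ _ HK]]] := local_inverse SG_an SG0 SGD.
have Sinj : injective S.
  move=> x y xy; apply/eqP; rewrite -subr_eq0; apply/eqP/unorm_eq0.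
  by rewrite -cm_Snorm linearB /= xy subrr unorm0.
exists t, (H \o S); split=> // y yt.
have [h1 _ _ _] := HK y yt; have [|_ h2 h3 _] := HK (S y); first by rewrite cm_Snorm.
split; first by rewrite -h1 /= cm_Snorm.
  by rewrite /= h2 cm_Snorm.
exact: Sinj.
Qed.

(* The orbits of an isometric dynamics stay in the ball, so that cm_uniq applies. *)
Lemma isometric_orbits_on_graph t (e : P -> cm_E m) (G H : P -> P) : t <= r ->
  (forall y, unorm y < t -> [/\ unorm (e y) <= r, k (e y) = y & fc (e y) = e (G y)]) ->
  (forall y, unorm y < t ->
    [/\ unorm (G y) = unorm y, unorm (H y) = unorm y & G (H y) = y]) ->
  forall y, unorm y < t -> e y = X 0 y.
Proof.
move=> tr he hG y yt.
(* The two-sided orbit in centre coordinates; its past uses [H], a norm-preserving right inverse of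
   [G]. *)
pose ys n := match n with Posz n => iter n G y | Negz n => iter n.+1 H y end.
have yst n : unorm (ys n) < t.
  suff -> : unorm (ys n) = unorm y by [].
  case: n => n; rewrite /ys.
    elim: n => [//|n IH] /=; have [|-> _ _] := hG (iter n G y); rewrite ?IH //.
  elim: n.+1 => [//|m' IH] /=; have [|_ -> _] := hG (iter m' H y); rewrite ?IH //.
have ysS n : G (ys n) = ys (n + 1).
  case: n => [n|[|n]].
  - by rewrite -PoszD addn1.
  - by rewrite NegzE addNr /=; have [] := hG y yt.
  - have -> : Negz n.+1 + 1 = Negz n by rewrite !NegzE -[n.+2]addn1 PoszD opprD subrK.
    by have [_ _ ->] := hG (ys (Negz n)) (yst _).
have [_ ky _] := he y yt.
rewrite -[in RHS]ky; apply: (cm_uniq (x := e \o ys) _ _ _ 0) => [n|n|].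
- by have [] := he _ (yst n).
- by have [_ _ ->] := he _ (yst n); rewrite ysS.
- by rewrite /= ky; exact: lt_le_trans tr.
Qed.

(** * An arbitrary centre manifold near the fixed point *)

Section parametrization.
Variables (F : ultraBanach K) (N : manifold F) (i : N -> M) (q : N).
Hypothesis cm : centre_manifold M0 f Tc i.
Hypothesis iq : i q = p.

Let inji : injective i. Proof. by have [[]] := cm. Qed.

Let hi x : man_an i x.
Proof. by have [[_ [h _]] _ _ _ _] := cm; exact: analytic_map_on_at h _. Qed.

Let idl : {linear F -> F} := idfun.
Let cidl : continuous idl. Proof. by move=> ?. Qed.

Variable d : charts_at q.
Let L : {linear F -> E} := differential (cmap (sval c) \o i \o cinv (sval d)) (cmap (sval d) q).
Let de := coord_at d idl.
Let pe := point_at d idl.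
Let ei y := chi (i (pe y)).
Let h y := k (ei y).

Let tcoord_i w : tcoord (tangent_map i q p w) c = L (tcoord w d).
Proof. exact: (tangent_mapE (hi q) iq). Qed.

Let range_i : range (tangent_map i q p) = Tc.
Proof. by have [_ _ [q' iq' <-] _ _] := cm; have -> : q' = q by apply: inji; rewrite iq'. Qed.

Let TcP v : Tc v <-> exists w, tangent_map i q p w = v.
Proof.
have e : range (tangent_map i q p) v = Tc v by rewrite range_i.
by split=> [|[w wv]]; [rewrite -e => -[w _ wv]; exists w|rewrite -e; exists w].
Qed.

Let Lc v : exists y, J (L v) = j y.
Proof.
have : Tc (of_coordl c (L v)).
  apply/TcP; exists (of_coordl d v).
  by apply: (@tcoord_inj _ _ _ _ _ c); rewrite tcoord_i !of_coordlK.
by move=> /(cm_Tc m); rewrite of_coordlK.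
Qed.

Let Linj : injective L.
Proof.
have [[_ [_ /(_ q)[h1 _]]] _ _ _ _] := cm; have [ac cp] := svalP c.
have cq : cdom (sval c) (i q) by rewrite iq.
pose c' : charts_at (i q) := exist _ (sval c) (conj ac cq).
exact: (tangent_map_injective d c' (hi q)).1 h1.
Qed.

Let ei_an : an_at ei 0. Proof. exact: (coord_rep d c cJ cidl (hi q) iq).1. Qed.

Let eiD v : differential ei 0 v = J (L v).
Proof. exact: (coord_rep d c cJ cidl (hi q) iq).2. Qed.

Let h_an : an_at h 0.
Proof. by apply: (an_at_comp ei_an); apply: an_at_linear; exact: cmk_cont. Qed.

Let B : {linear F -> P} := differential h 0.

Let jB v : j (B v) = J (L v).
Proof.
rewrite /B (differential_comp v ei_an) ?differential_linear; last 2 first.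
- exact: cmk_cont.
- by apply: an_at_linear; exact: cmk_cont.
by rewrite eiD; have [y ->] := Lc v; rewrite cm_jk.
Qed.

(** The tangent map is injective with range [Tc], so the derivative [B] of the centre coordinate on
    [N] is a continuous bijection onto [P]; open mapping gives the continuity of its inverse. *)
Let B_inverse : exists2 B' : {linear P -> F}, continuous B' & cancel B B' /\ cancel B' B.
Proof.
apply: bounded_inverse.
- exact: differential_cont.
- move=> y; have : Tc (of_coordl c (J' (j y))).
    by apply/(cm_Tc m); exists y; rewrite of_coordlK J'K.
  move=> /TcP[w e]; exists (tcoord w d).
  rewrite -[LHS]cm_jk jB -tcoord_i e of_coordlK J'K.
  exact: cm_jk.
- move=> u v uv; apply: Linj; apply: (can_inj JK).
  by rewrite -!jB uv.
Qed.

(** [psi y] is the point of [N] near [q] with centre coordinate [y], obtained by inverting that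
    coordinate locally. The dynamics of [f] on [N] is isometric in this coordinate, so the orbits on
    [N] are bounded and [i (psi y)] lies on the graph. *)
Lemma centre_manifold_param : exists (B : {linear F -> P}) (B' : {linear P -> F})
    (psi : P -> N) (t0 : R), [/\ continuous B /\ continuous B',
    cancel B B' /\ cancel B' B, 0 < t0 /\ t0 <= r, psi 0 = q
  & (forall y, unorm y < t0 -> i (psi y) = graph_map y /\ man_an (psi : vman P -> N) y) /\
    forall t, 0 < t -> t <= t0 -> open (psi @` [set y | unorm y < t])].
Proof.
have [B' cB' [BK B'K]] := B_inverse.
have cB : continuous B by exact: differential_cont.
have [ad dq] := svalP d; have [ac cp] := svalP c.
have [_ _ _ _ [g hg ig]] := cm.
have hgq x : man_an g x by exact: analytic_map_on_at hg _.
have gq : g q = q by apply: inji; rewrite ig iq fp.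
have de_q : de q = 0 by exact: coord_at_p.
have pe0 : pe 0 = q by exact: point_at0.
have h0 : h 0 = 0 by rewrite /h /ei pe0 iq coord_at_p linear0.
have hB_an : an_at (h \o B') 0.
  by apply: an_at_comp; [exact: an_at_linear|rewrite linear0].
have hB0 : (h \o B') 0 = 0 by rewrite /= linear0.
have DhB : differential (h \o B') 0 =1 id.
  move=> v; rewrite differential_comp ?linear0 //; last exact: an_at_linear.
  by rewrite differential_linear // B'K.
have [r1 [H [r10 hBb Hb HK]]] := local_inverse hB_an hB0 DhB.
have H_an y : unorm y < r1 -> an_at H y by move=> yr; exact: asball_an_at yr Hb.
have H0 : H 0 = 0.
  by apply/unorm_eq0; have [|_ -> _ _] := HK 0; rewrite unorm0.
have z1 : unorm (0 : P) < r1 by rewrite unorm0.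
have DH : differential H 0 =1 id.
  have near_inv : \forall y \near 0, (h \o B') (H y) = y.
    by apply: filterS (ball_near z1) => y yr; have [] := HK y yr.
  have ha : an_at (h \o B') (H 0) by rewrite H0.
  by move=> v; have := differential_inverse (H_an _ z1) ha near_inv v; rewrite H0 DhB.
have hH y : unorm y < r1 -> h (B' (H y)) = y by move=> yr; have [] := HK y yr.
have Hh z : unorm (B z) < r1 -> B' (H (h z)) = z.
  by move=> zr; have [_ _ _] := HK _ zr; rewrite /= BK => ->.
have Hnorm y : unorm y < r1 -> unorm (H y) = unorm y by move=> yr; have [] := HK y yr.
have BH_an : an_at (B' \o H) 0.
  by apply: an_at_comp; [exact: H_an|exact: an_at_linear].
have BH0 : (B' \o H) 0 = 0 by rewrite /= H0 linear0.
have e_BH_an : an_at ei ((B' \o H) 0) by rewrite BH0.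
have eBHD v : differential (ei \o (B' \o H)) 0 v = j v.
  rewrite differential_comp // BH0 eiD differential_comp ?differential_linear //.
  - by rewrite DH -jB B'K.
  - exact: H_an.
  - exact: an_at_linear.
have eBH0 : (ei \o (B' \o H)) 0 = 0 by rewrite /= H0 linear0 /ei pe0 iq coord_at_p.
have [r2 [H3 [r20 GK]]] := centre_dynamics_isometry (an_at_comp BH_an e_BH_an) eBH0 eBHD.
(* The self-map [g] of [N] in centre coordinates; [psiG] below confirms this. *)
pose GN y := k (fc (ei (B' (H y)))).
pose psi y := pe (B' (H y)).
(* The conditions on [g x] ensure that this point can also be recovered from its centre
   coordinate. *)
pose U := [set x : N | [/\ cdom (sval d) (g x), unorm (B (de (g x))) < r1,
  cdom (sval c) (i x) & unorm (chi (i x)) < r]].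
have man_de x : cdom (sval d) x -> man_an (de : N -> vman F) x.
  by move=> dx; exact: coord_at_man_an.
have near_de x : cdom (sval d) x -> unorm (B (de x)) < r1 ->
    nbhs x (cdom (sval d) `&` [set x | unorm (B (de x)) < r1]).
  move=> dx xr; apply: filterI; first exact: chart_nbhs (atlas_chart ad) dx.
  have [cde _] := man_de x dx; apply: (cde [set z : F | unorm (B z) < r1]).
  by have /cB := ball_near xr.
have nU : nbhs q U.
  have [cg _] := hgq q; have [ci _] := hi q.
  have n1 : nbhs (g q) (cdom (sval d) `&` [set x | unorm (B (de x)) < r1]).
    by rewrite gq; apply: near_de; rewrite // de_q linear0.
  have n2 : nbhs (i q) (cdom (sval c) `&` [set x | unorm (chi x) < r]).
    rewrite iq; apply: filterI; first exact: chart_nbhs (atlas_chart ac) cp.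
    have [cch _] := @coord_at_man_an _ _ _ _ _ _ c J cJ p cp; apply: (cch [set z | unorm z < r]).
    by rewrite coord_at_p; apply: ball_near; rewrite unorm0 cm_r0.
  apply: (@filterS _ _ (nbhs_filter q) _ _ _
    (@filterI _ _ (nbhs_filter q) _ _ (cg _ n1) (ci _ n2))) => x.
  by move=> [[h1 h2] [h3 h4]].
have idK : cancel idl idl by [].
have [r3 r30 hr3] := point_at_near d cidl idK nU.
have [r4 r40 hr4] : exists2 r4, 0 < r4 & forall y, unorm y < r4 -> unorm (B' (H y)) < r3.
  have n0 : nbhs ((B' \o H) 0) [set z | unorm z < r3].
    by rewrite BH0; apply: ball_near; rewrite unorm0.
  have [r4 r40 h4] := (nbhs_unormP _ _).1 (an_at_cont BH_an n0).
  by exists r4 => // y yr; apply: h4; rewrite /= subr0.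
(* The four radii are those of the model, the local inverse, the isometric dynamics, and the ball
   that [psi] maps into [U]. *)
pose t0 := Num.min r (Num.min r1 (Num.min r2 r4)).
have t00 : 0 < t0 by rewrite !lt_min (cm_r0 m) r10 r20.
have t0P y : unorm y < t0 -> [/\ unorm y < r, unorm y < r1, unorm y < r2 &
    unorm (B' (H y)) < r3].
  by rewrite !lt_min => /and4P[h1 h2 h3 /hr4].
have psiP y : unorm y < t0 -> [/\ U (psi y), cdom (sval d) (psi y) & de (psi y) = B' (H y)].
  by move=> /t0P[_ _ _ /hr3].
have psiG y : unorm y < t0 -> psi (GN y) = g (psi y).
  move=> yt; have [[u1 u2 u3 u4] dy dey] := psiP y yt.
  have -> : GN y = h (de (g (psi y))).
    by rewrite /GN /h /ei /pe /cm_f coord_atK // -ig coord_atK.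
  by rewrite /psi Hh // /pe coord_atK.
have kappa y : unorm y < t0 -> graph_coord (i (psi y)) = y.
  by move=> /t0P[_ h2 _ _]; exact: hH.
have on_graph y : unorm y < t0 -> i (psi y) = graph_map y.
  move=> yt.
  have [[_ _ h3 _] _ _] := psiP y yt.
  rewrite -[LHS](coord_atK JK h3) /graph_map; congr pt; move: y yt {h3}.
  apply: (isometric_orbits_on_graph (G := GN) (H := H3)) => [|y yt|y /t0P[_ _ /GK]] //.
    by rewrite ge_min lexx.
  have [[_ _ h3 h4] _ _] := psiP y yt; split; [exact: ltW|exact: kappa|].
  by rewrite psiG // ig /cm_f coord_atK.
exists B, B', psi, t0; split=> //.
- by split=> //; rewrite ge_min lexx.
- by rewrite /psi H0 linear0.
split.
  move=> y yt; split; first exact: on_graph.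
  have [_ dy dey] := psiP y yt; have [_ y1 _ _] := t0P y yt.
  apply: (@man_an_comp _ _ _ _ _ (vman P) (vman F) N (B' \o H) pe).
    by apply: vman_an; apply: an_at_comp; [exact: H_an|exact: an_at_linear].
  by apply: point_at_man_an => //.
move=> t tp tt0; rewrite openE => _ [y /= yt <-].
have yt0 : unorm y < t0 by exact: lt_le_trans tt0.
have [[u1 u2 u3 u4] dy dey] := psiP y yt0.
(* All [x] close to [psi y] satisfy [x = psi (graph_coord (i x))], with [graph_coord (i x)] still in
   the ball. *)
have n1 : nbhs (psi y) (cdom (sval d) `&` [set x | unorm (B (de x)) < r1]).
  by apply: near_de => //; have [_ y1 _ _] := t0P y yt0; rewrite dey B'K Hnorm.
have n2 : nbhs (psi y) [set x | unorm (graph_coord (i x)) < t].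
  have [cgi _] : man_an (graph_coord \o i : N -> vman P) (psi y).
    apply: (@man_an_comp _ _ _ _ _ N M (vman P)) => //.
    exact: graph_coord_man_an.
  by apply: (cgi [set z | unorm z < t]); rewrite /= kappa //; exact: ball_near.
apply: filterS (filterI n1 n2) => x [[dx xB] xt].
exists (graph_coord (i x)) => //.
rewrite -{2}(coord_atK idK dx) /psi; congr pe.
rewrite -[RHS](Hh _ xB); congr (B' (H _)).
by rewrite /h /ei /pe coord_atK.
Qed.

End parametrization.

(** * Uniqueness of the germ *)

Local Notation Gamma := graph_map.
Local Notation kappa := graph_coord.
Local Notation dyn := graph_dyn.

Lemma graph_preimage (T : Type) (i : T -> M) (psi : P -> T) t : injective i ->
  (forall y, unorm y < t -> i (psi y) = Gamma y) ->
  i @^-1` (Gamma @` [set y | unorm y < t]) = psi @` [set y | unorm y < t].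
Proof.
move=> inji h; apply/seteqP; split=> [x [y yt e]|_ [y yt <-]].
  by exists y => //; apply: inji; rewrite h.
by exists y => //; rewrite h.
Qed.

Lemma graph_chart_man_an (F : ultraBanach K) (N : manifold F) (i : N -> M) x y :
  man_an i x -> i x = Gamma y -> unorm y < r -> man_an (kappa \o i : N -> vman P) x.
Proof.
move=> hi e yr; apply: (@man_an_comp _ _ _ _ _ N M (vman P)) => //.
by apply: graph_coord_man_an; rewrite e; have [] := graph_dom yr.
Qed.

Section transition.
Variables (F1 F2 : ultraBanach K) (N1 : manifold F1) (N2 : manifold F2).
Variables (i1 : N1 -> M) (i2 : N2 -> M) (psi1 : P -> N1) (psi2 : P -> N2) (t : R).
Hypotheses (inj1 : injective i1) (hi1 : forall x, man_an i1 x) (tr : t <= r).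
Hypothesis h1 : forall y, unorm y < t -> i1 (psi1 y) = Gamma y.
Hypothesis h2 : forall y, unorm y < t ->
  i2 (psi2 y) = Gamma y /\ man_an (psi2 : vman P -> N2) y.
Hypothesis o1 : open (psi1 @` [set y | unorm y < t]).
Let U := Gamma @` [set y | unorm y < t].

(** Points of [N1] and [N2] with equal centre coordinates are the same point of the graph, so [psi2]
    composed with the centre coordinate on [N1] realises the identity. *)
Lemma germ_transition : exists2 h : N1 -> N2, analytic_map_on (i1 @^-1` U) h &
  forall x, U (i1 x) -> i2 (h x) = i1 x.
Proof.
exists (psi2 \o kappa \o i1) => [|x [y yt e]]; last first.
  by rewrite /= -e graph_mapK ?(lt_le_trans yt tr) //; have [] := h2 yt.
apply: analytic_map_onI; first by rewrite (graph_preimage inj1 h1).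
move=> x [y yt e]; have yr := lt_le_trans yt tr.
apply: (@man_an_comp _ _ _ _ _ N1 (vman P) N2 (kappa \o i1) psi2).
  exact: graph_chart_man_an (hi1 x) (esym e) yr.
by rewrite /= -e graph_mapK //; have [] := h2 yt.
Qed.

End transition.

Lemma centre_manifold_germ (F1 F2 : ultraBanach K) (N1 : manifold F1)
    (N2 : manifold F2) (i1 : N1 -> M) (i2 : N2 -> M) :
  centre_manifold M0 f Tc i1 -> centre_manifold M0 f Tc i2 -> same_germ p i1 i2.
Proof.
move=> cm1 cm2.
have [[inj1 [a1 _]] _ [q1 iq1 _] _ _] := cm1; have [[inj2 [a2 _]] _ [q2 iq2 _] _ _] := cm2.
have [d1 ad1 dq1] := atlas_cover q1; have [d2 ad2 dq2] := atlas_cover q2.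
have [B1 [B1' [psi1 [t1 [_ _ [t10 t1r] psi10 [h1 o1]]]]]] :=
  centre_manifold_param cm1 iq1 (exist _ d1 (conj ad1 dq1)).
have [B2 [B2' [psi2 [t2 [_ _ [t20 t2r] psi20 [h2 o2]]]]]] :=
  centre_manifold_param cm2 iq2 (exist _ d2 (conj ad2 dq2)).
pose t := Num.min t1 t2.
have t0 : 0 < t by rewrite lt_min t10.
have tt1 : t <= t1 by rewrite ge_min lexx.
have tt2 : t <= t2 by rewrite ge_min lexx orbT.
have tr : t <= r by exact: le_trans t1r.
have h1' y : unorm y < t -> i1 (psi1 y) = Gamma y /\ man_an (psi1 : vman P -> N1) y.
  by move=> yt; apply: h1; exact: lt_le_trans tt1.
have h2' y : unorm y < t -> i2 (psi2 y) = Gamma y /\ man_an (psi2 : vman P -> N2) y.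
  by move=> yt; apply: h2; exact: lt_le_trans tt2.
have o1' := o1 t t0 tt1; have o2' := o2 t t0 tt2.
have h1i y : unorm y < t -> i1 (psi1 y) = Gamma y by move=> /h1'[].
have h2i y : unorm y < t -> i2 (psi2 y) = Gamma y by move=> /h2'[].
exists (Gamma @` [set y | unorm y < t]); split.
- by exists 0; [rewrite /= unorm0|rewrite graph_map0].
- by split=> _ [y yt <-]; [exists (psi1 y); rewrite ?h1i|exists (psi2 y); rewrite ?h2i].
- by rewrite (graph_preimage inj1 h1i) (graph_preimage inj2 h2i).
- apply: (germ_transition inj1 _ tr h1i h2' o1') => x; exact: analytic_map_on_at a1 _.
- apply: (germ_transition inj2 _ tr h2i h1' o2') => x; exact: analytic_map_on_at a2 _.
Qed.

(** * Charts that flatten the graph *)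

Section straightening.
Variable t : R.
Hypotheses (t0 : 0 < t) (tr : t <= r).

(* z |-> z - dev z maps the graph of the centre manifold to the centre subspace *)
Let dev (z : cm_E m) : cm_E m := X 0 (k z) - j (k z).

Let kdev z : unorm z < t -> k (dev z) = 0.
Proof.
move=> zt; have kz : unorm (k z) < r.
  by apply: le_lt_trans (cm_knorm _) _; exact: lt_le_trans tr.
by rewrite /dev linearB /= cm_Xk // cm_jk subrr.
Qed.

Let dev_norm z : unorm z < t -> unorm (dev z) < t.
Proof.
move=> zt; have kz : unorm (k z) <= unorm z by exact: cm_knorm.
have kr : unorm (k z) < r by apply: le_lt_trans kz _; exact: lt_le_trans tr.
apply: (le_lt_trans _ zt); apply: unormB_le; last by rewrite cm_jnorm.
exact: le_trans (cm_Xnorm 0 kr) kz.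
Qed.

Let dev_an z : unorm z < t -> an_at dev z.
Proof.
move=> zt; have kr : unorm (k z) < r.
  by apply: le_lt_trans (cm_knorm _) _; exact: lt_le_trans tr.
have kan : an_at k z by apply: an_at_linear; exact: cmk_cont.
have h1 := an_at_comp kan (X_an_at 0 kr).
have jan : an_at j (k z) by apply: an_at_linear; exact: cmj_cont.
have h2 := an_at_comp kan jan.
exact: an_atB.
Qed.

Let V := cdom (sval c) `&` [set x | unorm (chi x) < t].
Let st (x : M) : E := J' (chi x - dev (chi x)).
Let unst (e : E) : M := point_at c J' (J e + dev (J e)).
Let kst z : unorm z < t -> k (z - dev z) = k z.
Proof. by move=> zt; rewrite linearB /= kdev // subr0. Qed.

(** [dev z] depends only on the centre part of [z] and has none itself, so [z |-> z - dev z] is a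
    shear with inverse [z |-> z + dev z]. *)
Let dev_k z z' : k z = k z' -> dev z = dev z'.
Proof. by rewrite /dev => ->. Qed.

Definition straight_chart : chart M E := Chart V st unst.

Let V_open : open V.
Proof.
have [ac _] := svalP c; rewrite openE => x [cx xt]; apply: filterI.
  exact: chart_nbhs (atlas_chart ac) cx.
have [cch _] := @coord_at_man_an _ _ _ _ _ _ c J cJ x cx.
by apply: (cch [set z | unorm z < t]); exact: ball_near.
Qed.

Let st_image : st @` V = [set e | unorm (J e) < t].
Proof.
apply/seteqP; split=> [_ [x [cx xt] <-]|e et].
  by rewrite /= /st J'K; apply: unormB_lt => //; exact: dev_norm.
have et' : unorm (J e + dev (J e)) < t by apply: unormD_lt => //; exact: dev_norm.
have [h1 h2 _ _] := cm_dom (lt_le_trans et' tr).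
exists (unst e); first by split=> //; rewrite /unst /= h2.
rewrite /st /unst h2 (@dev_k (J e + dev (J e)) (J e)) ?addrK ?JK //.
by rewrite linearD /= kdev // addr0.
Qed.

Let unstK x : V x -> unst (st x) = x.
Proof.
move=> [cx xt]; rewrite /unst /st J'K (@dev_k (chi x - dev (chi x)) (chi x)); last exact: kst.
by rewrite subrK coord_atK.
Qed.

Lemma straight_chart_atlas : atlas straight_chart.
Proof.
apply: atlas_man_an; first exact: V_open.
  rewrite st_image openE => e /= et.
  by have /cJ := ball_near et.
move=> x Vx; have [cx xt] := Vx; split; first exact: unstK.
  apply: (@man_an_comp _ _ _ _ _ M (vman (cm_E m)) (vman E) chi (fun z => J' (z - dev z))).
    exact: coord_at_man_an.
  apply: vman_an; apply: (@an_at_comp _ _ _ _ _ J' (fun z => z - dev z)); last exact: an_at_linear.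
  by apply: an_atB; [exact: an_at_id|exact: dev_an].
have et : unorm (J (st x)) < t.
  have : (st @` V) (st x) by exists x.
  by rewrite st_image.
have et' : unorm (J (st x) + dev (J (st x))) < t by apply: unormD_lt => //; exact: dev_norm.
have [h1 h2 _ _] := cm_dom (lt_le_trans et' tr).
apply: (@man_an_comp _ _ _ _ _ (vman E) (vman (cm_E m)) M (fun e => J e + dev (J e))).
  apply: vman_an; apply: an_atD; first exact: an_at_linear.
  by apply: (@an_at_comp _ _ _ _ _ dev J); [exact: an_at_linear|exact: dev_an].
exact: point_at_man_an.
Qed.

Lemma straight_chart_graph y : unorm y < t ->
  cdom straight_chart (Gamma y) /\ cmap straight_chart (Gamma y) = J' (j y).
Proof.
move=> yt; have yr := lt_le_trans yt tr; have [h1 h2 _] := graph_dom yr.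
split; first by split=> //=; rewrite h2; exact: le_lt_trans (cm_Xnorm 0 yr) yt.
by rewrite /= /st h2 /dev cm_Xk // opprB addrCA subrr addr0.
Qed.

Lemma straight_chart_adapted :
  adapted_chart (range (J' \o j)) (Gamma @` [set y | unorm y < t]) straight_chart.
Proof.
split; first exact: straight_chart_atlas.
rewrite /cimg; apply/seteqP; split.
  move=> _ [_ [[y yt <-] Vy] <-]; have [h1 h2] := straight_chart_graph yt.
  by split; [exists y; rewrite ?h2|exists (Gamma y)].
move=> _ [[y _ <-] [x Vx e]]; have yt : unorm y < t.
  have : (st @` V) (J' (j y)) by exists x.
  by rewrite st_image /= J'K cm_jnorm.
have [h1 h2] := straight_chart_graph yt.
by exists (Gamma y); [split=> //; exists y|].
Qed.

End straightening.

(** * Stable neighbourhoods inside a centre manifold *)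

Section stable_neighbourhoods.
Variables (F : ultraBanach K) (N : manifold F) (i : N -> M) (q : N).
Hypotheses (cm : centre_manifold M0 f Tc i) (iq : i q = p).
Variables (B : {linear F -> P}) (B' : {linear P -> F}) (psi : P -> N) (t : R).
Hypotheses (cB : continuous B) (cB' : continuous B') (BK : cancel B B')
  (B'K : cancel B' B) (t0 : 0 < t) (tr : t <= r) (psi0 : psi 0 = q).
Hypothesis psiP : forall y, unorm y < t ->
  i (psi y) = Gamma y /\ man_an (psi : vman P -> N) y.
Let Omega := psi @` [set y | unorm y < t].
Hypothesis oOmega : open Omega.
Local Notation T := (open_submanifold oOmega).
Let iOmega : T -> M := i \o set_val.

Let inji : injective i. Proof. by have [[]] := cm. Qed.

Let hi x : man_an i x.
Proof. by have [[_ [h _]] _ _ _ _] := cm; exact: analytic_map_on_at h _. Qed.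

Let ball_r (y : P) : unorm y < t -> unorm y < r.
Proof. by move=> yt; exact: lt_le_trans tr. Qed.

Let dynt n (y : P) : unorm y < t -> unorm (dyn n y) < t.
Proof. by move=> yt; exact: graph_dyn_lt. Qed.

Let kappaK y : unorm y < t -> kappa (i (psi y)) = y.
Proof. by move=> yt; have [-> _] := psiP yt; apply: graph_mapK; exact: ball_r. Qed.

Let Omega_ex (x : T) : exists2 y, unorm y < t & set_val x = psi y.
Proof. by have [y yt <-] := sub_valP x; exists y. Qed.

Let Omega_psi y : unorm y < t -> Omega (psi y).
Proof. by move=> yt; exists y. Qed.

Let image_Omega : i @` Omega = Gamma @` [set y | unorm y < t].
Proof.
apply/seteqP; split=> [_ [_ [y yt <-] <-]|_ [y yt <-]].
  by exists y => //; have [-> _] := psiP yt.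
by exists (psi y); [exact: Omega_psi|have [] := psiP yt].
Qed.

Let range_iOmega : range iOmega = i @` Omega.
Proof.
apply/seteqP; split=> [_ [x _ <-]|_ [x xO <-]].
  by exists (set_val x) => //; exact: sub_valP.
by have [y yx] := sub_val_ex oOmega xO; exists y; rewrite // /iOmega /= yx.
Qed.

Let Omegaq : Omega q. Proof. by exists 0; rewrite ?psi0 //= unorm0. Qed.

Let kappa_man_an x : Omega x -> man_an (kappa \o i : N -> vman P) x.
Proof.
move=> [y yt <-]; have [e _] := psiP yt.
exact: graph_chart_man_an (hi _) e (ball_r yt).
Qed.

Let f_psi y : unorm y < t -> f (i (psi y)) = i (psi (dyn 1 y)).
Proof.
move=> yt; have [-> _] := psiP yt; have [-> _] := psiP (dynt 1 yt).
by rewrite map_graph //; exact: ball_r.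
Qed.

Lemma stable_centre_manifold : centre_manifold M0 f Tc iOmega.
Proof.
have [[_ [_ imm]] iM0 [q' iq' rq] _ [g hg ig]] := cm.
have qq' : q' = q by apply: inji; rewrite iq'.
apply: (@centre_manifold_open _ _ _ _ _ oOmega _ _ _ _ q i g) => //.
- by move=> x y _ _ /inji.
- by move=> x _; have [h1 h2] := imm x.
- by move=> x _; apply: iM0; exists x.
- by rewrite -qq'.
- move=> x [y yt <-]; split=> //; first exact: analytic_map_on_at hg _.
  exists (dyn 1 y); first exact: dynt.
  by apply: inji; rewrite ig f_psi.
Qed.

Lemma stable_is_submanifold : is_submanifold (i @` Omega).
Proof.
exists (range (J' \o j)).
  exists (J' \o (j \o (k \o J))); split.
  - move=> x; apply: (@continuous_comp _ _ _ J (J' \o (j \o k))); first exact: cJ.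
    apply: continuous_comp; last exact: cJ'.
    by apply: continuous_comp; [exact: cmk_cont|exact: cmj_cont].
  - by move=> x; rewrite /= J'K cm_jk.
  - apply/seteqP; split=> [_ [x _ <-]|_ [y _ <-]]; first by exists (k (J x)).
    by exists (J' (j y)); rewrite //= J'K cm_jk.
move=> x; rewrite image_Omega => -[y yt <-]; exists (straight_chart t).
  exact: straight_chart_adapted.
by have [] := straight_chart_graph tr yt.
Qed.

Lemma stable_has_structure : has_submanifold_structure iOmega.
Proof.
have range_j : range (J' \o (j \o B)) = range (J' \o j).
  apply/seteqP; split=> [_ [x _ <-]|_ [y _ <-]]; first by exists (B x).
  by exists (B' y); rewrite //= B'K.
(* [B'] carries centre coordinates back to the modelling space of [N]; accordingly [F] embeds in [E]
   by [J' \o (j \o B)]. *)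
pose dN : chart N F := Chart Omega (B' \o (kappa \o i)) (psi \o B).
have adN : atlas dN.
  apply: atlas_man_an => //.
    rewrite (_ : _ @` _ = B @^-1` [set y | unorm y < t]).
      by rewrite openE => x xt; have /cB := ball_near xt.
    apply/seteqP; split=> [_ [_ [y yt <-] <-]|x xt] /=.
      by rewrite /= B'K kappaK.
    by exists (psi (B x)); [exact: Omega_psi|rewrite kappaK // BK].
  move=> x xO; have [y yt yx] := xO; split.
  - by rewrite /= B'K -yx kappaK.
  - apply: (@man_an_comp _ _ _ _ _ N (vman P) (vman F) (kappa \o i) B').
      exact: kappa_man_an.
    by apply: vman_an; exact: an_at_linear.
  - apply: (@man_an_comp _ _ _ _ _ (vman F) (vman P) N B psi).
      by apply: vman_an; exact: an_at_linear.
    by rewrite /= B'K -yx kappaK //; have [] := psiP yt.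
exists (J' \o (j \o B)), (B' \o (k \o J)); split.
- move=> x; apply: (@continuous_comp _ _ _ B (J' \o j)); first exact: cB.
  by apply: continuous_comp; [exact: cmj_cont|exact: cJ'].
- move=> x; apply: (@continuous_comp _ _ _ J (B' \o k)); first exact: cJ.
  by apply: continuous_comp; [exact: cmk_cont|exact: cB'].
- by move=> x; rewrite /= J'K cm_jk BK.
move=> x; have [s sK] := sub_retract x.
(* A single chart, the restriction of [dN], covers the whole neighbourhood. *)
pose d : chart T F :=
  Chart setT (fun x => B' (kappa (i (set_val x)))) (fun y => s (psi (B y))).
have ad : atlas d.
  apply: (sub_atlasE adN) => //=.
    by apply/seteqP; split=> // z _; exact: sub_valP.
  by move=> _ [_ [y yt <-] <-] /=; rewrite sK ?B'K ?kappaK //; exact: Omega_psi.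
have dom z : cdom (straight_chart t) (iOmega z).
  have [y yt yz] := Omega_ex z; rewrite /iOmega /= yz.
  by have [-> _] := psiP yt; have [] := straight_chart_graph tr yt.
exists (straight_chart t), d; split=> //.
- by split=> //; rewrite range_j range_iOmega image_Omega; exact: straight_chart_adapted.
- by apply/seteqP; split=> // z _; exact: dom.
move=> z _; have [y yt yz] := Omega_ex z.
have -> : iOmega z = Gamma y by rewrite /iOmega /= yz; have [] := psiP yt.
have [_ ->] := straight_chart_graph tr yt.
by rewrite /d [LHS]/= B'K yz kappaK.
Qed.

Lemma stable_image : f @` (i @` Omega) = i @` Omega.
Proof.
apply/seteqP; split=> [_ [_ [_ [y yt <-] <-] <-]|_ [_ [y yt <-] <-]].
  by exists (psi (dyn 1 y)); [exact: Omega_psi (dynt 1 yt)|rewrite f_psi].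
exists (i (psi (dyn (-1) y))).
  by exists (psi (dyn (-1) y)) => //; exact: Omega_psi (dynt _ yt).
by rewrite f_psi; [rewrite graph_dynK //; exact: ball_r|exact: dynt].
Qed.

(** Stated for all times [n], as 1 gives the restriction of [f] and -1 its inverse. *)
Let lift_an (s : N -> T) n : (forall x, Omega x -> set_val (s x) = x) ->
  analytic_map_on setT (fun x : T => s (psi (dyn n (kappa (i (set_val x)))))).
Proof.
move=> sK; apply: analytic_map_onI; first exact: openT.
move=> x _; apply: (@sub_lift_man_an _ _ _ _ _ oOmega _ T
  ((psi \o dyn n \o (kappa \o i)) \o set_val)).
  apply: filterE => z; have [y yt yz] := Omega_ex z.
  by rewrite /= yz kappaK // sK //; apply: Omega_psi; exact: dynt.
apply: sub_man_an; have [y yt yx] := Omega_ex x; rewrite yx.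
apply: (@man_an_comp _ _ _ _ _ N (vman P) N (kappa \o i) (psi \o dyn n)).
  exact: kappa_man_an (Omega_psi yt).
rewrite /= kappaK //.
apply: (@man_an_comp _ _ _ _ _ (vman P) (vman P) N (dyn n) psi).
  by apply: graph_dyn_man_an; exact: ball_r.
by have [] := psiP (dynt n yt).
Qed.

Lemma stable_diffeomorphism :
  exists2 h : T -> T, diffeomorphism h & forall x, iOmega (h x) = f (iOmega x).
Proof.
have [q' _] := sub_val_ex oOmega Omegaq; have [s sK] := sub_retract q'.
pose h n (x : T) := s (psi (dyn n (kappa (i (set_val x))))).
have hE n y z : unorm y < t -> set_val z = psi y -> set_val (h n z) = psi (dyn n y).
  by move=> yt yz; rewrite /h yz kappaK // sK //; apply: Omega_psi; exact: dynt.
exists (h 1); last first.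
  move=> x; have [y yt yx] := Omega_ex x.
  by rewrite /iOmega /= (hE 1 y) // yx f_psi.
split; first exact: lift_an.
exists (h (-1)); split; last exact: lift_an.
  move=> x; have [y yt yx] := Omega_ex x; apply: sub_val_inj.
  rewrite (hE (-1) (dyn 1 y)) ?graph_dynVK ?yx //; first exact: ball_r.
    exact: dynt.
  exact: hE.
move=> x; have [y yt yx] := Omega_ex x; apply: sub_val_inj.
rewrite (hE 1 (dyn (-1) y)) ?graph_dynK ?yx //; first exact: ball_r.
  exact: dynt.
exact: hE.
Qed.

End stable_neighbourhoods.
End model.

Arguments graph_map {R K E M M0 f p Tc} m _.

Theorem theorem1p10 (R : realType) (K : ultraField R) (E : ultraBanach K)
    (M : manifold E) (M0 : set M) (f : M -> M) (p : M)
    (Tc : set (tangent p)) :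
  open M0 -> analytic_map_on M0 f -> M0 p -> f p = p ->
  automorphism (tangent_map f p p) ->
  centre_subspace (tangent_map f p p) Tc ->
  [/\ exists (F : ultraBanach K) (N : manifold F) (i : N -> M),
        centre_manifold M0 f Tc i,
      forall (F1 F2 : ultraBanach K) (N1 : manifold F1) (N2 : manifold F2)
          (i1 : N1 -> M) (i2 : N2 -> M),
        centre_manifold M0 f Tc i1 -> centre_manifold M0 f Tc i2 ->
        same_germ p i1 i2
    & forall (F : ultraBanach K) (N : manifold F) (i : N -> M) (q : N),
        centre_manifold M0 f Tc i -> i q = p ->
        forall W : set N, nbhs q W ->
        exists (Omega : set N) (oOmega : open Omega),
          let iOmega : open_submanifold oOmega -> M := i \o set_val in
          [/\ Omega q /\ Omega `<=` W,
              centre_manifold M0 f Tc iOmega,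
              is_submanifold (i @` Omega) /\ has_submanifold_structure iOmega,
              f @` (i @` Omega) = i @` Omega
            & exists2 h : open_submanifold oOmega -> open_submanifold oOmega,
                diffeomorphism h & forall x, iOmega (h x) = f (iOmega x)]].
Proof.
move=> oM0 fan M0p fp _ csub.
have hf : man_an f p by exact: analytic_map_on_at fan _.
have [m _] := centre_model_ex oM0 fan M0p fp csub.
split.
- exists (cm_P m), (open_submanifold (N := vman (cm_P m)) (@ball_open _ _ _ (cm_r m))).
  by exists (graph_map m \o set_val); exact: graph_centre_manifold.
- by move=> F1 F2 N1 N2 i1 i2; exact: (centre_manifold_germ m hf fp).
move=> F N i q cm iq W nW.
have [d ad dq] := atlas_cover q.
have [B [B' [psi [t0 [[cB cB'] [BK B'K] [t00 t0r] psi0 [psiP oPsi]]]]]] :=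
  centre_manifold_param m hf fp cm iq (exist _ d (conj ad dq)).
have z : unorm (0 : cm_P m) < t0 by rewrite unorm0.
have [cpsi _] := (psiP 0 z).2.
have nW0 : nbhs (psi 0) W by rewrite psi0.
(* Continuity of [psi] at 0 provides balls whose images lie in the prescribed neighbourhood [W]. *)
have [t1 t10 ht1] := (nbhs_unormP _ _).1 (cpsi _ nW0).
pose t := Num.min t0 t1.
have tp : 0 < t by rewrite lt_min t00.
have tt0 : t <= t0 by rewrite ge_min lexx.
have tr : t <= cm_r m by exact: le_trans t0r.
have psiP' y : unorm y < t -> i (psi y) = graph_map m y /\ man_an (psi : vman (cm_P m) -> N) y.
  by move=> yt; apply: psiP; exact: lt_le_trans tt0.
have oO := oPsi t tp tt0.
exists (psi @` [set y | unorm y < t]), oO; split.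
- split; first by exists 0; rewrite ?psi0 //= unorm0.
  move=> _ [y yt <-]; apply: ht1; rewrite /= subr0.
  by apply: (lt_le_trans yt); rewrite ge_min lexx orbT.
- exact: (stable_centre_manifold cm iq tp tr psi0 psiP').
- split; first exact: (stable_is_submanifold tr psiP').
  exact: (stable_has_structure cm cB cB' BK B'K tr psiP').
- exact: (stable_image tr psiP').
- exact: (stable_diffeomorphism cm tp tr psi0 psiP').
Qed.
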